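(* For $L>0$ let $R$ be a rectangle of dimensions $L\times L^{-1}$, and let $\det\Delta_L$ be the zeta-regularized determinant of the Euclidean Laplacian on $R$ with Dirichlet boundary condition. Then $\det\Delta_L$ is uniquely maximized for $L=1$, and it tends to $0$ as $L\to0$ or equivalently as $L\to\infty$.
   Context: The spectrum of the Dirichlet Laplacian on the rectangle is $\{\pi^2m^2/L^2+\pi^2n^2L^2: m,n\in\mathbb{N},\ m,n\ge1\}$, counted with multiplicity. The spectral zeta function is $\zeta_L(s)=\sum_{m,n\geq 1}(\pi^2m^2/L^2+\pi^2n^2L^2)^{-s}$ for $\operatorname{Re}(s)>1$; it has a meromorphic extension to $\mathbb{C}$ holomorphic at $s=0$. The zeta-regularized determinant is $\det\Delta_L=e^{-\zeta_L'(0)}$. *)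

(* Defs.v *)
From Stdlib Require Import Reals ClassicalEpsilon.
From Coquelicot Require Import Coquelicot.

Open Scope R_scope.

(* Stdlib reals with Coquelicot's complex numbers. *)

Definition Cexp (z : C) : C :=
  (exp (Re z) * cos (Im z), exp (Re z) * sin (Im z)).

(* The complex power x^s; meaningful for x > 0 only. *)
Definition Rcpow (x : R) (s : C) : C := Cexp (s * RtoC (ln x))%C.

(* The derivative is the complex one: the scalars are [C_AbsRing]. *)
Definition holomorphic_at (f : C -> C) (z : C) : Prop :=
  locally z (fun w : C => @ex_derive C_AbsRing C_NormedModule f w).

(* [locally' z] is the filter of punctured neighbourhoods of z, so the value of
   f at a pole is irrelevant. *)
Definition meromorphic_at (f : C -> C) (z : C) : Prop :=
  exists (k : nat) (g : C -> C),
    holomorphic_at g z /\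
    locally' z (fun w : C => f w = (g w / (w - z) ^ k)%C).

Definition dirichlet_eigenvalue (L : R) (m n : nat) : R :=
  PI ^ 2 * INR m ^ 2 / L ^ 2 + PI ^ 2 * INR n ^ 2 * L ^ 2.

(* z is the sum over m, n >= 1 of the powers (eigenvalue m n)^(-s).  For
   Re s > 1 the double series converges absolutely, so that summing first over n
   and then over m is immaterial.  Series in Coquelicot start at 0, hence the
   successors. *)
Definition is_zeta_sum (L : R) (s z : C) : Prop :=
  exists u : nat -> C,
    (forall m : nat,
       @is_series C_AbsRing C_NormedModule
         (fun n : nat => Rcpow (dirichlet_eigenvalue L (S m) (S n)) (- s)%C)
         (u m)) /\
    @is_series C_AbsRing C_NormedModule u z.

Definition is_zeta_extension (L : R) (Z : C -> C) : Prop :=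
  (forall s : C, meromorphic_at Z s) /\
  (forall s : C, 1 < Re s -> is_zeta_sum L s (Z s)).

Definition is_zeta_det (L d : R) : Prop :=
  exists Z : C -> C,
    is_zeta_extension L Z /\
    holomorphic_at Z (RtoC 0) /\
    RtoC d = Cexp (- C_derive Z (RtoC 0))%C.

(* For L > 0 there is exactly one d with [is_zeta_det L d]: the spectral zeta
   function extends meromorphically to C, the extension is unique by the
   identity theorem, holomorphic at 0, and has a real derivative there. *)
Definition det_laplacian (L : R) : R :=
  epsilon (inhabits 0) (is_zeta_det L).

(* Main.v *)
(* With u = 1/L^2 one has zeta_L(s) = (pi^2/u)^(-s) W(s), where W(s) is the sum of
   ((m u)^2 + n^2)^(-s) over m, n >= 1.  Summing over n by the Euler-Maclaurin formula gives,
   with a = m u,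
     2 sum_n (n^2 + a^2)^(-s) = c(s) a^(1-2s) - a^(-2s) + R(a, s),
   where c(s) is the integral of (1 + x^2)^(-s), continued by (2s - 1) c(s) = 2s c(s + 1), and
   R(a, s) is entire in s and decays faster than any power of a.  Summing over m continues
   zeta_L: a remainder of order N reaches a half-plane Re s > - N/2, and the continuations are
   glued by the identity theorem.

   At s = 0 this gives - zeta_L'(0) = ln u / 4 + alpha u + sum_m ln (1 - e^(-2 pi m u)) + kappa:
   c(0) = 0, zeta(0) = -1/2, and the derivative of R(a, s) at s = 0 is - 2 ln (1 - e^(-2 pi a))
   by the product formula for sinh.  This is a strictly concave function of u; exchanging m and
   n shows that it is invariant under u -> 1/u.  Hence it is maximal at u = 1 only, and since it
   is bounded above, alpha < 0, so that it tends to - oo as u -> + oo.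

   The complex analysis rests on Goursat's theorem, used on rectangles in logarithmic
   coordinates w = z + a e^zeta: a function of period 2 i pi has equal integrals over the
   vertical sides.  Integrating against e^(-zeta) bounds f'(z); integrating against the kernels
   (1 + cosh zeta)^N, which concentrate at a point, gives the identity theorem. *)
Require Import Defs.
From Stdlib Require Import Reals ZArith Lra Lia Psatz Classical ClassicalEpsilon List.
From Coquelicot Require Import Coquelicot.
Open Scope R_scope.

(** * Complex derivatives and the complex exponential *)

(** The value at [s = 0] is needed only up to constants that do not depend on [L]. The numbers
    [alpha] and [kappa] are built from [zhat] and [ck], whose construction does not involve [u], and
    they are never evaluated. In the same spirit the derivative of the remainder is found from its
    differences in [a] together with its decay for large [a], which avoids Stirling's formula. What
    has to be quantitative is the remainder itself: its bound must be summable in [m] and in [n] at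
    once, and locally uniform in [s]. Since [det_laplacian] is chosen by [epsilon], the explicit
    continuation says something about it only through uniqueness, and the derivative at 0 has to be
    shown real; this follows from the symmetry under conjugation, again by uniqueness. Complex
    series, integrals and limits are treated by components, so that the real theory applies; this is
    the origin of the factors 2 in most bounds. *)

Local Notation RN := R_NormedModule.
Local Notation RCN := R_CompleteNormedModule.

Ltac by_Rmin H := eapply Rlt_le_trans; [exact H | first [apply Rmin_l | apply Rmin_r]].

Lemma Csub_diag (z : C) : (z - z)%C = 0%C.
Proof. ring. Qed.

(** Differentiability without quotients: [h = 0] needs no exception, and norm estimates apply to the
    increment directly. *)
Definition Cder (f : C -> C) (z l : C) : Prop :=
  forall eps : R, 0 < eps -> exists d : R, 0 < d /\
    forall h : C, Cmod h < d ->
      Cmod (f (z + h) - f z - h * l)%C <= eps * Cmod h.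

Definition Ccont (f : C -> C) (z : C) : Prop :=
  forall eps : R, 0 < eps -> exists d : R, 0 < d /\
    forall h : C, Cmod h < d -> Cmod (f (z + h) - f z)%C < eps.

Definition near (z : C) (P : C -> Prop) : Prop :=
  exists d : R, 0 < d /\ forall w : C, Cmod (w - z)%C < d -> P w.

Definition pnear (z : C) (P : C -> Prop) : Prop :=
  exists d : R, 0 < d /\ forall w : C, Cmod (w - z)%C < d -> w <> z -> P w.

Lemma locally_near (z : C) (P : C -> Prop) : locally z P <-> near z P.
Proof.
  split.
  - intros H. apply (proj1 (locally_C z P)) in H.
    destruct H as [e He]. exists e. split. apply cond_pos.
    intros w Hw. apply He. exact Hw.
  - intros [d [Hd H]].
    apply (proj2 (locally_C z P)).
    exists (mkposreal d Hd). intros w Hw. apply H. exact Hw.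
Qed.

Lemma locally'_pnear (z : C) (P : C -> Prop) : locally' z P <-> pnear z P.
Proof.
  unfold locally', within. rewrite locally_near. reflexivity.
Qed.

Lemma is_derive_Cder (f : C -> C) (z l : C) :
  @is_derive C_AbsRing C_NormedModule f z l <-> Cder f z l.
Proof.
  split.
  - intros [_ H] eps Heps.
    specialize (H z (fun P HP => HP) (mkposreal eps Heps)).
    destruct H as [d Hd]. exists d. split. apply cond_pos.
    intros h Hh. specialize (Hd (z + h)%C).
    assert (E : (z + h - z = h)%C) by ring.
    replace (f (z + h) - f z - h * l)%C with (f (z + h) - f z - (z + h - z) * l)%C
      by (rewrite E; ring).
    replace (Cmod h) with (Cmod (z + h - z)%C) by (f_equal; exact E). apply Hd.
    unfold ball; simpl. unfold AbsRing_ball. unfold abs, minus, plus, opp; simpl.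
    change (Cmod (z + h - z)%C < d). rewrite E. exact Hh.
  - intros H. split. apply is_linear_scal_l.
    intros w Hw. apply (@is_filter_lim_locally_unique C_AbsRing (AbsRing_NormedModule C_AbsRing)) in Hw. subst w.
    intros [eps Heps]. destruct (H eps Heps) as [d [Hd H1]].
    exists (mkposreal d Hd). intros w Hw.
    specialize (H1 (w - z)%C Hw).
    assert (E : (z + (w - z))%C = (w : C)) by (generalize (w : C); intros v; ring).
    rewrite E in H1. exact H1.
Qed.

(* Coquelicot's product and composition rules use the normed module that [C_AbsRing]
   induces on itself, which is not convertible to [C_NormedModule]. *)
Lemma is_derive_AbsRing_Cder (f : C -> C) (z l : C) :
  @is_derive C_AbsRing (AbsRing_NormedModule C_AbsRing) f z l <-> Cder f z l.
Proof.
  split.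
  - intros [_ H] eps Heps.
    specialize (H z (fun P HP => HP) (mkposreal eps Heps)).
    destruct H as [d Hd]. exists d. split. apply cond_pos.
    intros h Hh. specialize (Hd (z + h)%C).
    assert (E : (z + h - z = h)%C) by ring.
    replace (f (z + h) - f z - h * l)%C with (f (z + h) - f z - (z + h - z) * l)%C
      by (rewrite E; ring).
    replace (Cmod h) with (Cmod (z + h - z)%C) by (f_equal; exact E). apply Hd.
    unfold ball; simpl. unfold AbsRing_ball. unfold abs, minus, plus, opp; simpl.
    change (Cmod (z + h - z)%C < d). rewrite E. exact Hh.
  - intros H. split. apply (@is_linear_scal_l C_AbsRing (AbsRing_NormedModule C_AbsRing)).
    intros w Hw. apply (@is_filter_lim_locally_unique C_AbsRing (AbsRing_NormedModule C_AbsRing)) in Hw. subst w.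
    intros [eps Heps]. destruct (H eps Heps) as [d [Hd H1]].
    exists (mkposreal d Hd). intros w Hw.
    specialize (H1 (w - z)%C Hw).
    assert (E : (z + (w - z))%C = (w : C)) by (generalize (w : C); intros v; ring).
    rewrite E in H1. exact H1.
Qed.

Lemma ex_derive_Cder (f : C -> C) (z : C) :
  @ex_derive C_AbsRing C_NormedModule f z <-> exists l, Cder f z l.
Proof.
  split; intros [l H]; exists l; apply is_derive_Cder; exact H.
Qed.

Lemma Cder_C_derive (f : C -> C) (z l : C) : Cder f z l -> C_derive f z = l.
Proof. intros H. apply is_C_derive_unique, is_derive_Cder, H. Qed.

Lemma Cder_unique (f : C -> C) (z l1 l2 : C) : Cder f z l1 -> Cder f z l2 -> l1 = l2.
Proof.
  intros H1 H2. rewrite <- (Cder_C_derive _ _ _ H1). apply Cder_C_derive, H2.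
Qed.

Lemma Cder_ext_loc (f g : C -> C) (z l : C) :
  near z (fun w => f w = g w) -> Cder f z l -> Cder g z l.
Proof.
  intros [d1 [Hd1 E]] H eps Heps. destruct (H eps Heps) as [d [Hd H1]].
  exists (Rmin d d1). split. apply Rmin_glb_lt; lra.
  intros h Hh.
  rewrite <- (E (z + h)%C), <- (E z).
  apply H1. eapply Rlt_le_trans. exact Hh. apply Rmin_l.
  rewrite Csub_diag, Cmod_0. lra.
  replace (z + h - z)%C with h by ring. eapply Rlt_le_trans. exact Hh. apply Rmin_r.
Qed.

Lemma Cder_ext (f g : C -> C) (z l : C) :
  (forall w, f w = g w) -> Cder f z l -> Cder g z l.
Proof. intros E. apply Cder_ext_loc. exists 1. split. lra. intros; apply E. Qed.

Lemma Cder_const (a z : C) : Cder (fun _ => a) z 0%C.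
Proof.
  intros eps He. exists 1. split. lra. intros h _.
  replace (a - a - h * 0)%C with (RtoC 0) by ring. rewrite Cmod_0.
  apply Rmult_le_pos. lra. apply Cmod_ge_0.
Qed.

Lemma Cder_id (z : C) : Cder (fun w => w) z 1%C.
Proof.
  intros eps He. exists 1. split. lra. intros h _.
  replace (z + h - z - h * 1)%C with (RtoC 0) by ring. rewrite Cmod_0.
  apply Rmult_le_pos. lra. apply Cmod_ge_0.
Qed.

Lemma Cder_plus (f g : C -> C) (z lf lg : C) :
  Cder f z lf -> Cder g z lg -> Cder (fun w => f w + g w)%C z (lf + lg)%C.
Proof.
  intros H1 H2. apply is_derive_Cder in H1, H2. apply is_derive_Cder.
  exact (is_derive_plus _ _ _ _ _ H1 H2).
Qed.

Lemma Cder_mult (f g : C -> C) (z lf lg : C) :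
  Cder f z lf -> Cder g z lg ->
  Cder (fun w => f w * g w)%C z (lf * g z + f z * lg)%C.
Proof.
  intros H1 H2. apply is_derive_AbsRing_Cder in H1, H2. apply is_derive_AbsRing_Cder.
  refine (is_derive_mult _ _ _ _ _ H1 H2 _). intros; apply Cmult_comm.
Qed.

Lemma Cder_comp (f g : C -> C) (z lf lg : C) :
  Cder f (g z) lf -> Cder g z lg -> Cder (fun w => f (g w)) z (lg * lf)%C.
Proof.
  intros H1 H2. apply is_derive_Cder in H1. apply is_derive_AbsRing_Cder in H2.
  apply is_derive_Cder. exact (is_derive_comp _ _ _ _ _ H1 H2).
Qed.

Lemma Cder_scal (f : C -> C) (z a l : C) :
  Cder f z l -> Cder (fun w => a * f w)%C z (a * l)%C.
Proof.
  intros H. replace (a * l)%C with (0 * f z + a * l)%C by ring.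
  apply (Cder_mult (fun _ => a) f). apply Cder_const. exact H.
Qed.

Lemma Cder_opp (f : C -> C) (z l : C) : Cder f z l -> Cder (fun w => - f w)%C z (- l)%C.
Proof.
  intros H. replace (- l)%C with ((-1) * l)%C by ring.
  apply Cder_ext with (fun w => (-1) * f w)%C. intros; ring.
  apply Cder_scal, H.
Qed.

Lemma Cder_minus (f g : C -> C) (z lf lg : C) :
  Cder f z lf -> Cder g z lg -> Cder (fun w => f w - g w)%C z (lf - lg)%C.
Proof. intros H1 H2. apply (Cder_plus f (fun w => - g w)%C). exact H1. apply Cder_opp, H2. Qed.

Lemma Cder_Ccont (f : C -> C) (z l : C) : Cder f z l -> Ccont f z.
Proof.
  intros H eps He. destruct (H 1 Rlt_0_1) as [d [Hd H1]].
  pose proof (Cmod_ge_0 l) as Hl.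
  exists (Rmin d (eps / (2 + Cmod l))). split.
  apply Rmin_glb_lt. lra. apply Rdiv_lt_0_compat; lra.
  intros h Hh.
  assert (h1 : Cmod h < d) by (by_Rmin Hh).
  assert (h2 : Cmod h < eps / (2 + Cmod l)) by (by_Rmin Hh).
  specialize (H1 h h1).
  replace (f (z + h) - f z)%C with ((f (z + h) - f z - h * l) + h * l)%C by ring.
  eapply Rle_lt_trans. apply Cmod_triangle. rewrite Cmod_mult.
  apply Rle_lt_trans with (Cmod h * (1 + Cmod l)). lra.
  apply Rle_lt_trans with (Cmod h * (2 + Cmod l)).
  pose proof (Cmod_ge_0 h); nra.
  apply Rmult_lt_compat_r with (r := 2 + Cmod l) in h2; [|lra].
  replace (eps / (2 + Cmod l) * (2 + Cmod l)) with eps in h2 by (field; lra). exact h2.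
Qed.

Lemma Cmod_le_abs (z : C) : Cmod z <= Rabs (fst z) + Rabs (snd z).
Proof.
  unfold Cmod. apply Rle_trans with (sqrt ((Rabs (fst z) + Rabs (snd z))^2)).
  apply sqrt_le_1_alt. rewrite <- (pow2_abs (fst z)), <- (pow2_abs (snd z)).
  pose proof (Rabs_pos (fst z)); pose proof (Rabs_pos (snd z)). nra.
  rewrite sqrt_pow2. lra. pose proof (Rabs_pos (fst z)); pose proof (Rabs_pos (snd z)); lra.
Qed.

Lemma abs_fst_le_Cmod (z : C) : Rabs (fst z) <= Cmod z.
Proof. eapply Rle_trans. apply Rmax_l. apply Rmax_Cmod. Qed.

Lemma abs_snd_le_Cmod (z : C) : Rabs (snd z) <= Cmod z.
Proof. eapply Rle_trans. apply Rmax_r. apply Rmax_Cmod. Qed.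

Lemma Cmod_sub_sym (a b : C) : Cmod (a - b)%C = Cmod (b - a)%C.
Proof. rewrite <- Cmod_opp. f_equal. ring. Qed.

Lemma Ceq (z w : C) : fst z = fst w -> snd z = snd w -> z = w.
Proof. destruct z, w; simpl; intros; subst; reflexivity. Qed.

(* [1 / (z + h) - 1 / z + h / z^2 = h^2 / (z^2 (z + h))] *)
Lemma Cder_inv_id (z : C) : z <> 0%C -> Cder (fun w => / w)%C z (- / (z * z))%C.
Proof.
  intros Hz eps He.
  assert (Hm : 0 < Cmod z) by (apply Cmod_gt_0; exact Hz).
  set (m := Cmod z) in *.
  assert (P : 0 < eps * (m * m * m) / 2).
  { apply Rdiv_lt_0_compat; [|lra]. repeat apply Rmult_lt_0_compat; lra. }
  exists (Rmin (m / 2) (eps * (m * m * m) / 2)). split.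
  apply Rmin_glb_lt; lra.
  intros h Hh.
  assert (h1 : Cmod h < m / 2) by (by_Rmin Hh).
  assert (h2 : Cmod h < eps * (m * m * m) / 2) by (by_Rmin Hh).
  assert (Hzh : m / 2 < Cmod (z + h)).
  { pose proof (Cmod_triangle (z + h) (- h)) as T.
    replace (z + h + - h)%C with z in T by ring. rewrite Cmod_opp in T. fold m in T. lra. }
  assert (Nzh : (z + h)%C <> 0%C) by (apply Cmod_gt_0; lra).
  replace (/ (z + h) - / z - h * - / (z * z))%C with (h * (h / (z * z * (z + h))))%C
    by (field; split; assumption).
  rewrite Cmod_mult, Rmult_comm. apply Rmult_le_compat_r. apply Cmod_ge_0.
  rewrite Cmod_div, !Cmod_mult.
  2:{ repeat apply Cmult_neq_0; assumption. }
  fold m. apply Rle_div_l. repeat apply Rmult_lt_0_compat; lra.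
  assert (eps * (m * m * (m/2)) <= eps * (m * m * Cmod (z + h))).
  { apply Rmult_le_compat_l. lra. apply Rmult_le_compat_l; nra. }
  lra.
Qed.

Lemma Cder_inv (f : C -> C) (z l : C) : f z <> 0%C -> Cder f z l ->
  Cder (fun w => / f w)%C z (- l / (f z * f z))%C.
Proof.
  intros Hz H. replace (- l / (f z * f z))%C with (l * - / (f z * f z))%C by (field; auto).
  apply (Cder_comp (fun w => / w)%C f). apply Cder_inv_id, Hz. exact H.
Qed.

Lemma Cexp_plus (z w : C) : Cexp (z + w) = (Cexp z * Cexp w)%C.
Proof.
  unfold Cexp. apply Ceq; simpl.
  - rewrite exp_plus, cos_plus. unfold Im, Re. ring.
  - rewrite exp_plus, sin_plus. unfold Im, Re. ring.
Qed.

Lemma Cexp_0 : Cexp 0 = 1%C.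
Proof. unfold Cexp. apply Ceq; simpl; rewrite exp_0, ?cos_0, ?sin_0; ring. Qed.

Lemma Cmod_Cexp (z : C) : Cmod (Cexp z) = exp (Re z).
Proof.
  unfold Cmod, Cexp; simpl.
  replace (_ + _) with (Rsqr (exp (Re z))).
  rewrite sqrt_Rsqr. reflexivity. apply Rlt_le, exp_pos.
  pose proof (sin2_cos2 (Im z)) as H. unfold Rsqr in *.
  transitivity (exp (Re z) * exp (Re z) * (sin (Im z) * sin (Im z) + cos (Im z) * cos (Im z))).
  rewrite H. ring. ring.
Qed.

Lemma Cexp_neq_0 (z : C) : Cexp z <> 0%C.
Proof. apply Cmod_gt_0. rewrite Cmod_Cexp. apply exp_pos. Qed.

Lemma is_derive_first_order (f : R -> R) (l : R) : is_derive f 0 l ->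
  forall eps, 0 < eps -> exists d, 0 < d /\ forall x, Rabs x < d ->
    Rabs (f x - f 0 - l * x) <= eps * Rabs x.
Proof.
  intros [_ H] eps He. specialize (H 0 (fun P HP => HP) (mkposreal eps He)).
  destruct H as [d Hd]. exists d. split. apply cond_pos. intros x Hx.
  specialize (Hd x). unfold ball, norm, minus, plus, opp, scal in Hd; simpl in Hd.
  unfold AbsRing_ball, abs, minus, plus, opp, mult in Hd; simpl in Hd. unfold mult in Hd; simpl in Hd.
  replace (x + - 0) with x in Hd by ring.
  replace (f x + - f 0 + - (x * l)) with (f x - f 0 - l * x) in Hd by ring. auto.
Qed.

Lemma Cder_Cexp_0 : Cder Cexp 0 1.
Proof.
  (* The errors add up to [7 * (e * t)], so a tenth of [eps] suffices; [e <= 1 / 10] keeps the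
     factor [1 + x + a] below 2. *)
  intros eps He. set (e := Rmin 1 eps / 10).
  assert (He' : 0 < e) by (unfold e; apply Rdiv_lt_0_compat; [apply Rmin_glb_lt; lra|lra]).
  assert (e1 : e <= 1 / 10) by (unfold e; pose proof (Rmin_l 1 eps); lra).
  assert (e2 : 10 * e <= eps) by (unfold e; pose proof (Rmin_r 1 eps); lra).
  destruct (is_derive_first_order exp 1) with (eps := e) as [d1 [Hd1 H1]].
  { auto_derive; auto. rewrite exp_0; ring. } exact He'.
  destruct (is_derive_first_order cos 0) with (eps := e) as [d2 [Hd2 H2]].
  { auto_derive; auto. rewrite sin_0; ring. } exact He'.
  destruct (is_derive_first_order sin 1) with (eps := e) as [d3 [Hd3 H3]].
  { auto_derive; auto. rewrite cos_0; ring. } exact He'.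
  exists (Rmin (Rmin d1 d2) (Rmin d3 e)). split.
  repeat apply Rmin_glb_lt; lra.
  intros [x y] Hh.
  pose proof (abs_fst_le_Cmod (x, y)) as Hx. pose proof (abs_snd_le_Cmod (x, y)) as Hy.
  simpl in Hx, Hy.
  set (t := Cmod (x, y)) in *.
  pose proof (Rmin_l (Rmin d1 d2) (Rmin d3 e)). pose proof (Rmin_r (Rmin d1 d2) (Rmin d3 e)).
  pose proof (Rmin_l d1 d2). pose proof (Rmin_r d1 d2).
  pose proof (Rmin_l d3 e). pose proof (Rmin_r d3 e).
  assert (A1 := H1 x ltac:(lra)). assert (A2 := H2 y ltac:(lra)). assert (A3 := H3 y ltac:(lra)).
  rewrite exp_0 in A1. rewrite cos_0 in A2. rewrite sin_0 in A3.
  replace (0 + (x, y))%C with (x, y) by (apply Ceq; simpl; ring).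
  rewrite Cexp_0.
  eapply Rle_trans. apply Cmod_le_abs. unfold Cexp; simpl.
  set (a := exp x - 1 - 1 * x) in *. set (b := cos y - 1 - 0 * y) in *. set (c := sin y - 0 - 1 * y) in *.
  replace (exp x) with (1 + x + a) by (unfold a; ring).
  replace (cos y) with (1 + b) by (unfold b; ring).
  replace (sin y) with (y + c) by (unfold c; ring).
  replace ((1 + x + a) * (1 + b) + - (1) + - (x * 1 - y * 0)) with (a + b * (1 + x + a)) by ring.
  replace ((1 + x + a) * (y + c) + - 0 + - (x * 0 + y * 1)) with ((x + a) * y + c * (1 + x + a)) by ring.
  assert (T0 : 0 <= t) by (unfold t; apply Cmod_ge_0).
  assert (Ba : Rabs a <= e * t).
  { eapply Rle_trans. exact A1. apply Rmult_le_compat_l; lra. }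
  assert (Bb : Rabs b <= e * t).
  { eapply Rle_trans. exact A2. apply Rmult_le_compat_l; lra. }
  assert (Bc : Rabs c <= e * t).
  { eapply Rle_trans. exact A3. apply Rmult_le_compat_l; lra. }
  assert (Te : t < e) by lra.
  assert (B1 : Rabs (1 + x + a) <= 2).
  { eapply Rle_trans. apply Rabs_triang. assert (Rabs (1 + x) <= 1 + Rabs x).
    eapply Rle_trans. apply Rabs_triang. rewrite Rabs_R1. lra. nra. }
  assert (B2 : Rabs (x + a) <= 2 * t).
  { eapply Rle_trans. apply Rabs_triang. nra. }
  assert (U1 : Rabs (a + b * (1 + x + a)) <= 3 * (e * t)).
  { eapply Rle_trans. apply Rabs_triang. rewrite Rabs_mult.
    assert (Rabs b * Rabs (1 + x + a) <= e * t * 2). apply Rmult_le_compat; try apply Rabs_pos; lra. lra. }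
  assert (U2 : Rabs ((x + a) * y + c * (1 + x + a)) <= 4 * (e * t)).
  { eapply Rle_trans. apply Rabs_triang. rewrite !Rabs_mult.
    assert (Rabs c * Rabs (1 + x + a) <= e * t * 2). apply Rmult_le_compat; try apply Rabs_pos; lra.
    assert (Rabs (x + a) * Rabs y <= 2 * t * e). apply Rmult_le_compat; try apply Rabs_pos; lra. lra. }
  apply Rle_trans with (7 * (e * t)). lra.
  nra.
Qed.

Lemma Cder_Cexp (z : C) : Cder Cexp z (Cexp z).
Proof.
  intros eps He. pose proof (exp_pos (Re z)) as P.
  destruct (Cder_Cexp_0 (eps / exp (Re z))) as [d [Hd H]].
  apply Rdiv_lt_0_compat; lra.
  exists d. split. exact Hd. intros h Hh. specialize (H h Hh).
  replace (0 + h)%C with h in H by ring. rewrite Cexp_0 in H.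
  rewrite Cexp_plus.
  replace (Cexp z * Cexp h - Cexp z - h * Cexp z)%C with (Cexp z * (Cexp h - 1 - h * 1))%C by ring.
  rewrite Cmod_mult, Cmod_Cexp.
  apply Rmult_le_compat_l with (r := exp (Re z)) in H; [|lra].
  replace (exp (Re z) * (eps / exp (Re z) * Cmod h)) with (eps * Cmod h) in H by (field; lra).
  exact H.
Qed.

Lemma Cder_Rcpow (x : R) (s : C) : Cder (Rcpow x) s (ln x * Rcpow x s)%C.
Proof.
  unfold Rcpow. apply (Cder_comp Cexp (fun s => s * ln x)%C). apply Cder_Cexp.
  assert (E : (1 * ln x + s * 0)%C = RtoC (ln x)) by ring.
  pose proof (Cder_mult (fun s => s) (fun _ => RtoC (ln x)) s _ _ (Cder_id s) (Cder_const _ s)) as H.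
  cbv beta in H. rewrite E in H. exact H.
Qed.

Lemma Cmod_Rcpow (x : R) (s : C) : Cmod (Rcpow x s) = exp (Re s * ln x).
Proof. unfold Rcpow. rewrite Cmod_Cexp. f_equal. unfold Re; simpl. ring. Qed.

Lemma Rcpow_plus (x : R) (s t : C) : Rcpow x (s + t) = (Rcpow x s * Rcpow x t)%C.
Proof. unfold Rcpow. rewrite <- Cexp_plus. f_equal. ring. Qed.

Lemma Rcpow_0 (x : R) : Rcpow x 0 = 1%C.
Proof. unfold Rcpow. rewrite <- Cexp_0. f_equal. ring. Qed.

Lemma Rcpow_mult_base (x y : R) (s : C) : 0 < x -> 0 < y ->
  Rcpow (x * y) s = (Rcpow x s * Rcpow y s)%C.
Proof.
  intros Hx Hy. unfold Rcpow. rewrite <- Cexp_plus, ln_mult, RtoC_plus by assumption.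
  f_equal. ring.
Qed.

Lemma Rcpow_1 (x : R) : 0 < x -> Rcpow x 1 = RtoC x.
Proof.
  intros Hx. unfold Rcpow, Cexp. apply Ceq; unfold Re, Im; simpl.
  replace (1 * ln x - 0 * 0) with (ln x) by ring.
  replace (1 * 0 + 0 * ln x) with 0 by ring. rewrite exp_ln, cos_0 by assumption. ring.
  replace (1 * 0 + 0 * ln x) with 0 by ring. rewrite sin_0. ring.
Qed.

Lemma Rcpow_base_1 (s : C) : Rcpow 1 s = 1%C.
Proof. unfold Rcpow. rewrite ln_1, <- Cexp_0. f_equal. ring. Qed.

Lemma exp_le (x y : R) : x <= y -> exp x <= exp y.
Proof.
  intros [H | ->]. apply Rlt_le, exp_increasing, H. apply Rle_refl.
Qed.

(** * Goursat's theorem *)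

Definition frechet (P : R -> R -> R) (u v p1 p2 : R) : Prop :=
  forall eps, 0 < eps -> exists d, 0 < d /\
    forall x y, Rabs (x - u) < d -> Rabs (y - v) < d ->
      Rabs (P x y - P u v - p1 * (x - u) - p2 * (y - v)) <=
      eps * (Rabs (x - u) + Rabs (y - v)).

(* The form P dx + Q dy is differentiable and closed at the point (u, v). *)
Definition closed_form (P Q : R -> R -> R) (u v : R) : Prop :=
  exists p1 p2 q2, frechet P u v p1 p2 /\ frechet Q u v p2 q2.

(** The counterclockwise integral of [P dx + Q dy] along the boundary of [[a, b] x [c, d]]. *)
Definition rect_int (P Q : R -> R -> R) (a b c d : R) : R :=
  RInt (fun x => P x c) a b - RInt (fun x => P x d) a b
  + (RInt (fun y => Q b y) c d - RInt (fun y => Q a y) c d).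

Lemma frechet_cont (P : R -> R -> R) (u v p1 p2 : R) : frechet P u v p1 p2 ->
  forall eps, 0 < eps -> exists d, 0 < d /\
    forall x y, Rabs (x - u) < d -> Rabs (y - v) < d -> Rabs (P x y - P u v) < eps.
Proof.
  intros H eps He. destruct (H 1 Rlt_0_1) as [d [Hd H1]].
  pose proof (Rabs_pos p1); pose proof (Rabs_pos p2).
  set (K := 2 + Rabs p1 + Rabs p2).
  exists (Rmin d (eps / (2 * K))). split.
  apply Rmin_glb_lt; [lra|]. apply Rdiv_lt_0_compat; unfold K; lra.
  intros x y Hx Hy.
  assert (Hx2 : Rabs (x - u) < eps / (2 * K)) by (by_Rmin Hx).
  assert (Hy2 : Rabs (y - v) < eps / (2 * K)) by (by_Rmin Hy).
  assert (H3 := H1 x y ltac:(by_Rmin Hx)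
                        ltac:(by_Rmin Hy)).
  set (t := eps / (2 * K)) in *.
  assert (Et : eps = 2 * K * t) by (unfold t; field; unfold K; lra).
  replace (P x y - P u v) with
    ((P x y - P u v - p1 * (x - u) - p2 * (y - v)) + (p1 * (x - u) + p2 * (y - v))) by ring.
  eapply Rle_lt_trans. apply Rabs_triang.
  assert (Rabs (p1 * (x - u) + p2 * (y - v)) <= Rabs p1 * t + Rabs p2 * t).
  { eapply Rle_trans. apply Rabs_triang. rewrite !Rabs_mult.
    apply Rplus_le_compat; apply Rmult_le_compat_l; lra. }
  assert (0 < t) by (unfold t; apply Rdiv_lt_0_compat; unfold K; lra).
  unfold K in *. nra.
Qed.

Lemma continuous_eps (f : R -> R) (x : R) :
  (forall eps, 0 < eps -> exists d, 0 < d /\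
     forall y, Rabs (y - x) < d -> Rabs (f y - f x) < eps) -> continuous f x.
Proof.
  intros H. apply continuity_pt_filterlim. apply continuity_pt_locally.
  intros [eps He]. destruct (H eps He) as [d [Hd H1]].
  exists (mkposreal d Hd). intros y Hy. apply H1. exact Hy.
Qed.

Lemma frechet_continuous_l (P : R -> R -> R) (u v p1 p2 : R) :
  frechet P u v p1 p2 -> continuous (fun x => P x v) u.
Proof.
  intros H. apply continuous_eps. intros eps He.
  destruct (frechet_cont _ _ _ _ _ H eps He) as [d [Hd H1]].
  exists d. split; [exact Hd|]. intros y Hy. apply H1. exact Hy.
  replace (v - v) with 0 by ring. rewrite Rabs_R0. exact Hd.
Qed.

Lemma frechet_continuous_r (P : R -> R -> R) (u v p1 p2 : R) :
  frechet P u v p1 p2 -> continuous (fun y => P u y) v.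
Proof.
  intros H. apply continuous_eps. intros eps He.
  destruct (frechet_cont _ _ _ _ _ H eps He) as [d [Hd H1]].
  exists d. split; [exact Hd|]. intros y Hy. apply H1; [|exact Hy].
  replace (u - u) with 0 by ring. rewrite Rabs_R0. exact Hd.
Qed.

Lemma ex_RInt_cont (f : R -> R) (a b : R) : a <= b ->
  (forall x, a <= x <= b -> continuous f x) -> ex_RInt f a b.
Proof.
  intros Hab H. apply (ex_RInt_continuous (V := RCN)). intros z Hz.
  rewrite Rmin_left, Rmax_right in Hz by assumption. apply H, Hz.
Qed.

Section Goursat.

Variables P Q : R -> R -> R.

Definition closed_on (a b c d : R) : Prop :=
  forall u v, a <= u <= b -> c <= v <= d -> closed_form P Q u v.

Lemma closed_on_int_l a b c d : closed_on a b c d -> forall x1 x2 y,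
  a <= x1 -> x1 <= x2 -> x2 <= b -> c <= y <= d -> ex_RInt (fun x => P x y) x1 x2.
Proof.
  intros H x1 x2 y H1 H2 H3 H4. apply ex_RInt_cont. exact H2.
  intros x Hx. destruct (H x y ltac:(lra) H4) as (p1 & p2 & q2 & HP & HQ).
  eapply frechet_continuous_l; eassumption.
Qed.

Lemma closed_on_int_r a b c d : closed_on a b c d -> forall x y1 y2,
  a <= x <= b -> c <= y1 -> y1 <= y2 -> y2 <= d -> ex_RInt (fun y => Q x y) y1 y2.
Proof.
  intros H x y1 y2 H1 H2 H3 H4. apply ex_RInt_cont. exact H3.
  intros y Hy. destruct (H x y H1 ltac:(lra)) as (p1 & p2 & q2 & HP & HQ).
  eapply frechet_continuous_r; eassumption.
Qed.

Lemma rect_int_split_x a b c d m : closed_on a b c d -> a <= m <= b -> c <= d ->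
  rect_int P Q a b c d = rect_int P Q a m c d + rect_int P Q m b c d.
Proof.
  intros H Hm Hcd. unfold rect_int.
  rewrite <- (RInt_Chasles (fun x => P x c) a m b), <- (RInt_Chasles (fun x => P x d) a m b).
  unfold plus; simpl. ring.
  all: eapply closed_on_int_l; try eassumption; lra.
Qed.

Lemma rect_int_split_y a b c d m : closed_on a b c d -> c <= m <= d -> a <= b ->
  rect_int P Q a b c d = rect_int P Q a b c m + rect_int P Q a b m d.
Proof.
  intros H Hm Hab. unfold rect_int.
  rewrite <- (RInt_Chasles (fun y => Q a y) c m d), <- (RInt_Chasles (fun y => Q b y) c m d).
  unfold plus; simpl. ring.
  all: eapply closed_on_int_r; try eassumption; lra.
Qed.

Lemma RInt_near_const (f g : R -> R) (a b k e : R) : a <= b ->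
  ex_RInt f a b -> ex_RInt g a b ->
  (forall x, a <= x <= b -> Rabs (f x - g x - k) <= e) ->
  Rabs (RInt f a b - RInt g a b - k * (b - a)) <= e * (b - a).
Proof.
  intros Hab Hf Hg H.
  assert (E1 : RInt f a b - RInt g a b - k * (b - a) = RInt (fun x => minus (minus (f x) (g x)) k) a b).
  { rewrite (RInt_minus (fun x => minus (f x) (g x)) (fun _ => k)).
    rewrite (RInt_minus f g), RInt_const by assumption.
    unfold minus, plus, opp, scal; simpl. unfold mult; simpl. ring.
    apply (ex_RInt_minus f g); assumption. apply ex_RInt_const. }
  rewrite E1, Rmult_comm. apply abs_RInt_le_const. exact Hab.
  apply (ex_RInt_minus (fun x => minus (f x) (g x)) (fun _ => k)).
  apply (ex_RInt_minus f g); assumption. apply ex_RInt_const.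
  intros t Ht. apply (H t Ht).
Qed.

(** The affine parts of [P] and [Q] cancel around the boundary: [P] contributes [p2 (c - d) (b - a)]
    and [Q] contributes [p2 (b - a) (d - c)]. Closedness enters in that both carry the same [p2];
    only the errors survive. *)
Lemma rect_int_small a b c d u v eps del p1 p2 q2 : closed_on a b c d ->
  a <= u <= b -> c <= v <= d -> (b - a) + (d - c) < del -> 0 < eps ->
  (forall x y, Rabs (x - u) < del -> Rabs (y - v) < del ->
     Rabs (P x y - P u v - p1 * (x - u) - p2 * (y - v)) <= eps * (Rabs (x - u) + Rabs (y - v))) ->
  (forall x y, Rabs (x - u) < del -> Rabs (y - v) < del ->
     Rabs (Q x y - Q u v - p2 * (x - u) - q2 * (y - v)) <= eps * (Rabs (x - u) + Rabs (y - v))) ->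
  Rabs (rect_int P Q a b c d) <= 2 * eps * ((b - a) + (d - c)) ^ 2.
Proof.
  intros H Hu Hv Hdel He HP HQ.
  set (D := (b - a) + (d - c)) in *.
  assert (B : forall x y, a <= x <= b -> c <= y <= d ->
     Rabs (x - u) < del /\ Rabs (y - v) < del /\ Rabs (x - u) + Rabs (y - v) <= D).
  { intros x y Hx Hy.
    assert (Rabs (x - u) <= b - a) by (apply Rabs_le; lra).
    assert (Rabs (y - v) <= d - c) by (apply Rabs_le; lra). unfold D in *. lra. }
  assert (EP : Rabs (RInt (fun x => P x c) a b - RInt (fun x => P x d) a b - (p2 * (c - d)) * (b - a))
               <= (2 * eps * D) * (b - a)).
  { apply RInt_near_const. lra.
    eapply closed_on_int_l; try eassumption; lra.
    eapply closed_on_int_l; try eassumption; lra.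
    intros x Hx. destruct (B x c Hx) as (B1 & B2 & B3). lra.
    destruct (B x d Hx) as (B4 & B5 & B6). lra.
    pose proof (HP x c B1 B2) as E1. pose proof (HP x d B4 B5) as E2.
    replace (P x c - P x d - p2 * (c - d)) with
     ((P x c - P u v - p1 * (x - u) - p2 * (c - v)) - (P x d - P u v - p1 * (x - u) - p2 * (d - v))) by ring.
    eapply Rle_trans. apply Rabs_triang. rewrite Rabs_Ropp.
    apply Rmult_le_compat_l with (r := eps) in B3; [|lra].
    apply Rmult_le_compat_l with (r := eps) in B6; [|lra]. lra. }
  assert (EQ : Rabs (RInt (fun y => Q b y) c d - RInt (fun y => Q a y) c d - (p2 * (b - a)) * (d - c))
               <= (2 * eps * D) * (d - c)).
  { apply RInt_near_const. lra.
    eapply closed_on_int_r; try eassumption; lra.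
    eapply closed_on_int_r; try eassumption; lra.
    intros y Hy. destruct (B b y ltac:(lra) Hy) as (B1 & B2 & B3).
    destruct (B a y ltac:(lra) Hy) as (B4 & B5 & B6).
    pose proof (HQ b y B1 B2) as E1. pose proof (HQ a y B4 B5) as E2.
    replace (Q b y - Q a y - p2 * (b - a)) with
     ((Q b y - Q u v - p2 * (b - u) - q2 * (y - v)) - (Q a y - Q u v - p2 * (a - u) - q2 * (y - v))) by ring.
    eapply Rle_trans. apply Rabs_triang. rewrite Rabs_Ropp.
    apply Rmult_le_compat_l with (r := eps) in B3; [|lra].
    apply Rmult_le_compat_l with (r := eps) in B6; [|lra]. lra. }
  unfold rect_int.
  set (A := RInt (fun x => P x c) a b - RInt (fun x => P x d) a b) in *.
  set (A' := RInt (fun y => Q b y) c d - RInt (fun y => Q a y) c d) in *.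
  replace (A + A') with ((A - p2 * (c - d) * (b - a)) + (A' - p2 * (b - a) * (d - c))) by ring.
  eapply Rle_trans. apply Rabs_triang.
  replace (2 * eps * D ^ 2) with (2 * eps * D * (b - a) + 2 * eps * D * (d - c)) by (unfold D; ring).
  lra.
Qed.

Definition rect := (R * R * R * R)%type.

Definition rquarter (r : rect) (i j : bool) : rect :=
  let '(a, b, c, d) := r in
  let m := (a + b) / 2 in let n := (c + d) / 2 in
  (if i then a else m, if i then m else b, if j then c else n, if j then n else d).

Definition rdiam (r : rect) : R := let '(a, b, c, d) := r in (b - a) + (d - c).

Definition rJ (r : rect) : R := let '(a, b, c, d) := r in rect_int P Q a b c d.

Definition big_quarter (k : R) (r : rect) (i j : bool) : Prop :=
  k * rdiam (rquarter r i j) ^ 2 <= Rabs (rJ (rquarter r i j)).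

(** The last quarter is taken without a test: if the rectangle itself satisfies the lower bound and
    the other three quarters fail it, the last one satisfies it, by [rstep_big]. *)
Definition rstep (k : R) (r : rect) : rect :=
  let q i j := rquarter r i j in
  if excluded_middle_informative (big_quarter k r true true) then q true true else
  if excluded_middle_informative (big_quarter k r true false) then q true false else
  if excluded_middle_informative (big_quarter k r false true) then q false true else
  q false false.

Lemma rstep_quarter k r : exists i j, rstep k r = rquarter r i j.
Proof.
  unfold rstep. repeat destruct excluded_middle_informative; eexists _, _; reflexivity.
Qed.

(** The four integrals add up to the whole one and each quarter has half the diameter, so four
    integrals below [k X^2] would sum to less than [k (2 X)^2]. *)
Lemma rstep_big k a b c d : a <= b -> c <= d -> closed_on a b c d ->
  k * rdiam (a, b, c, d) ^ 2 <= Rabs (rJ (a, b, c, d)) ->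
  k * rdiam (rstep k (a, b, c, d)) ^ 2 <= Rabs (rJ (rstep k (a, b, c, d))).
Proof.
  intros Hab Hcd H Hbig. unfold rstep.
  destruct excluded_middle_informative as [H1|H1]; [exact H1|].
  destruct excluded_middle_informative as [H2|H2]; [exact H2|].
  destruct excluded_middle_informative as [H3|H3]; [exact H3|].
  unfold big_quarter in *. apply Rnot_le_lt in H1, H2, H3.
  apply Rnot_lt_le. intros H4.
  unfold rquarter, rdiam, rJ in *.
  set (m := (a + b) / 2) in *. set (n := (c + d) / 2) in *.
  assert (Hm : a <= m <= b) by (unfold m; lra). assert (Hn : c <= n <= d) by (unfold n; lra).
  assert (S : rect_int P Q a b c d = rect_int P Q a m c n + rect_int P Q a m n d
                 + (rect_int P Q m b c n + rect_int P Q m b n d)).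
  { rewrite (rect_int_split_x a b c d m) by assumption.
    rewrite (rect_int_split_y a m c d n), (rect_int_split_y m b c d n); try lra; auto;
    intros u v Hu Hv; apply H; lra. }
  rewrite S in Hbig.
  pose proof (Rabs_triang (rect_int P Q a m c n + rect_int P Q a m n d) (rect_int P Q m b c n + rect_int P Q m b n d)).
  pose proof (Rabs_triang (rect_int P Q a m c n) (rect_int P Q a m n d)).
  pose proof (Rabs_triang (rect_int P Q m b c n) (rect_int P Q m b n d)).
  replace (b - a + (d - c)) with (2 * (m - a + (n - c))) in Hbig by (unfold m, n; field).
  replace (m - a + (d - n)) with (m - a + (n - c)) in H2 by (unfold m, n; field).
  replace (b - m + (n - c)) with (m - a + (n - c)) in H3 by (unfold m, n; field).
  replace (b - m + (d - n)) with (m - a + (n - c)) in H4 by (unfold m, n; field).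
  set (X := m - a + (n - c)) in *.
  replace (k * (2 * X) ^ 2) with (4 * (k * X ^ 2)) in Hbig by ring. lra.
Qed.

Theorem goursat a b c d : a < b -> c < d -> closed_on a b c d -> rect_int P Q a b c d = 0.
Proof.
  intros Hab Hcd H.
  apply NNPP. intros Hne.
  set (D0 := (b - a) + (d - c)). assert (HD0 : 0 < D0) by (unfold D0; lra).
  (* The ratio of the integral to the squared diameter; it stays a lower bound for all the nested
     quarters. *)
  set (k := Rabs (rect_int P Q a b c d) / D0 ^ 2).
  assert (Hk : 0 < k). { apply Rdiv_lt_0_compat. apply Rabs_pos_lt, Hne. apply pow_lt, HD0. }
  set (r := fun n : nat => nat_rect (fun _ => rect) (a, b, c, d) (fun _ => rstep k) n).
  set (A := fun n => fst (fst (fst (r n)))). set (B := fun n => snd (fst (fst (r n)))).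
  set (Cc := fun n => snd (fst (r n))). set (Dd := fun n => snd (r n)).
  assert (Er : forall n, r n = (A n, B n, Cc n, Dd n)).
  { intros n. unfold A, B, Cc, Dd. destruct (r n) as [[[? ?] ?] ?]. reflexivity. }
  assert (Es : forall n, exists i j, (A (S n), B (S n), Cc (S n), Dd (S n)) = rquarter (A n, B n, Cc n, Dd n) i j).
  { intros n. rewrite <- !Er. exact (rstep_quarter k (r n)). }
  assert (Step : forall n, A n <= B n /\ Cc n <= Dd n ->
     A n <= A (S n) /\ A (S n) <= B (S n) /\ B (S n) <= B n /\
     Cc n <= Cc (S n) /\ Cc (S n) <= Dd (S n) /\ Dd (S n) <= Dd n /\
     B (S n) - A (S n) = (B n - A n) / 2 /\ Dd (S n) - Cc (S n) = (Dd n - Cc n) / 2).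
  { intros n [H1 H2]. destruct (Es n) as (i & j & E). unfold rquarter in E. injection E as E1 E2 E3 E4.
    rewrite E1, E2, E3, E4. destruct i, j; repeat split; lra. }
  assert (Ord : forall n, A n <= B n /\ Cc n <= Dd n).
  { induction n. unfold A, B, Cc, Dd; simpl; lra. destruct (Step n IHn) as (?&?&?&?&?&?&?&?). lra. }
  assert (Size : forall n, B n - A n = (b - a) * (/ 2) ^ n /\ Dd n - Cc n = (d - c) * (/ 2) ^ n).
  { induction n. unfold A, B, Cc, Dd; simpl; lra.
    destruct (Step n (Ord n)) as (?&?&?&?&?&?&E1&E2). destruct IHn as [E3 E4].
    rewrite E1, E2, E3, E4. simpl. split; field. }
  assert (In0 : forall n, a <= A n /\ B n <= b /\ c <= Cc n /\ Dd n <= d).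
  { induction n. unfold A, B, Cc, Dd; simpl; lra.
    destruct (Step n (Ord n)) as (?&?&?&?&?&?&?&?). lra. }
  assert (Lim0 : forall w, is_lim_seq (fun n => w * (/ 2) ^ n) 0).
  { intros w. replace (Finite 0) with (Rbar_mult w 0) by (simpl; f_equal; ring).
    apply is_lim_seq_scal_l. apply is_lim_seq_geom. rewrite Rabs_pos_eq; lra. }
  assert (Pt : forall (X Y : nat -> R) w, (forall n, X n <= X (S n)) -> (forall n, Y (S n) <= Y n) ->
     (forall n, Y n - X n = w * (/ 2) ^ n) -> exists u, forall n, X n <= u <= Y n).
  { intros X Y w HX HY HXY.
    destruct (ex_lim_seq_adj X Y HX HY) as ((u & Hu) & (u' & Hu') & Eu).
    { apply is_lim_seq_ext with (fun n => w * (/ 2) ^ n). intros n; symmetry; apply HXY. apply Lim0. }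
    exists u. assert (u' = u).
    { rewrite (is_lim_seq_unique _ _ Hu), (is_lim_seq_unique _ _ Hu') in Eu. injection Eu; auto. }
    subst u'. intros n. split.
    - apply (is_lim_seq_incr_compare X u Hu HX).
    - apply (is_lim_seq_decr_compare Y u Hu' HY). }
  destruct (Pt A B (b - a)) as [u Hu]; try (intros n; apply (Step n (Ord n))). apply Size.
  destruct (Pt Cc Dd (d - c)) as [v Hv]; try (intros n; apply (Step n (Ord n))). apply Size.
  assert (Big : forall n, k * (B n - A n + (Dd n - Cc n)) ^ 2 <= Rabs (rect_int P Q (A n) (B n) (Cc n) (Dd n))).
  { induction n.
    - unfold A, B, Cc, Dd; simpl r; simpl fst; simpl snd. fold D0. unfold k. right. field. lra.
    - pose proof (rstep_big k (A n) (B n) (Cc n) (Dd n)) as Sb.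
      assert (E : rstep k (A n, B n, Cc n, Dd n) = (A (S n), B (S n), Cc (S n), Dd (S n))).
      { rewrite <- !Er. reflexivity. }
      rewrite E in Sb. unfold rdiam, rJ in Sb. apply Sb; try apply Ord; try exact IHn.
      intros x y Hx Hy. pose proof (In0 n). apply H; lra. }
  destruct (H u v) as (p1 & p2 & q2 & HP & HQ).
  { specialize (Hu 0%nat). unfold A, B in Hu; simpl in Hu. exact Hu. }
  { specialize (Hv 0%nat). unfold Cc, Dd in Hv; simpl in Hv. exact Hv. }
  (* With error [k / 4], [rect_int_small] bounds the integral by [k / 2] times the squared diameter,
     against the lower bound [k]. *)
  destruct (HP (k / 4) ltac:(lra)) as (d1 & Hd1 & HP1).
  destruct (HQ (k / 4) ltac:(lra)) as (d2 & Hd2 & HQ1).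
  assert (Hex : exists n, B n - A n + (Dd n - Cc n) < Rmin d1 d2).
  { pose proof (Lim0 D0) as L. apply is_lim_seq_spec in L.
    assert (Hm : 0 < Rmin d1 d2) by (apply Rmin_glb_lt; assumption).
    destruct (L (mkposreal _ Hm)) as [n Hn]. exists n. specialize (Hn n (le_n n)). simpl in Hn.
    destruct (Size n) as [E1 E2]. rewrite E1, E2.
    apply Rabs_def2 in Hn. unfold D0 in Hn. lra. }
  destruct Hex as [n Hn].
  pose proof (Rmin_l d1 d2). pose proof (Rmin_r d1 d2).
  assert (Bd : Rabs (rect_int P Q (A n) (B n) (Cc n) (Dd n)) <= 2 * (k / 4) * (B n - A n + (Dd n - Cc n)) ^ 2).
  { apply (rect_int_small (A n) (B n) (Cc n) (Dd n) u v (k / 4) (Rmin d1 d2) p1 p2 q2); auto; try lra.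
    - intros x y Hx Hy. pose proof (In0 n). apply H; lra.
    - intros x y Hx Hy. apply HP1; lra.
    - intros x y Hx Hy. apply HQ1; lra. }
  specialize (Big n). destruct (Size n) as [E1 E2]. rewrite E1, E2 in Bd, Big.
  replace ((b - a) * (/ 2) ^ n + (d - c) * (/ 2) ^ n) with (D0 * (/ 2) ^ n) in * by (unfold D0; ring).
  assert (0 < (D0 * (/ 2) ^ n) ^ 2) by (apply pow_lt; apply Rmult_lt_0_compat; [lra|apply pow_lt; lra]).
  assert (0 < k * (D0 * (/ 2) ^ n) ^ 2) by (apply Rmult_lt_0_compat; lra).
  lra.
Qed.

End Goursat.

(** * Cauchy estimates *)

Definition holo_at (f : C -> C) (z : C) : Prop := exists l, Cder f z l.

Lemma holo_C_derive (f : C -> C) (z : C) : holo_at f z -> Cder f z (C_derive f z).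
Proof. intros [l H]. rewrite (Cder_C_derive _ _ _ H). exact H. Qed.

(** The Cauchy-Riemann equations: the components of [h * l] as linear forms in the components of
    [h]. *)
Lemma Cder_frechet (f : C -> C) (u v : R) (l : C) : Cder f (u, v) l ->
  frechet (fun x y => fst (f (x, y))) u v (fst l) (- snd l) /\
  frechet (fun x y => snd (f (x, y))) u v (snd l) (fst l).
Proof.
  intros H.
  assert (G : forall eps, 0 < eps -> exists d, 0 < d /\ forall x y,
     Rabs (x - u) < d -> Rabs (y - v) < d ->
     Cmod (f (x, y) - f (u, v) - ((x, y) - (u, v)) * l)%C <= eps * (Rabs (x - u) + Rabs (y - v))).
  { intros eps He. destruct (H eps He) as [d [Hd H1]]. exists (d / 2). split. lra.
    intros x y Hx Hy.
    pose proof (Cmod_le_abs ((x, y) - (u, v))%C) as B. simpl in B. fold (x - u) in B. fold (y - v) in B.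
    specialize (H1 ((x, y) - (u, v))%C).
    replace ((u, v) + ((x, y) - (u, v)))%C with (x, y) in H1 by (apply Ceq; simpl; ring).
    eapply Rle_trans. apply H1. lra. apply Rmult_le_compat_l; lra. }
  split; intros eps He; destruct (G eps He) as [d [Hd H1]]; exists d; (split; [exact Hd|]);
    intros x y Hx Hy; specialize (H1 x y Hx Hy).
  - pose proof (abs_fst_le_Cmod (f (x, y) - f (u, v) - ((x, y) - (u, v)) * l)%C) as B. simpl in B.
    eapply Rle_trans; [|exact H1]. eapply Rle_trans; [|exact B]. right. f_equal. ring.
  - pose proof (abs_snd_le_Cmod (f (x, y) - f (u, v) - ((x, y) - (u, v)) * l)%C) as B. simpl in B.
    eapply Rle_trans; [|exact H1]. eapply Rle_trans; [|exact B]. right. f_equal. ring.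
Qed.

(** The form [Im H dx + Re H dy] is the imaginary part of [H dz] and is closed by the Cauchy-Riemann
    equations; periodicity makes the horizontal sides cancel in Goursat's theorem. *)
Lemma RInt_periodic_strip (H : C -> C) (x1 x2 : R) : x1 < x2 ->
  (forall x y, x1 <= x <= x2 -> holo_at H (x, y)) ->
  (forall x, H (x, 2 * PI) = H (x, 0)) ->
  RInt (fun y => fst (H (x1, y))) 0 (2 * PI) = RInt (fun y => fst (H (x2, y))) 0 (2 * PI).
Proof.
  intros Hx Hh Hp.
  assert (G : rect_int (fun x y => snd (H (x, y))) (fun x y => fst (H (x, y))) x1 x2 0 (2 * PI) = 0).
  { apply goursat. exact Hx. pose proof PI_RGT_0; lra.
    intros u v Hu _. destruct (Hh u v Hu) as [l Hl]. destruct (Cder_frechet _ _ _ _ Hl) as [A B].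
    exists (snd l), (fst l), (- snd l). split; assumption. }
  unfold rect_int in G.
  assert (E : RInt (fun x => snd (H (x, 2 * PI))) x1 x2 = RInt (fun x => snd (H (x, 0))) x1 x2).
  { apply RInt_ext. intros x _. rewrite Hp. reflexivity. }
  lra.
Qed.

Lemma Cexp_2PI (x : R) : Cexp (x, 2 * PI) = Cexp (x, 0).
Proof. unfold Cexp; simpl. rewrite cos_2PI, sin_2PI, cos_0, sin_0. reflexivity. Qed.

(* The circle of radius [|a| exp x] about [z], in logarithmic coordinates. *)
Lemma RInt_circle_const (f K : C -> C) (z a : C) (r x1 x2 : R) :
  (forall w, Cmod (w - z)%C < r -> holo_at f w) ->
  (forall w, holo_at K w) -> (forall x, K (x, 2 * PI) = K (x, 0)) ->
  Cmod a < r -> x1 < x2 -> x2 <= 0 ->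
  RInt (fun y => fst (f (z + a * Cexp (x1, y)) * K (x1, y))%C) 0 (2 * PI) =
  RInt (fun y => fst (f (z + a * Cexp (x2, y)) * K (x2, y))%C) 0 (2 * PI).
Proof.
  intros Hf HK Hp Ha Hx Hx2.
  apply (RInt_periodic_strip (fun w => f (z + a * Cexp w) * K w)%C).
  - exact Hx.
  - intros x y Hxx.
    destruct (Hf (z + a * Cexp (x, y))%C) as [l Hl].
    { replace (z + a * Cexp (x, y) - z)%C with (a * Cexp (x, y))%C by ring.
      rewrite Cmod_mult, Cmod_Cexp. simpl.
      apply Rle_lt_trans with (Cmod a * 1); [|lra].
      apply Rmult_le_compat_l. apply Cmod_ge_0. rewrite <- exp_0. apply exp_le. unfold Re; simpl. lra. }
    destruct (HK (x, y)) as [k Hk].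
    eexists. apply Cder_mult; [|exact Hk].
    apply (Cder_comp f (fun w => z + a * Cexp w)%C). exact Hl.
    apply (Cder_plus (fun _ => z) (fun w => a * Cexp w)%C). apply Cder_const.
    apply Cder_scal. apply Cder_Cexp.
  - intros x. rewrite Hp, Cexp_2PI. reflexivity.
Qed.

Lemma Ccont_continuous (f : C -> C) (g : R -> C) (t : R) :
  Ccont f (g t) -> continuous (fun s => fst (g s)) t -> continuous (fun s => snd (g s)) t ->
  continuous (fun s => fst (f (g s))) t /\ continuous (fun s => snd (f (g s))) t.
Proof.
  intros Hf H1 H2.
  assert (G : forall eps, 0 < eps -> exists d, 0 < d /\
     forall y, Rabs (y - t) < d -> Cmod (f (g y) - f (g t))%C < eps).
  { intros eps He. destruct (Hf eps He) as [d [Hd H]].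
    apply continuity_pt_filterlim, continuity_pt_locally with (eps := mkposreal (d / 2) ltac:(lra)) in H1, H2.
    destruct H1 as [d1 H1]. destruct H2 as [d2 H2]. simpl in H1, H2.
    exists (Rmin d1 d2). split. apply Rmin_glb_lt; apply cond_pos.
    intros y Hy.
    assert (A1 := H1 y ltac:(by_Rmin Hy)).
    assert (A2 := H2 y ltac:(by_Rmin Hy)).
    specialize (H (g y - g t)%C). replace (g t + (g y - g t))%C with (g y) in H by ring.
    apply H. eapply Rle_lt_trans. apply Cmod_le_abs. simpl. unfold Rminus in *. lra. }
  split; apply continuous_eps; intros eps He; destruct (G eps He) as [d [Hd H]]; exists d;
    (split; [exact Hd|]); intros y Hy; specialize (H y Hy).
  - eapply Rle_lt_trans; [|exact H]. apply (abs_fst_le_Cmod (f (g y) - f (g t))%C).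
  - eapply Rle_lt_trans; [|exact H]. apply (abs_snd_le_Cmod (f (g y) - f (g t))%C).
Qed.

Lemma continuous_vertical (H : C -> C) (x t : R) : holo_at H (x, t) ->
  continuous (fun y => fst (H (x, y))) t /\ continuous (fun y => snd (H (x, y))) t.
Proof.
  intros [l Hl]. apply (Ccont_continuous H (fun y => (x, y)) t).
  eapply Cder_Ccont, Hl. simpl. apply continuous_const. simpl. apply continuous_id.
Qed.

Lemma RInt_abs_near (f : R -> R) (a b k e : R) : a <= b -> ex_RInt f a b ->
  (forall x, a <= x <= b -> Rabs (f x - k) <= e) -> Rabs (RInt f a b - k * (b - a)) <= e * (b - a).
Proof.
  intros Hab Hf H.
  pose proof (RInt_near_const f (fun _ => 0) a b k e Hab Hf (ex_RInt_const _ _ _)) as B.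
  rewrite RInt_const in B. unfold scal in B; simpl in B; unfold mult in B; simpl in B.
  replace (RInt f a b - (b - a) * 0 - k * (b - a)) with (RInt f a b - k * (b - a)) in B by ring.
  apply B. intros x Hx. replace (f x - 0 - k) with (f x - k) by ring. apply H, Hx.
Qed.

(** At [w = z + a e^zeta] the kernel [K] is [1 / (w - z)], so the mean of the difference quotient
    over a circle about [z] does not depend on the radius. For small radii it is close to [l]; at
    radius [r / 2] it is at most [2 M * (2 / r)]. *)
Lemma cauchy_estimate_fst (f : C -> C) (z l : C) (r M : R) : 0 < r ->
  (forall w, Cmod (w - z)%C < r -> holo_at f w) ->
  (forall w, Cmod (w - z)%C < r -> Cmod (f w) <= M) ->
  Cder f z l -> Rabs (fst l) <= 4 * M / r.
Proof.
  intros Hr Hf HM Hl.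
  set (a := RtoC (r / 2)).
  assert (Ha : Cmod a = r / 2) by (unfold a; rewrite Cmod_R; apply Rabs_pos_eq; lra).
  set (g := fun w => (f w - f z)%C).
  set (K := fun w : C => (/ a * Cexp (- w))%C).
  pose proof PI_RGT_0 as HPI.
  assert (Na : a <> 0%C) by (apply Cmod_gt_0; rewrite Ha; lra).
  assert (Hg : forall w, Cmod (w - z)%C < r -> holo_at g w).
  { intros w Hw. destruct (Hf w Hw) as [k Hk]. exists (k - 0)%C. apply Cder_minus. exact Hk. apply Cder_const. }
  assert (HK : forall w, holo_at K w).
  { intros w. eexists. unfold K. apply Cder_scal. apply (Cder_comp Cexp (fun w => - w)%C).
    apply Cder_Cexp. apply Cder_opp, Cder_id. }
  assert (HKp : forall x, K (x, 2 * PI) = K (x, 0)).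
  { intros x. unfold K. f_equal. unfold Cexp; simpl.
    rewrite !cos_neg, !sin_neg, cos_2PI, sin_2PI, cos_0, sin_0. reflexivity. }
  assert (HmK : forall x y, Cmod (K (x, y)) = 2 / r * exp (- x)).
  { intros x y. unfold K. rewrite Cmod_mult, Cmod_inv, Ha, Cmod_Cexp by exact Na.
    unfold Re; simpl. field. lra. }
  assert (Hin : forall x y, x <= 0 -> Cmod (z + a * Cexp (x, y) - z)%C < r).
  { intros x y Hx. replace (z + a * Cexp (x, y) - z)%C with (a * Cexp (x, y))%C by ring.
    rewrite Cmod_mult, Cmod_Cexp, Ha. unfold Re; simpl.
    assert (exp x <= 1) by (rewrite <- exp_0; apply exp_le; lra).
    assert (r / 2 * exp x <= r / 2 * 1) by (apply Rmult_le_compat_l; lra). lra. }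
  assert (Hex : forall x, x <= 0 -> ex_RInt (fun y => fst (g (z + a * Cexp (x, y)) * K (x, y))%C) 0 (2 * PI)).
  { intros x Hx. apply ex_RInt_cont. lra. intros y _.
    apply (continuous_vertical (fun w => g (z + a * Cexp w) * K w)%C x y).
    destruct (Hg _ (Hin x y Hx)) as [k1 Hk1]. destruct (HK (x, y)) as [k2 Hk2].
    eexists. apply Cder_mult; [|exact Hk2]. apply (Cder_comp g (fun w => z + a * Cexp w)%C). exact Hk1.
    apply (Cder_plus (fun _ => z) (fun w => a * Cexp w)%C). apply Cder_const.
    apply Cder_scal. apply Cder_Cexp. }
  assert (B0 : Rabs (RInt (fun y => fst (g (z + a * Cexp (0, y)) * K (0%R, y))%C) 0 (2 * PI)) <= (2 * PI - 0) * (4 * M / r)).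
  { apply abs_RInt_le_const. lra. apply Hex; lra. intros y _.
    eapply Rle_trans. apply abs_fst_le_Cmod. rewrite Cmod_mult, HmK.
    rewrite Ropp_0, exp_0.
    assert (Cmod (g (z + a * Cexp (0%R, y))%C) <= 2 * M).
    { unfold g. eapply Rle_trans. apply Cmod_triangle. rewrite Cmod_opp.
      assert (Cmod (f z) <= M). apply HM. rewrite Csub_diag, Cmod_0; lra.
      specialize (HM _ (Hin 0 y (Rle_refl 0))). lra. }
    replace (4 * M / r) with (2 * M * (2 / r * 1)) by (field; lra).
    apply Rmult_le_compat_r. assert (0 < 2 / r) by (apply Rdiv_lt_0_compat; lra). lra. exact H. }
  apply le_epsilon. intros eps He.
  destruct (Hl eps He) as [d [Hd Hd1]].
  (* The circle at [x1] has radius at most [d / 2], where the difference quotient is within [eps] of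
     [l]; the [-1] keeps [x1] negative. *)
  set (x1 := Rmin (-1) (ln d - ln r)).
  assert (Hx1 : x1 < 0) by (unfold x1; pose proof (Rmin_l (-1) (ln d - ln r)); lra).
  assert (B1 : Rabs (RInt (fun y => fst (g (z + a * Cexp (x1, y)) * K (x1, y))%C) 0 (2 * PI) - fst l * (2 * PI - 0)) <= eps * (2 * PI - 0)).
  { apply RInt_abs_near. lra. apply Hex; lra. intros y _.
    set (h := (a * Cexp (x1, y))%C).
    assert (Nh : h <> 0%C) by (apply Cmult_neq_0; [exact Na|apply Cexp_neq_0]).
    assert (Hh : Cmod h < d).
    { unfold h. rewrite Cmod_mult, Cmod_Cexp, Ha. unfold Re; simpl.
      assert (exp x1 <= d / r).
      { replace (d / r) with (exp (ln d - ln r)).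
        apply exp_le. apply Rmin_r.
        unfold Rminus. rewrite exp_plus, exp_Ropp, !exp_ln by lra. reflexivity. }
      apply Rmult_le_compat_l with (r := r / 2) in H; [|lra].
      replace (r / 2 * (d / r)) with (d / 2) in H by (field; lra). lra. }
    assert (EK : K (x1, y) = (/ h)%C).
    { transitivity (K (x1, y) * h * / h)%C. field; exact Nh.
      replace (K (x1, y) * h)%C with (RtoC 1). ring.
      transitivity (/ a * a * (Cexp (- (x1, y)) * Cexp (x1, y)))%C; [|unfold K, h; ring].
      rewrite <- Cexp_plus. replace (- (x1, y) + (x1, y))%C with (RtoC 0) by (apply Ceq; simpl; ring).
      rewrite Cexp_0, Cinv_l by exact Na. ring. }
    assert (E : fst (g (z + h) * K (x1, y))%C - fst l = fst (g (z + h) * K (x1, y) - l)%C) by reflexivity.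
    fold h. rewrite E. eapply Rle_trans. apply abs_fst_le_Cmod. rewrite EK.
    unfold g. replace ((f (z + h) - f z) * / h - l)%C with ((f (z + h) - f z - h * l) / h)%C by (field; exact Nh).
    rewrite Cmod_div by exact Nh. apply Rle_div_l. apply Cmod_gt_0; exact Nh.
    apply Hd1, Hh. }
  rewrite (RInt_circle_const g K z a r x1 0) in B1; auto; try lra.
  set (I := RInt (fun y => fst (g (z + a * Cexp (0, y)) * K (0%R, y))%C) 0 (2 * PI)) in *.
  assert (B2 : Rabs (fst l * (2 * PI - 0)) <= (2 * PI - 0) * (4 * M / r) + eps * (2 * PI - 0)).
  { replace (fst l * (2 * PI - 0)) with (I - (I - fst l * (2 * PI - 0))) by ring.
    eapply Rle_trans. apply Rabs_triang. rewrite Rabs_Ropp. lra. }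
  rewrite Rabs_mult, (Rabs_pos_eq (2 * PI - 0)) in B2 by lra.
  apply Rmult_le_reg_r with (2 * PI - 0). lra. lra.
Qed.

(** Multiplication by [- Ci] turns the imaginary part into a real part; the two bounds [4 M / r] add
    up. *)
Lemma cauchy_estimate (f : C -> C) (z l : C) (r M : R) : 0 < r ->
  (forall w, Cmod (w - z)%C < r -> holo_at f w) ->
  (forall w, Cmod (w - z)%C < r -> Cmod (f w) <= M) ->
  Cder f z l -> Cmod l <= 8 * M / r.
Proof.
  intros Hr Hf HM Hl.
  pose proof (cauchy_estimate_fst f z l r M Hr Hf HM Hl) as B1.
  assert (B2 : Rabs (fst (- Ci * l)%C) <= 4 * M / r).
  { apply (cauchy_estimate_fst (fun w => - Ci * f w)%C z _ r M Hr).
    - intros w Hw. destruct (Hf w Hw) as [k Hk]. eexists. apply Cder_scal, Hk.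
    - intros w Hw. rewrite Cmod_mult, Cmod_opp, Cmod_Ci, Rmult_1_l. apply HM, Hw.
    - apply Cder_scal, Hl. }
  simpl in B2. replace (- 0 * fst l - - (1) * snd l) with (snd l) in B2 by ring.
  eapply Rle_trans. apply Cmod_le_abs. 
  replace (8 * M / r) with (4 * M / r + 4 * M / r) by (field; lra). lra.
Qed.

Lemma is_derive_segment (f : C -> C) (z h l : C) (t : R) : Cder f (z + t * h)%C l ->
  is_derive (fun s : R => fst (f (z + s * h)%C)) t (fst (h * l)%C) /\
  is_derive (fun s : R => snd (f (z + s * h)%C)) t (snd (h * l)%C).
Proof.
  intros H.
  assert (G : forall eps, 0 < eps -> exists d, 0 < d /\ forall k, Rabs k < d ->
     Cmod (f (z + (t + k)%R * h) - f (z + t * h) - k * (h * l))%C <= eps * Rabs k).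
  { intros eps He.
    pose proof (Cmod_ge_0 h) as Ph.
    destruct (H (eps / (1 + Cmod h))) as [d [Hd Hd1]]. apply Rdiv_lt_0_compat; lra.
    exists (d / (1 + Cmod h)). split. apply Rdiv_lt_0_compat; lra.
    intros k Hk.
    apply Rmult_lt_compat_r with (r := 1 + Cmod h) in Hk; [|lra].
    replace (d / (1 + Cmod h) * (1 + Cmod h)) with d in Hk by (field; lra).
    assert (Hkh : Cmod (k * h)%C <= Rabs k * (1 + Cmod h)).
    { rewrite Cmod_mult, Cmod_R. apply Rmult_le_compat_l. apply Rabs_pos. lra. }
    specialize (Hd1 (k * h)%C ltac:(lra)).
    replace (z + t * h + k * h)%C with (z + (t + k)%R * h)%C in Hd1 by (rewrite RtoC_plus; ring).
    replace (k * h * l)%C with (k * (h * l))%C in Hd1 by ring.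
    eapply Rle_trans. exact Hd1.
    apply Rmult_le_compat_l with (r := eps / (1 + Cmod h)) in Hkh.
    replace (eps / (1 + Cmod h) * (Rabs k * (1 + Cmod h))) with (eps * Rabs k) in Hkh by (field; lra).
    exact Hkh. apply Rlt_le, Rdiv_lt_0_compat; lra. }
  split; apply is_derive_Reals; intros eps He; destruct (G (eps / 2) ltac:(lra)) as [d [Hd Hd1]];
    exists (mkposreal d Hd); intros k Nk Hk; simpl in Hk; specialize (Hd1 k Hk);
    pose proof (Rabs_pos_lt k Nk).
  - match goal with |- Rabs ?e < _ => replace e with ((fst (f (z + (t + k)%R * h) - f (z + t * h) - k * (h * l))%C) / k) end.
    2:{ simpl. field. exact Nk. }
    rewrite Rabs_div by exact Nk. apply Rlt_div_l. lra.
    eapply Rle_lt_trans. eapply Rle_trans. apply abs_fst_le_Cmod. exact Hd1. nra.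
  - match goal with |- Rabs ?e < _ => replace e with ((snd (f (z + (t + k)%R * h) - f (z + t * h) - k * (h * l))%C) / k) end.
    2:{ simpl. field. exact Nk. }
    rewrite Rabs_div by exact Nk. apply Rlt_div_l. lra.
    eapply Rle_lt_trans. eapply Rle_trans. apply abs_snd_le_Cmod. exact Hd1. nra.
Qed.

Lemma MVT_bound (f df : R -> R) (B : R) :
  (forall t, 0 <= t <= 1 -> is_derive f t (df t)) ->
  (forall t, 0 <= t <= 1 -> Rabs (df t) <= B) -> Rabs (f 1 - f 0) <= B.
Proof.
  intros H HB. destruct (MVT_gen f 0 1 df) as [c [Hc E]].
  - intros x Hx. rewrite Rmin_left, Rmax_right in Hx by lra. apply H; lra.
  - intros x Hx. rewrite Rmin_left, Rmax_right in Hx by lra.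
    apply continuity_pt_filterlim. apply (ex_derive_continuous (V := RN)). eexists. apply H; lra.
  - rewrite Rmin_left, Rmax_right in Hc by lra. rewrite E.
    replace (df c * (1 - 0)) with (df c) by ring. apply HB, Hc.
Qed.

(** The mean value theorem is applied to each component, whence the 2. *)
Lemma Cder_segment_bound (f df : C -> C) (z h : C) (B : R) :
  (forall t, 0 <= t <= 1 -> Cder f (z + t * h)%C (df (z + t * h)%C)) ->
  (forall t, 0 <= t <= 1 -> Cmod (df (z + t * h)%C) <= B) ->
  Cmod (f (z + h) - f z)%C <= 2 * B * Cmod h.
Proof.
  intros H HB.
  assert (E1 : (z + h)%C = (z + 1%R * h)%C) by ring.
  assert (E0 : z = (z + 0%R * h)%C) by ring.
  assert (Bd : forall t, 0 <= t <= 1 -> Cmod (h * df (z + t * h))%C <= Cmod h * B).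
  { intros t Ht. rewrite Cmod_mult. apply Rmult_le_compat_l. apply Cmod_ge_0. apply HB, Ht. }
  assert (B1 : Rabs (fst (f (z + 1%R * h)%C) - fst (f (z + 0%R * h)%C)) <= Cmod h * B).
  { apply (MVT_bound (fun s : R => fst (f (z + s * h)%C)) (fun s => fst (h * df (z + s * h))%C)).
    - intros t Ht. apply is_derive_segment, H, Ht.
    - intros t Ht. eapply Rle_trans. apply abs_fst_le_Cmod. apply Bd, Ht. }
  assert (B2 : Rabs (snd (f (z + 1%R * h)%C) - snd (f (z + 0%R * h)%C)) <= Cmod h * B).
  { apply (MVT_bound (fun s : R => snd (f (z + s * h)%C)) (fun s => snd (h * df (z + s * h))%C)).
    - intros t Ht. apply is_derive_segment, H, Ht.
    - intros t Ht. eapply Rle_trans. apply abs_snd_le_Cmod. apply Bd, Ht. }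
  rewrite <- E1, <- E0 in B1, B2.
  eapply Rle_trans. apply Cmod_le_abs. simpl. unfold Rminus in *. lra.
Qed.

(** The remainder depends on [f] only through [M] and [r], hence is uniform in families of
    functions; series and integrals with a parameter are differentiated by means of it. No second
    derivative is formed: the increment of [C_derive f] is estimated as the derivative of an
    increment of [f]. The constants are [16 = 8 * 2], [1024 = 8 * 2 * 16 * 4] and
    [2048 = 2 * 1024]. *)
Lemma taylor1_bound (f : C -> C) (z h : C) (r M : R) : 0 < r ->
  (forall w, Cmod (w - z)%C < r -> holo_at f w) ->
  (forall w, Cmod (w - z)%C < r -> Cmod (f w) <= M) ->
  Cmod h < r / 4 ->
  Cmod (f (z + h) - f z - h * C_derive f z)%C <= 2048 * M / r ^ 2 * Cmod h ^ 2.
Proof.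
  intros Hr Hf HM Hh.
  assert (HD : forall w, Cmod (w - z)%C < r -> Cder f w (C_derive f w)).
  { intros w Hw. apply holo_C_derive, Hf, Hw. }
  assert (D1 : forall w, Cmod (w - z)%C < r / 2 -> Cmod (C_derive f w) <= 16 * M / r).
  { intros w Hw. replace (16 * M / r) with (8 * M / (r / 2)) by (field; lra).
    assert (T : forall v, Cmod (v - w)%C < r / 2 -> Cmod (v - z)%C < r).
    { intros v Hv. replace (v - z)%C with ((v - w) + (w - z))%C by ring.
      eapply Rle_lt_trans. apply Cmod_triangle. lra. }
    apply (cauchy_estimate f w _ (r / 2) M). lra. intros v Hv. apply Hf, T, Hv.
    intros v Hv; apply HM, T, Hv. apply HD. lra. }
  (* the Cauchy estimate for [w => f (w + k) - f w] *)
  assert (D2 : forall k, Cmod k < r / 4 -> Cmod (C_derive f (z + k)%C - C_derive f z)%C <= 1024 * M / r ^ 2 * Cmod k).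
  { intros k Hk.
    replace (1024 * M / r ^ 2 * Cmod k) with (8 * (2 * (16 * M / r) * Cmod k) / (r / 4)) by (field; lra).
    assert (T : forall w, Cmod (w - z)%C < r / 4 -> forall t, 0 <= t <= 1 -> Cmod (w + t * k - z)%C < r / 2).
    { intros w Hw t Ht. replace (w + t * k - z)%C with ((w - z) + t * k)%C by ring.
      eapply Rle_lt_trans. apply Cmod_triangle. rewrite Cmod_mult, Cmod_R, Rabs_pos_eq by lra.
      assert (t * Cmod k <= 1 * Cmod k). apply Rmult_le_compat_r. apply Cmod_ge_0. lra. lra. }
    assert (T1 : forall w, Cmod (w - z)%C < r / 4 -> Cmod (w + k - z)%C < r / 2).
    { intros w Hw. specialize (T w Hw 1 ltac:(lra)). replace (w + 1%R * k - z)%C with (w + k - z)%C in T by ring. exact T. }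
    assert (Dk : forall w, Cmod (w - z)%C < r / 4 ->
       Cder (fun w => f (w + k) - f w)%C w (C_derive f (w + k) - C_derive f w)%C).
    { intros w Hw. apply Cder_minus.
      - replace (C_derive f (w + k)%C) with ((1 + 0) * C_derive f (w + k))%C by ring.
        apply (Cder_comp f (fun w => w + k)%C). apply HD. specialize (T1 w Hw). lra.
        apply (Cder_plus (fun w => w) (fun _ => k)). apply Cder_id. apply Cder_const.
      - apply HD. lra. }
    apply (cauchy_estimate (fun w => f (w + k) - f w)%C z _ (r / 4)). lra.
    - intros w Hw. eexists. apply Dk, Hw.
    - intros w Hw. apply (Cder_segment_bound f (C_derive f)).
      intros t Ht. apply HD. specialize (T w Hw t Ht). lra.
      intros t Ht. apply D1. apply T; assumption.
    - apply Dk. rewrite Csub_diag, Cmod_0. lra. }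
  set (psi := fun w => (f w - (w - z) * C_derive f z)%C).
  assert (E : (f (z + h) - f z - h * C_derive f z)%C = (psi (z + h) - psi z)%C) by (unfold psi; ring).
  rewrite E.
  replace (2048 * M / r ^ 2 * Cmod h ^ 2) with (2 * (1024 * M / r ^ 2 * Cmod h) * Cmod h) by (field; lra).
  assert (T : forall t, 0 <= t <= 1 -> Cmod (t * h)%C <= Cmod h).
  { intros t Ht. rewrite Cmod_mult, Cmod_R, Rabs_pos_eq by lra.
    rewrite <- (Rmult_1_l (Cmod h)) at 2. apply Rmult_le_compat_r. apply Cmod_ge_0. lra. }
  assert (HM0 : 0 <= M).
  { eapply Rle_trans. apply (Cmod_ge_0 (f z)). apply HM. rewrite Csub_diag, Cmod_0. lra. }
  apply (Cder_segment_bound psi (fun w => C_derive f w - C_derive f z)%C).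
  - intros t Ht. unfold psi.
    replace (C_derive f (z + t * h) - C_derive f z)%C with
      (C_derive f (z + t * h) - ((1 - 0) * C_derive f z + (z + t * h - z) * 0))%C by ring.
    apply Cder_minus. apply HD. replace (z + t * h - z)%C with (t * h)%C by ring. specialize (T t Ht). lra.
    apply (Cder_mult (fun w => w - z)%C (fun _ => C_derive f z)).
    apply (Cder_minus (fun w => w) (fun _ => z)). apply Cder_id. apply Cder_const. apply Cder_const.
  - intros t Ht. specialize (T t Ht). eapply Rle_trans. apply D2. lra.
    apply Rmult_le_compat_l; [|exact T].
    apply Rle_div_r. apply pow_lt; lra. lra.
Qed.

(** * Complex series and the identity theorem *)

(** Convergence by components makes the real [Series], with its total function and its comparison
    tests, available; [is_series_is_Cser] connects it with the series in the normed module [C]. *)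
Definition is_Cser (a : nat -> C) (l : C) : Prop :=
  is_series (fun n => fst (a n)) (fst l) /\ is_series (fun n => snd (a n)) (snd l).

Definition Cser (a : nat -> C) : C :=
  (Series (fun n => fst (a n)), Series (fun n => snd (a n))).

Definition Cconv (a : nat -> C) : Prop :=
  ex_series (fun n => fst (a n)) /\ ex_series (fun n => snd (a n)).

Lemma sum_n_fst (a : nat -> C) (N : nat) :
  fst (@sum_n C_AbelianMonoid a N) = sum_n (fun n => fst (a n)) N.
Proof. induction N. rewrite !sum_O. reflexivity. rewrite !sum_Sn, <- IHN. reflexivity. Qed.

Lemma sum_n_snd (a : nat -> C) (N : nat) :
  snd (@sum_n C_AbelianMonoid a N) = sum_n (fun n => snd (a n)) N.
Proof. induction N. rewrite !sum_O. reflexivity. rewrite !sum_Sn, <- IHN. reflexivity. Qed.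

Lemma is_series_is_Cser (a : nat -> C) (l : C) :
  @is_series C_AbsRing C_NormedModule a l <-> is_Cser a l.
Proof.
  unfold is_Cser, is_series. split.
  - intros H. split.
    + apply filterlim_ext with (fun N => fst (@sum_n C_AbelianMonoid a N)).
      intros N. apply sum_n_fst.
      eapply filterlim_comp. exact H. intros P HP. apply locally_near.
      destruct HP as [e He]. exists e. split. apply cond_pos.
      intros w Hw. apply He. eapply Rle_lt_trans; [|exact Hw]. apply (abs_fst_le_Cmod (w - l)%C).
    + apply filterlim_ext with (fun N => snd (@sum_n C_AbelianMonoid a N)).
      intros N. apply sum_n_snd.
      eapply filterlim_comp. exact H. intros P HP. apply locally_near.
      destruct HP as [e He]. exists e. split. apply cond_pos.
      intros w Hw. apply He. eapply Rle_lt_trans; [|exact Hw]. apply (abs_snd_le_Cmod (w - l)%C).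
  - intros [H1 H2] P HP. apply locally_near in HP. destruct HP as [d [Hd HP]].
    specialize (H1 (fun x => Rabs (x - fst l) < d / 2)).
    specialize (H2 (fun x => Rabs (x - snd l) < d / 2)).
    assert (Hd2 : 0 < d / 2) by lra.
    destruct H1 as [N1 H1]. exists (mkposreal _ Hd2). intros y Hy; exact Hy.
    destruct H2 as [N2 H2]. exists (mkposreal _ Hd2). intros y Hy; exact Hy.
    exists (max N1 N2). intros n Hn. apply HP. eapply Rle_lt_trans. apply Cmod_le_abs.
    specialize (H1 n ltac:(lia)). specialize (H2 n ltac:(lia)).
    rewrite <- sum_n_fst in H1. rewrite <- sum_n_snd in H2.
    change (Rabs (fst (@sum_n C_AbelianMonoid a n) - fst l) + Rabs (snd (@sum_n C_AbelianMonoid a n) - snd l) < d).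
    lra.
Qed.

Lemma Cconv_is_Cser (a : nat -> C) : Cconv a -> is_Cser a (Cser a).
Proof. intros [H1 H2]. split; apply Series_correct; assumption. Qed.

Lemma is_Cser_unique (a : nat -> C) (l : C) : is_Cser a l -> Cser a = l.
Proof. intros [H1 H2]. apply Ceq; apply is_series_unique; assumption. Qed.

Lemma is_Cser_ext (a b : nat -> C) (l : C) : (forall n, a n = b n) -> is_Cser a l -> is_Cser b l.
Proof.
  intros E [H1 H2]. split; (eapply is_series_ext; [|eassumption]); intros n; simpl; rewrite E; reflexivity.
Qed.

Lemma Cser_ext (a b : nat -> C) : (forall n, a n = b n) -> Cser a = Cser b.
Proof. intros E. apply Ceq; apply Series_ext; intros n; rewrite E; reflexivity. Qed.

Lemma is_Cser_plus (a b : nat -> C) (l m : C) :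
  is_Cser a l -> is_Cser b m -> is_Cser (fun n => a n + b n)%C (l + m)%C.
Proof. intros [H1 H2] [H3 H4]. split; apply (is_series_plus (V := RN)); assumption. Qed.

Lemma is_Cser_scal (c : C) (a : nat -> C) (l : C) :
  is_Cser a l -> is_Cser (fun n => c * a n)%C (c * l)%C.
Proof.
  intros [H1 H2]. split; simpl.
  - apply (is_series_minus (V := RN) (fun n => fst c * fst (a n)) (fun n => snd c * snd (a n))).
    apply (is_series_scal (V := RN) (fst c)); assumption.
    apply (is_series_scal (V := RN) (snd c)); assumption.
  - apply (is_series_plus (V := RN) (fun n => fst c * snd (a n)) (fun n => snd c * fst (a n))).
    apply (is_series_scal (V := RN) (fst c)); assumption.
    apply (is_series_scal (V := RN) (snd c)); assumption.
Qed.

Lemma is_Cser_opp (a : nat -> C) (l : C) : is_Cser a l -> is_Cser (fun n => - a n)%C (- l)%C.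
Proof.
  intros H. apply (is_Cser_scal (-1)) in H. replace (- l)%C with (-1 * l)%C by ring.
  eapply is_Cser_ext; [|exact H]. intros n. cbv beta. ring.
Qed.

Lemma is_Cser_minus (a b : nat -> C) (l m : C) :
  is_Cser a l -> is_Cser b m -> is_Cser (fun n => a n - b n)%C (l - m)%C.
Proof. intros H1 H2. apply (is_Cser_plus a (fun n => - b n)%C). exact H1. apply is_Cser_opp, H2. Qed.

Lemma is_Cser_bound (a : nat -> C) (b : nat -> R) : (forall n, Cmod (a n) <= b n) -> ex_series b ->
  is_Cser a (Cser a) /\ Cmod (Cser a) <= 2 * Series b.
Proof.
  intros H Hb.
  assert (H1 : forall n, Rabs (fst (a n)) <= b n).
  { intros n. eapply Rle_trans. apply abs_fst_le_Cmod. apply H. }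
  assert (H2 : forall n, Rabs (snd (a n)) <= b n).
  { intros n. eapply Rle_trans. apply abs_snd_le_Cmod. apply H. }
  assert (A1 : ex_series (fun n => Rabs (fst (a n)))).
  { apply (ex_series_le (V := RCN) _ b); [|exact Hb].
    intros n. unfold norm; simpl. unfold abs; simpl. rewrite Rabs_Rabsolu. apply H1. }
  assert (A2 : ex_series (fun n => Rabs (snd (a n)))).
  { apply (ex_series_le (V := RCN) _ b); [|exact Hb].
    intros n. unfold norm; simpl. unfold abs; simpl. rewrite Rabs_Rabsolu. apply H2. }
  split.
  - apply Cconv_is_Cser. split; apply ex_series_Rabs; assumption.
  - eapply Rle_trans. apply Cmod_le_abs. simpl.
    pose proof (Series_Rabs _ A1). pose proof (Series_Rabs _ A2).
    assert (Series (fun n => Rabs (fst (a n))) <= Series b).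
    { apply Series_le; [|exact Hb]. intros n. split. apply Rabs_pos. apply H1. }
    assert (Series (fun n => Rabs (snd (a n))) <= Series b).
    { apply Series_le; [|exact Hb]. intros n. split. apply Rabs_pos. apply H2. }
    lra.
Qed.

(** The majorant of the functions yields one of the derivatives by [cauchy_estimate], and
    [taylor1_bound] summed over [n] bounds the remainder of the sum by a multiple of
    [Cmod h ^ 2]. *)
Theorem weierstrass (f : nat -> C -> C) (b : nat -> R) (z : C) (r : R) : 0 < r ->
  (forall n w, Cmod (w - z)%C < r -> holo_at (f n) w) ->
  (forall n w, Cmod (w - z)%C < r -> Cmod (f n w) <= b n) -> ex_series b ->
  is_Cser (fun n => C_derive (f n) z) (Cser (fun n => C_derive (f n) z)) /\
  Cder (fun w => Cser (fun n => f n w)) z (Cser (fun n => C_derive (f n) z)).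
Proof.
  intros Hr Hf Hb Hs.
  assert (Hz : Cmod (z - z)%C < r) by (rewrite Csub_diag, Cmod_0; lra).
  assert (D : is_Cser (fun n => C_derive (f n) z) (Cser (fun n => C_derive (f n) z))).
  { apply (is_Cser_bound _ (fun n => 8 / r * b n)).
    - intros n. replace (8 / r * b n) with (8 * b n / r) by (field; lra).
      apply (cauchy_estimate (f n) z _ r (b n) Hr). apply Hf. apply Hb.
      apply holo_C_derive, Hf, Hz.
    - apply (ex_series_scal (V := RN)), Hs. }
  split. exact D.
  intros eps He.
  set (K := 2 * Series (fun n => 2048 * b n / r ^ 2)).
  assert (K0 : 0 <= K).
  { assert (forall n, 0 <= 2048 * b n / r ^ 2).
    { intros n. apply Rle_div_r. apply pow_lt, Hr. rewrite Rmult_0_l.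
      pose proof (Hb n z Hz). pose proof (Cmod_ge_0 (f n z)). lra. }
    destruct (is_Cser_bound (fun _ => RtoC 0) (fun n => 2048 * b n / r ^ 2)) as [_ B].
    { intros n. rewrite Cmod_0. apply H. }
    { apply ex_series_ext with (fun n => 2048 / r ^ 2 * b n).
      intros n; change (2048 / r ^ 2 * b n = 2048 * b n / r ^ 2); field; lra.
      apply (ex_series_scal (V := RN)), Hs. }
    pose proof (Cmod_ge_0 (Cser (fun _ => RtoC 0))).
    unfold K. lra. }
  exists (Rmin (r / 4) (eps / (1 + K))). split.
  apply Rmin_glb_lt. lra. apply Rdiv_lt_0_compat; lra.
  intros h Hh.
  assert (h1 : Cmod h < r / 4) by (by_Rmin Hh).
  assert (h2 : Cmod h < eps / (1 + K)) by (by_Rmin Hh).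
  assert (S1 : is_Cser (fun n => f n (z + h)%C) (Cser (fun n => f n (z + h)%C))).
  { apply (is_Cser_bound _ b); [|exact Hs]. intros n. apply Hb.
    replace (z + h - z)%C with h by ring. lra. }
  assert (S2 : is_Cser (fun n => f n z) (Cser (fun n => f n z))).
  { apply (is_Cser_bound _ b); [|exact Hs]. intros n. apply Hb, Hz. }
  pose proof (is_Cser_minus _ _ _ _ (is_Cser_minus _ _ _ _ S1 S2) (is_Cser_scal h _ _ D)) as S3.
  rewrite <- (is_Cser_unique _ _ S3).
  destruct (is_Cser_bound (fun n => f n (z + h) - f n z - h * C_derive (f n) z)%C
     (fun n => Cmod h ^ 2 * (2048 * b n / r ^ 2))) as [_ B].
  { intros n. rewrite (Rmult_comm (Cmod h ^ 2)). apply taylor1_bound; auto. }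
  { apply (ex_series_scal (V := RN)).
    apply ex_series_ext with (fun n => 2048 / r ^ 2 * b n). intros n; change (2048 / r ^ 2 * b n = 2048 * b n / r ^ 2); field; lra.
    apply (ex_series_scal (V := RN)), Hs. }
  eapply Rle_trans. exact B. rewrite Series_scal_l.
  replace (2 * (Cmod h ^ 2 * Series (fun n => 2048 * b n / r ^ 2))) with (K * Cmod h * Cmod h) by (unfold K; ring).
  apply Rmult_le_compat_r. apply Cmod_ge_0.
  apply Rmult_lt_compat_r with (r := 1 + K) in h2; [|lra].
  replace (eps / (1 + K) * (1 + K)) with eps in h2 by (field; lra).
  pose proof (Cmod_ge_0 h). nra.
Qed.

Lemma RInt_ge_const (f : R -> R) (a b m : R) : a <= b -> ex_RInt f a b ->
  (forall x, a <= x <= b -> m <= f x) -> m * (b - a) <= RInt f a b.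
Proof.
  intros Hab Hf H. replace (m * (b - a)) with (RInt (fun _ => m) a b).
  apply RInt_le. exact Hab. apply ex_RInt_const. exact Hf. intros x Hx. apply H. lra.
  rewrite RInt_const. unfold scal; simpl; unfold mult; simpl. ring.
Qed.

Lemma continuous_bounded (h : R -> R) (a b : R) : a <= b -> (forall x, a <= x <= b -> continuous h x) ->
  exists M, 0 <= M /\ forall x, a <= x <= b -> Rabs (h x) <= M.
Proof.
  intros Hab Hc.
  destruct (continuity_ab_maj h a b Hab) as [x1 [H1 _]].
  { intros c Hc'. apply continuity_pt_filterlim, Hc, Hc'. }
  destruct (continuity_ab_min h a b Hab) as [x2 [H2 _]].
  { intros c Hc'. apply continuity_pt_filterlim, Hc, Hc'. }
  exists (Rmax (Rabs (h x1)) (Rabs (h x2))). split.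
  eapply Rle_trans; [apply Rabs_pos|apply Rmax_l].
  intros x Hx. specialize (H1 x Hx). specialize (H2 x Hx).
  apply Rabs_le. pose proof (Rle_abs (h x1)). pose proof (Rle_abs (- h x2)). rewrite Rabs_Ropp in H0.
  pose proof (Rmax_l (Rabs (h x1)) (Rabs (h x2))). pose proof (Rmax_r (Rabs (h x1)) (Rabs (h x2))). lra.
Qed.

(* The kernels [(1 - cos)^N] concentrate at [PI]. *)
Lemma concentration_le (h : R -> R) : (forall x, continuous h x) ->
  (forall N, RInt (fun y => h y * (1 - cos y) ^ N) 0 (2 * PI) = 0) -> h PI <= 0.
Proof.
  intros Hc HI. apply Rnot_lt_le. intros Hpos.
  pose proof PI_RGT_0 as HPI.
  destruct (continuous_bounded h 0 (2 * PI)) as [M [HM0 HM]]. lra. intros; apply Hc.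
  set (eta := h PI / 2).
  assert (He : 0 < eta) by (unfold eta; lra).
  assert (Hn : exists d, 0 < d < PI /\ forall y, Rabs (y - PI) <= d -> eta <= h y).
  { pose proof (proj2 (continuity_pt_filterlim h PI) (Hc PI)) as Hp.
    destruct (proj1 (continuity_pt_locally h PI) Hp (mkposreal eta He)) as [d Hd]. simpl in Hd.
    pose proof (cond_pos d).
    exists (Rmin (d / 2) (PI / 2)). split. split. apply Rmin_glb_lt; lra.
    pose proof (Rmin_r (d / 2) (PI / 2)); lra.
    intros y Hy. specialize (Hd y). assert (Hy' : Rabs (y - PI) < d).
    { pose proof (Rmin_l (d / 2) (PI / 2)); lra. }
    specialize (Hd Hy'). apply Rabs_def2 in Hd. unfold eta in *. lra. }
  destruct Hn as [d [Hd Hnear]].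
  (* [q ^ N] bounds the kernel outside the window of radius [d] about [PI], [p ^ N] bounds it from
     below in the window of radius [d / 2]; in between, the sign of [h] is enough. *)
  set (q := 1 + cos d). set (p := 1 + cos (d / 2)).
  assert (Hq : 0 <= q) by (unfold q; pose proof (COS_bound d); lra).
  assert (Hpq : q < p).
  { unfold p, q. assert (cos d < cos (d / 2)). apply cos_decreasing_1; lra. lra. }
  assert (Hcos : forall y, 1 - cos y = 1 + cos (y - PI)).
  { intros y. replace (cos y) with (cos (y - PI + PI)) by (f_equal; ring). rewrite neg_cos. ring. }
  assert (K0 : forall y N, 0 <= (1 - cos y) ^ N).
  { intros y N. apply pow_le. pose proof (COS_bound y); lra. }
  assert (Kq : forall y N, 0 <= y <= 2 * PI -> d <= Rabs (y - PI) -> (1 - cos y) ^ N <= q ^ N).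
  { intros y N Hy Hyd. apply pow_incr. split. pose proof (COS_bound y); lra.
    rewrite Hcos. unfold q.
    assert (cos (y - PI) <= cos d); [|lra].
    replace (cos (y - PI)) with (cos (Rabs (y - PI))).
    destruct (Req_dec d (Rabs (y - PI))) as [E|E]. rewrite <- E; lra.
    assert (Rabs (y - PI) <= PI) by (apply Rabs_le; lra).
    left. apply cos_decreasing_1; lra.
    unfold Rabs; destruct Rcase_abs; [apply cos_neg|reflexivity]. }
  assert (Kp : forall y N, Rabs (y - PI) <= d / 2 -> p ^ N <= (1 - cos y) ^ N).
  { intros y N Hy. apply pow_incr. split. lra. rewrite Hcos. unfold p.
    assert (cos (d / 2) <= cos (y - PI)); [|lra].
    replace (cos (y - PI)) with (cos (Rabs (y - PI))).
    destruct (Req_dec (d / 2) (Rabs (y - PI))) as [E|E]. rewrite <- E; lra.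
    left. apply cos_decreasing_1; try lra. apply Rabs_pos.
    unfold Rabs; destruct Rcase_abs; [apply cos_neg|reflexivity]. }
  assert (Hint : forall N a b, a <= b -> ex_RInt (fun y => h y * (1 - cos y) ^ N) a b).
  { intros N a b Hab. apply ex_RInt_cont. exact Hab. intros x _.
    apply (continuous_mult h). apply Hc.
    apply (ex_derive_continuous (V := RN)). auto_derive. auto. }
  assert (Far : forall N a b, 0 <= a -> a <= b -> b <= 2 * PI -> (forall y, a <= y <= b -> d <= Rabs (y - PI)) ->
     - (M * q ^ N) * (b - a) <= RInt (fun y => h y * (1 - cos y) ^ N) a b).
  { intros N a b Ha Hab Hb Hy. apply RInt_ge_const. exact Hab. apply Hint, Hab.
    intros x Hx. specialize (HM x ltac:(lra)). apply Rabs_le_between in HM.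
    pose proof (Kq x N ltac:(lra) (Hy x Hx)). pose proof (K0 x N).
    assert (M * (1 - cos x) ^ N <= M * q ^ N) by (apply Rmult_le_compat_l; lra). nra. }
  (* The inner window contributes at least [eta p^N d], the outside at least [- 2 PI M q^N], and the
     total is 0; but [(q / p)^N] tends to 0. *)
  assert (Main : forall N, eta * p ^ N * d <= 2 * PI * M * q ^ N).
  { intros N. specialize (HI N).
    rewrite <- (RInt_Chasles _ 0 (PI - d) (2 * PI)) in HI by (apply Hint; lra).
    rewrite <- (RInt_Chasles _ (PI - d) (PI - d / 2) (2 * PI)) in HI by (apply Hint; lra).
    rewrite <- (RInt_Chasles _ (PI - d / 2) (PI + d / 2) (2 * PI)) in HI by (apply Hint; lra).
    rewrite <- (RInt_Chasles _ (PI + d / 2) (PI + d) (2 * PI)) in HI by (apply Hint; lra).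
    unfold plus in HI; simpl in HI.
    pose proof (Far N 0 (PI - d) ltac:(lra) ltac:(lra) ltac:(lra)
      ltac:(intros y Hy; rewrite Rabs_left1 by lra; lra)).
    pose proof (Far N (PI + d) (2 * PI) ltac:(lra) ltac:(lra) ltac:(lra)
      ltac:(intros y Hy; rewrite Rabs_pos_eq by lra; lra)).
    assert (G : forall a b, a <= b -> PI - d <= a -> b <= PI + d -> 0 <= RInt (fun y => h y * (1 - cos y) ^ N) a b).
    { intros a b Hab H1 H2. replace 0 with (0 * (b - a)) by ring. apply RInt_ge_const. exact Hab.
      apply Hint, Hab. intros x Hx. apply Rmult_le_pos; [|apply K0].
      assert (eta <= h x) by (apply Hnear, Rabs_le; lra). lra. }
    pose proof (G (PI - d) (PI - d / 2) ltac:(lra) ltac:(lra) ltac:(lra)).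
    pose proof (G (PI + d / 2) (PI + d) ltac:(lra) ltac:(lra) ltac:(lra)).
    assert (eta * p ^ N * ((PI + d / 2) - (PI - d / 2)) <= RInt (fun y => h y * (1 - cos y) ^ N) (PI - d / 2) (PI + d / 2)).
    { apply RInt_ge_const. lra. apply Hint; lra. intros x Hx.
      assert (Rabs (x - PI) <= d / 2) by (apply Rabs_le; lra).
      apply Rmult_le_compat. lra. apply pow_le; lra. apply Hnear; lra. apply Kp; lra. }
    assert (0 <= M * q ^ N) by (apply Rmult_le_pos; [lra|apply pow_le, Hq]).
    nra. }
  assert (L : is_lim_seq (fun N => (q / p) ^ N) 0).
  { apply is_lim_seq_geom. rewrite Rabs_pos_eq. apply Rlt_div_l; lra. apply Rle_div_r; lra. }
  apply is_lim_seq_spec in L.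
  assert (Hsm : 0 < eta * d / (2 * PI * M + 1)).
  { assert (0 <= PI * M) by (apply Rmult_le_pos; lra).
    apply Rdiv_lt_0_compat. apply Rmult_lt_0_compat; lra. lra. }
  destruct (L (mkposreal _ Hsm)) as [N HN]. specialize (HN N (le_n N)). simpl in HN.
  specialize (Main N).
  assert (Pp : 0 < p ^ N) by (apply pow_lt; lra).
  rewrite Rminus_0_r, Rabs_pos_eq in HN by (apply pow_le; apply Rle_div_r; lra).
  unfold Rdiv in HN at 1. rewrite Rpow_mult_distr, pow_inv in HN.
  assert (PM : 0 <= PI * M) by (apply Rmult_le_pos; lra).
  apply Rmult_lt_compat_r with (r := p ^ N * (2 * PI * M + 1)) in HN; [|apply Rmult_lt_0_compat; lra].
  replace (q ^ N * / p ^ N * (p ^ N * (2 * PI * M + 1))) with (q ^ N * (2 * PI * M + 1)) in HN by (field; lra).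
  replace (eta * d / (2 * PI * M + 1) * (p ^ N * (2 * PI * M + 1))) with (eta * d * p ^ N) in HN by (field; lra).
  assert (0 <= q ^ N) by (apply pow_le; lra). lra.
Qed.

Lemma concentration (h : R -> R) : (forall x, continuous h x) ->
  (forall N, RInt (fun y => h y * (1 - cos y) ^ N) 0 (2 * PI) = 0) -> h PI = 0.
Proof.
  intros Hc HI. apply Rle_antisym. apply concentration_le; assumption.
  assert (- h PI <= 0); [|lra].
  apply (concentration_le (fun x => - h x)).
  - intros x. apply (continuous_opp h), Hc.
  - intros N. transitivity (- RInt (fun y => h y * (1 - cos y) ^ N) 0 (2 * PI)); [|rewrite HI; apply Ropp_0].
    assert (Hint : ex_RInt (fun y => h y * (1 - cos y) ^ N) 0 (2 * PI)).
    { apply ex_RInt_cont. pose proof PI_RGT_0; lra. intros x _.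
      apply (continuous_mult h). apply Hc.
      apply (ex_derive_continuous (V := RN)). auto_derive. auto. }
    rewrite <- (RInt_opp (V := RCN) (fun y => h y * (1 - cos y) ^ N)) by exact Hint.
    apply RInt_ext. intros x _. unfold opp; simpl. ring.
Qed.

Lemma Cpow_holo (K : C -> C) (N : nat) : (forall w, holo_at K w) -> forall w, holo_at (fun w => K w ^ N)%C w.
Proof.
  intros HK. induction N; intros w.
  - eexists. apply (Cder_const 1).
  - destruct (IHN w) as [l1 H1]. destruct (HK w) as [l2 H2]. eexists.
    apply (Cder_mult K (fun w => K w ^ N)%C); eassumption.
Qed.

(** On small circles about [z] the function vanishes, so its integrals against all kernels are 0
    there, and by invariance also on the circle through [w]. The choice [a = z - w] puts [w] at the
    angle [PI], where the kernels concentrate. *)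
Theorem identity_disk (f : C -> C) (z : C) (r : R) :
  (forall w, Cmod (w - z)%C < r -> holo_at f w) ->
  near z (fun w => f w = 0%C) ->
  forall w, Cmod (w - z)%C < r -> f w = 0%C.
Proof.
  intros Hf [del [Hdel Hz]] w Hw.
  pose proof PI_RGT_0 as HPI.
  destruct (Rlt_le_dec (Cmod (w - z)%C) del) as [Hlt|Hge]. { apply Hz, Hlt. }
  set (a := (z - w)%C).
  assert (Ha : Cmod a = Cmod (w - z)%C) by apply Cmod_sub_sym.
  assert (Fst : forall g : C -> C, (forall w, Cmod (w - z)%C < r -> holo_at g w) ->
            (forall w, Cmod (w - z)%C < del -> g w = 0%C) -> fst (g w) = 0).
  { intros g Hg Hg0.
    (* [1 - cosh]: entire, of period [2 i PI], and equal to [1 - cos y] on the imaginary axis. *)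
    set (ch := fun w : C => (1 - (Cexp w + Cexp (- w)) / 2)%C).
    assert (Hch : forall w, holo_at ch w).
    { intros v. unfold ch, Cdiv. eexists. apply Cder_minus. apply Cder_const.
      apply Cder_mult; [|apply Cder_const]. apply Cder_plus. apply Cder_Cexp.
      apply (Cder_comp Cexp (fun w => - w)%C). apply Cder_Cexp. apply Cder_opp, Cder_id. }
    assert (Ech : forall y, ch (0%R, y) = RtoC (1 - cos y)).
    { intros y. unfold ch, Cexp. apply Ceq; simpl; rewrite ?Ropp_0, ?exp_0, ?cos_neg, ?sin_neg; field. }
    assert (Pch : forall x, ch (x, 2 * PI) = ch (x, 0)).
    { intros x. unfold ch, Cexp; simpl. rewrite !cos_neg, !sin_neg, cos_2PI, sin_2PI, cos_0, sin_0. reflexivity. }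
    assert (E : w = (z + a * Cexp (0%R, PI))%C).
    { unfold a, Cexp. apply Ceq; simpl; rewrite cos_PI, sin_PI, exp_0; ring. }
    rewrite E.
    assert (Hin : forall y, Cmod (z + a * Cexp (0%R, y) - z)%C < r).
    { intros y. replace (z + a * Cexp (0%R, y) - z)%C with (a * Cexp (0%R, y))%C by ring.
      rewrite Cmod_mult, Cmod_Cexp, Ha. unfold Re; simpl. rewrite exp_0. lra. }
    apply (concentration (fun y => fst (g (z + a * Cexp (0%R, y))%C))).
    - intros y. apply (continuous_vertical (fun v => g (z + a * Cexp v)%C) 0 y).
      destruct (Hg _ (Hin y)) as [k Hk]. eexists.
      apply (Cder_comp g (fun w => z + a * Cexp w)%C). exact Hk.
      apply (Cder_plus (fun _ => z) (fun w => a * Cexp w)%C). apply Cder_const.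
      apply Cder_scal. apply Cder_Cexp.
    - intros N.
      (* The circle at [x1] has radius below [del] and lies where [g] vanishes. *)
      set (x1 := Rmin (-1) (ln del - ln (1 + Cmod a))).
      pose proof (Cmod_ge_0 a) as Pa.
      assert (Hx1 : x1 < 0) by (unfold x1; pose proof (Rmin_l (-1) (ln del - ln (1 + Cmod a))); lra).
      pose proof (RInt_circle_const g (fun w => ch w ^ N)%C z a r x1 0 Hg (Cpow_holo ch N Hch)) as C0.
      rewrite <- (RInt_ext (fun y => fst (g (z + a * Cexp (0%R, y)) * ch (0%R, y) ^ N)%C)).
      2:{ intros y _. rewrite Ech, <- RtoC_pow. simpl. ring. }
      rewrite <- C0; [|intros x; rewrite Pch; reflexivity|lra|exact Hx1|lra].
      rewrite (RInt_ext _ (fun _ => 0)).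
      rewrite RInt_const. unfold scal; simpl; unfold mult; simpl; ring.
      intros y _. rewrite Hg0. simpl; ring.
      replace (z + a * Cexp (x1, y) - z)%C with (a * Cexp (x1, y))%C by ring.
      rewrite Cmod_mult, Cmod_Cexp. unfold Re; simpl.
      assert (exp x1 <= del / (1 + Cmod a)).
      { replace (del / (1 + Cmod a)) with (exp (ln del - ln (1 + Cmod a))).
        apply exp_le. apply Rmin_r.
        unfold Rminus. rewrite exp_plus, exp_Ropp, !exp_ln by lra. reflexivity. }
      pose proof (exp_pos x1).
      apply Rmult_le_compat_r with (r := 1 + Cmod a) in H; [|lra].
      replace (del / (1 + Cmod a) * (1 + Cmod a)) with del in H by (field; lra). nra. }
  apply Ceq.
  - apply Fst. exact Hf. exact Hz.
  - change (snd (f w) = 0).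
    assert (H := Fst (fun w => - Ci * f w)%C).
    simpl in H. replace (- 0 * fst (f w) - - (1) * snd (f w)) with (snd (f w)) in H by ring.
    apply H.
    + intros v Hv. destruct (Hf v Hv) as [k Hk]. eexists. apply Cder_scal, Hk.
    + intros v Hv. rewrite Hz by exact Hv. ring.
Qed.

(** * Meromorphic functions *)

Definition mero (f : C -> C) (z : C) : Prop :=
  exists (k : nat) (g : C -> C),
    near z (holo_at g) /\ pnear z (fun w => f w = (g w / (w - z) ^ k)%C).

Lemma near_impl (z : C) (P Q : C -> Prop) : (forall w, P w -> Q w) -> near z P -> near z Q.
Proof. intros H [d [Hd HP]]. exists d. split; auto. Qed.

Lemma pnear_impl (z : C) (P Q : C -> Prop) : (forall w, P w -> Q w) -> pnear z P -> pnear z Q.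
Proof. intros H [d [Hd HP]]. exists d. split; auto. Qed.

Lemma near_and (z : C) (P Q : C -> Prop) : near z P -> near z Q -> near z (fun w => P w /\ Q w).
Proof.
  intros [d1 [Hd1 H1]] [d2 [Hd2 H2]]. exists (Rmin d1 d2). split. apply Rmin_glb_lt; assumption.
  intros w Hw. split; [apply H1|apply H2]; (eapply Rlt_le_trans; [exact Hw|]); [apply Rmin_l|apply Rmin_r].
Qed.

Lemma pnear_and (z : C) (P Q : C -> Prop) : pnear z P -> pnear z Q -> pnear z (fun w => P w /\ Q w).
Proof. intros H1 H2. destruct (near_and z _ _ H1 H2) as [d [Hd H]]. exists d. split; auto. firstorder. Qed.

Lemma near_pnear (z : C) (P : C -> Prop) : near z P -> pnear z P.
Proof. intros [d [Hd H]]. exists d. split; auto. Qed.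

Lemma near_self (z : C) (P : C -> Prop) : near z P -> P z.
Proof. intros [d [Hd H]]. apply H. rewrite Csub_diag, Cmod_0. exact Hd. Qed.

Lemma near_lt_Re (z : C) (X : R) : X < Re z -> near z (fun w => X < Re w).
Proof.
  intros H. exists (Re z - X). split. lra. intros w Hw.
  pose proof (abs_fst_le_Cmod (w - z)%C) as A. simpl in A.
  unfold Re in *. assert (Rabs (fst w + - fst z) < fst z - X) by lra.
  apply Rabs_def2 in H0. lra.
Qed.

Lemma holo_pt_Re (f : C -> C) (X : R) (z : C) :
  (forall s, X < Re s -> holo_at f s) -> X < Re z -> near z (holo_at f).
Proof. intros H Hz. eapply near_impl; [|apply near_lt_Re, Hz]. intros w Hw. apply H, Hw. Qed.

Lemma holomorphic_at_near (f : C -> C) (z : C) : holomorphic_at f z <-> near z (holo_at f).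
Proof.
  unfold holomorphic_at. rewrite locally_near. 
  split; apply near_impl; intros w Hw; apply ex_derive_Cder; exact Hw.
Qed.

Lemma meromorphic_at_mero (f : C -> C) (z : C) : meromorphic_at f z <-> mero f z.
Proof.
  unfold meromorphic_at, mero. split; intros (k & g & H1 & H2); exists k, g; split.
  apply holomorphic_at_near, H1. apply locally'_pnear, H2.
  apply holomorphic_at_near, H1. apply locally'_pnear, H2.
Qed.

Lemma holo_at_plus f g z : holo_at f z -> holo_at g z -> holo_at (fun w => f w + g w)%C z.
Proof. intros [l1 H1] [l2 H2]. eexists. apply Cder_plus; eassumption. Qed.

Lemma holo_at_minus f g z : holo_at f z -> holo_at g z -> holo_at (fun w => f w - g w)%C z.
Proof. intros [l1 H1] [l2 H2]. eexists. apply Cder_minus; eassumption. Qed.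

Lemma holo_at_mult f g z : holo_at f z -> holo_at g z -> holo_at (fun w => f w * g w)%C z.
Proof. intros [l1 H1] [l2 H2]. eexists. apply Cder_mult; eassumption. Qed.

Lemma holo_at_const a z : holo_at (fun _ => a) z.
Proof. eexists. apply Cder_const. Qed.

Lemma holo_at_id z : holo_at (fun w => w) z.
Proof. eexists. apply Cder_id. Qed.

Lemma holo_at_comp f g z : holo_at f (g z) -> holo_at g z -> holo_at (fun w => f (g w)) z.
Proof. intros [l1 H1] [l2 H2]. eexists. apply Cder_comp; eassumption. Qed.

Lemma holo_at_opp f z : holo_at f z -> holo_at (fun w => - f w)%C z.
Proof. intros [l H]. eexists. apply Cder_opp, H. Qed.

Lemma holo_at_pow f z n : holo_at f z -> holo_at (fun w => f w ^ n)%C z.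
Proof.
  intros H. induction n. apply (holo_at_const 1). apply (holo_at_mult f (fun w => f w ^ n)%C); assumption.
Qed.

Lemma holo_at_Rcpow x f z : holo_at f z -> holo_at (fun w => Rcpow x (f w)) z.
Proof. intros H. apply (holo_at_comp (Rcpow x)). eexists. apply Cder_Rcpow. exact H. Qed.

Lemma mero_ext f g z : pnear z (fun w => f w = g w) -> mero f z -> mero g z.
Proof.
  intros E (k & h & H1 & H2). exists k, h. split. exact H1.
  eapply pnear_impl; [|apply (pnear_and _ _ _ E H2)]. intros w [A B]. rewrite <- A; exact B.
Qed.

Lemma mero_holo f z : near z (holo_at f) -> mero f z.
Proof.
  intros H. exists 0%nat, f. split. exact H. exists 1. split. lra. intros w _ _. simpl. field.
Qed.

Lemma Csub_neq_0 (w z : C) : w <> z -> (w - z)%C <> 0%C.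
Proof. intros H E. apply H. replace w with (w - z + z)%C by ring. rewrite E. ring. Qed.

Lemma Cpow_neq_0 (w : C) (k : nat) : w <> 0%C -> (w ^ k)%C <> 0%C.
Proof. intros H. apply Cpow_nz, H. Qed.

Lemma mero_mult f g z : mero f z -> mero g z -> mero (fun w => f w * g w)%C z.
Proof.
  intros (k1 & h1 & H1 & E1) (k2 & h2 & H2 & E2).
  exists (k1 + k2)%nat, (fun w => h1 w * h2 w)%C. split.
  - eapply near_impl; [|apply (near_and _ _ _ H1 H2)]. intros w [A B]. apply holo_at_mult; assumption.
  - destruct (pnear_and _ _ _ E1 E2) as [d [Hd H]]. exists d. split. exact Hd.
    intros w Hw Nw. destruct (H w Hw Nw) as [A B]. rewrite A, B, Cpow_add_r.
    apply Csub_neq_0 in Nw. field. split; apply Cpow_neq_0, Nw.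
Qed.

Lemma mero_plus f g z : mero f z -> mero g z -> mero (fun w => f w + g w)%C z.
Proof.
  intros (k1 & h1 & H1 & E1) (k2 & h2 & H2 & E2).
  exists (k1 + k2)%nat, (fun w => h1 w * (w - z) ^ k2 + h2 w * (w - z) ^ k1)%C. split.
  - eapply near_impl; [|apply (near_and _ _ _ H1 H2)]. intros w [A B].
    apply holo_at_plus; apply holo_at_mult; try assumption; apply holo_at_pow;
    apply holo_at_minus; [apply holo_at_id|apply holo_at_const|apply holo_at_id|apply holo_at_const].
  - destruct (pnear_and _ _ _ E1 E2) as [d [Hd H]]. exists d. split. exact Hd.
    intros w Hw Nw. destruct (H w Hw Nw) as [A B]. rewrite A, B, Cpow_add_r.
    apply Csub_neq_0 in Nw. field. split; apply Cpow_neq_0, Nw.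
Qed.

Lemma mero_minus f g z : mero f z -> mero g z -> mero (fun w => f w - g w)%C z.
Proof.
  intros H1 H2. apply (mero_plus f (fun w => - g w)%C). exact H1.
  apply mero_ext with (fun w => (-1) * g w)%C. exists 1. split. lra. intros; ring.
  apply mero_mult. apply mero_holo. exists 1. split. lra. intros; apply holo_at_const. exact H2.
Qed.

Lemma near_neq_0 f z : holo_at f z -> f z <> 0%C -> near z (fun w => f w <> 0%C).
Proof.
  intros [l H] Hz. apply Cder_Ccont in H.
  destruct (H (Cmod (f z))) as [d [Hd H1]]. apply Cmod_gt_0, Hz.
  exists d. split. exact Hd. intros w Hw E. specialize (H1 (w - z)%C Hw).
  replace (z + (w - z))%C with w in H1 by ring. rewrite E in H1.
  replace (0 - f z)%C with (- f z)%C in H1 by ring. rewrite Cmod_opp in H1. lra.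
Qed.

Lemma mero_inv_affine (a b z : C) : a <> 0%C -> mero (fun w => / (a * w + b))%C z.
Proof.
  intros Ha.
  assert (HA : forall w, holo_at (fun w => a * w + b)%C w).
  { intros w. apply holo_at_plus; [|apply holo_at_const]. apply holo_at_mult; [apply holo_at_const|apply holo_at_id]. }
  destruct (classic ((a * z + b)%C = 0%C)) as [E|E].
  - exists 1%nat, (fun _ => / a)%C. split. exists 1. split. lra. intros; apply holo_at_const.
    exists 1. split. lra. intros w _ Nw. apply Csub_neq_0 in Nw.
    replace (a * w + b)%C with (a * (w - z) + (a * z + b))%C by ring. rewrite E. simpl.
    field. split; auto.
  - apply mero_holo. eapply near_impl; [|apply (near_neq_0 (fun w => a * w + b)%C z (HA z) E)].
    intros w Hw. simpl in Hw. destruct (HA w) as [l Hl]. eexists. apply (Cder_inv (fun w => a * w + b)%C). exact Hw. exact Hl.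
Qed.

Lemma pnear_zero_cont f z : holo_at f z -> pnear z (fun w => f w = 0%C) -> near z (fun w => f w = 0%C).
Proof.
  intros [l H] [d [Hd H0]]. exists d. split. exact Hd. intros w Hw.
  destruct (classic (w = z)) as [->|N]; [|apply H0; assumption].
  apply NNPP. intros Nz. apply Cder_Ccont in H.
  destruct (H (Cmod (f z))) as [e [He H1]]. apply Cmod_gt_0, Nz.
  set (h := RtoC (Rmin (d / 2) (e / 2))).
  assert (Hh : Cmod h = Rmin (d / 2) (e / 2)).
  { unfold h. rewrite Cmod_R. apply Rabs_pos_eq. apply Rmin_glb; lra. }
  pose proof (Rmin_l (d / 2) (e / 2)). pose proof (Rmin_r (d / 2) (e / 2)).
  assert (0 < Rmin (d / 2) (e / 2)) by (apply Rmin_glb_lt; lra).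
  specialize (H1 h ltac:(lra)). rewrite (H0 (z + h)%C) in H1.
  - replace (0 - f z)%C with (- f z)%C in H1 by ring. rewrite Cmod_opp in H1. lra.
  - replace (z + h - z)%C with h by ring. lra.
  - intros E. assert (h = 0%C). { replace h with (z + h - z)%C by ring. rewrite E. ring. }
    rewrite H5, Cmod_0 in Hh. lra.
Qed.

(** The horizontal line through [s] is followed from right to left. At the supremum [m] of the
    abscissae around which [f] is not locally 0, the pole is removed by passing to [g], and
    [identity_disk] for [g] carries the zeros past [m]. *)
Theorem identity_half_plane (f : C -> C) (X : R) :
  (forall s, X < Re s -> mero f s) -> (forall s, 1 < Re s -> f s = 0%C) ->
  forall s, X < Re s -> pnear s (fun w => f w = 0%C).
Proof.
  intros Hm H0 [x y] Hx. unfold Re in Hx; simpl in Hx.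
  apply NNPP. intros Hbad.
  set (T := fun t => x <= t /\ ~ pnear (t, y) (fun w => f w = 0%C)).
  assert (Bd : bound T).
  { exists 1. intros t [Ht1 Ht2]. apply Rnot_lt_le. intros Hlt. apply Ht2.
    apply near_pnear. eapply near_impl; [|apply (near_lt_Re (t, y) 1 Hlt)]. exact H0. }
  destruct (completeness T Bd) as [m [Hub Hlub]].
  { exists x. split. lra. exact Hbad. }
  assert (Hmx : x <= m). { apply Hub. split. lra. exact Hbad. }
  destruct (Hm (m, y)) as (k & g & [r1 [Hr1 Hg]] & [r2 [Hr2 Hfg]]). unfold Re; simpl; lra.
  set (r := Rmin r1 r2). assert (Hr : 0 < r) by (apply Rmin_glb_lt; assumption).
  assert (Lr1 : r <= r1) by apply Rmin_l. assert (Lr2 : r <= r2) by apply Rmin_r.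
  (* A centre to the right of [m], near which [f] vanishes; its disk of radius [r / 2] covers the
     disk of radius [r / 4] about [m]. *)
  set (t := m + r / 4).
  assert (Dist : forall p q : R, Cmod ((p, y) - (q, y))%C = Rabs (p - q)).
  { intros p q. replace ((p, y) - (q, y))%C with (RtoC (p - q)) by (apply Ceq; simpl; ring). apply Cmod_R. }
  assert (Dt : Cmod ((t, y) - (m, y))%C = r / 4).
  { rewrite Dist. unfold t. rewrite Rabs_pos_eq; lra. }
  assert (Ht : pnear (t, y) (fun w => f w = 0%C)).
  { apply NNPP. intros N. assert (t <= m). apply Hub. split. unfold t; lra. exact N. unfold t in H; lra. }
  assert (Bt : forall w, Cmod (w - (t, y))%C < r / 2 -> Cmod (w - (m, y))%C < r).
  { intros w Hw. replace (w - (m, y))%C with ((w - (t, y)) + ((t, y) - (m, y)))%C by ring.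
    eapply Rle_lt_trans. apply Cmod_triangle. lra. }
  assert (Gt : near (t, y) (fun w => g w = 0%C)).
  { apply pnear_zero_cont. apply Hg. lra.
    destruct Ht as [d [Hd Hd0]]. exists (Rmin d (r / 4)). split. apply Rmin_glb_lt; lra.
    intros w Hw Nw.
    assert (w1 : Cmod (w - (t, y))%C < d) by (by_Rmin Hw).
    assert (w2 : Cmod (w - (t, y))%C < r / 4) by (by_Rmin Hw).
    specialize (Hd0 w w1 Nw).
    assert (Nm : w <> (m, y)).
    { intros ->. rewrite Cmod_sub_sym in w2. lra. }
    rewrite (Hfg w) in Hd0; [|specialize (Bt w); lra|exact Nm].
    apply Csub_neq_0 in Nm. pose proof (Cpow_neq_0 _ k Nm) as Np.
    replace (g w) with (g w / (w - (m, y)) ^ k * (w - (m, y)) ^ k)%C by (field; exact Np).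
    rewrite Hd0. ring. }
  assert (Gd : forall w, Cmod (w - (t, y))%C < r / 2 -> g w = 0%C).
  { apply (identity_disk g (t, y) (r / 2)); [|exact Gt].
    intros w Hw. apply Hg. specialize (Bt w Hw). lra. }
  assert (Fd : forall w, Cmod (w - (m, y))%C < r / 4 -> w <> (m, y) -> f w = 0%C).
  { intros w Hw Nw. rewrite Hfg; [|lra|exact Nw]. rewrite Gd. unfold Cdiv; ring.
    replace (w - (t, y))%C with ((w - (m, y)) - ((t, y) - (m, y)))%C by ring.
    eapply Rle_lt_trans. apply Cmod_triangle. rewrite Cmod_opp. lra. }
  (* No point of [T] is left in the interval from [m - r / 4] to [m], against the choice of [m] as
     least upper bound. *)
  assert (Hnot : is_upper_bound T (m - r / 4)).
  { intros q [Hq1 Hq2]. apply Rnot_lt_le. intros Hlt.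
    assert (Hqm : q <= m) by (apply Hub; split; assumption).
    apply Hq2.
    destruct (Req_dec q m) as [->|Nq].
    - exists (r / 4). split. lra. exact Fd.
    - exists (Rmin (r / 4 - (m - q)) (m - q)). split. apply Rmin_glb_lt; lra.
      intros w Hw _.
      pose proof (Rmin_l (r / 4 - (m - q)) (m - q)). pose proof (Rmin_r (r / 4 - (m - q)) (m - q)).
      assert (Dq : Cmod ((q, y) - (m, y))%C = m - q) by (rewrite Dist, Rabs_left; lra).
      apply Fd.
      replace (w - (m, y))%C with ((w - (q, y)) + ((q, y) - (m, y)))%C by ring.
      eapply Rle_lt_trans. apply Cmod_triangle. lra.
      intros ->. rewrite Cmod_sub_sym in Hw. lra. }
  specialize (Hlub _ Hnot). lra.
Qed.

(** * Uniqueness of the continuation and gluing *)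

Lemma is_zeta_sum_unique (L : R) (s z1 z2 : C) : is_zeta_sum L s z1 -> is_zeta_sum L s z2 -> z1 = z2.
Proof.
  intros (u1 & H1 & S1) (u2 & H2 & S2).
  apply is_series_is_Cser in S1, S2.
  assert (E : forall m, u1 m = u2 m).
  { intros m. specialize (H1 m). specialize (H2 m). apply is_series_is_Cser in H1, H2.
    rewrite <- (is_Cser_unique _ _ H1). apply is_Cser_unique, H2. }
  rewrite <- (is_Cser_unique _ _ S1), <- (is_Cser_unique _ _ S2). apply Cser_ext, E.
Qed.

(** Values at poles are arbitrary, so [identity_half_plane] gives equality on punctured
    neighbourhoods only; continuity of both functions supplies the point 0. *)
Lemma zeta_extension_unique (L : R) (Z1 Z2 : C -> C) :
  is_zeta_extension L Z1 -> is_zeta_extension L Z2 ->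
  holomorphic_at Z1 0 -> holomorphic_at Z2 0 -> near 0 (fun w => Z1 w = Z2 w).
Proof.
  intros [M1 S1] [M2 S2] H1 H2. apply holomorphic_at_near, near_self in H1, H2.
  apply near_impl with (fun w => (Z1 w - Z2 w)%C = 0%C).
  { intros w E. replace (Z1 w) with (Z1 w - Z2 w + Z2 w)%C by ring. rewrite E. ring. }
  apply pnear_zero_cont. apply holo_at_minus; assumption.
  apply (identity_half_plane (fun w => Z1 w - Z2 w)%C (-1)).
  - intros s _. apply mero_minus; apply meromorphic_at_mero; [apply M1|apply M2].
  - intros s Hs. rewrite (is_zeta_sum_unique L s (Z1 s) (Z2 s)); [ring|apply S1, Hs|apply S2, Hs].
  - simpl. lra.
Qed.

Lemma C_derive_ext_near (f g : C -> C) (z : C) : holo_at f z -> near z (fun w => f w = g w) ->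
  C_derive f z = C_derive g z.
Proof.
  intros Hf E. symmetry. apply Cder_C_derive. eapply Cder_ext_loc. exact E. apply holo_C_derive, Hf.
Qed.

(** The explicit [d] shows that the choice made by [epsilon] satisfies [is_zeta_det]; uniqueness of
    the extension near 0 then identifies the two numbers. *)
Lemma det_laplacian_eq (L d : R) (Z : C -> C) : is_zeta_extension L Z -> holomorphic_at Z 0 ->
  RtoC d = Cexp (- C_derive Z 0)%C -> det_laplacian L = d.
Proof.
  intros HZ Hh Hd. unfold det_laplacian.
  assert (S : is_zeta_det L (epsilon (inhabits 0) (is_zeta_det L))).
  { apply epsilon_spec. exists d, Z. split; [|split]; assumption. }
  destruct S as (Z' & HZ' & Hh' & Hd').
  assert (E : C_derive Z' 0 = C_derive Z 0).
  { apply C_derive_ext_near. apply holomorphic_at_near, near_self in Hh'. exact Hh'.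
    apply (zeta_extension_unique L); assumption. }
  rewrite E, <- Hd in Hd'. injection Hd'. auto.
Qed.

(* Continuations to larger and larger half-planes agree by the identity theorem, up to poles. *)
Lemma glue (L : R) (Zs : nat -> C -> C) :
  (forall N s, - (INR N + 1) < Re s -> mero (Zs N) s) ->
  (forall N s, 1 < Re s -> is_zeta_sum L s (Zs N s)) ->
  exists Z, is_zeta_extension L Z /\ near 0 (fun w => Z w = Zs 0%nat w).
Proof.
  intros HM HS.
  (* Index 0 near the origin, as the conclusion demands. In all cases [w] lies in the half-plane of
     its index with a margin of [1 / 2], so that points within [1 / 2] of [w] lie there too. *)
  set (n := fun w : C => if Rlt_dec (- (1 / 2)) (Re w) then 0%nat else Z.to_nat (up (1 - Re w))).
  assert (Hn : forall w, - (INR (n w) + 1 / 2) < Re w).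
  { intros w. unfold n. destruct Rlt_dec. simpl; lra.
    destruct (archimed (1 - Re w)) as [A B].
    assert (Hup : (0 <= up (1 - Re w))%Z) by (apply le_IZR; lra).
    rewrite INR_IZR_INZ, Z2Nat.id by exact Hup. lra. }
  assert (Hb : forall w, INR (n w) <= Rmax 0 (2 - Re w)).
  { intros w. unfold n. destruct Rlt_dec. simpl; apply Rmax_l.
    destruct (archimed (1 - Re w)) as [A B].
    assert (Hup : (0 <= up (1 - Re w))%Z) by (apply le_IZR; lra).
    rewrite INR_IZR_INZ, Z2Nat.id by exact Hup. eapply Rle_trans; [|apply Rmax_r]. lra. }
  exists (fun w => Zs (n w) w). split; [split|].
  - intros s. apply meromorphic_at_mero.
    (* [M] exceeds every index [n w] with [w] within [1 / 2] of [s], so only finitely many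
       continuations occur near [s]. *)
    destruct (nfloor_ex (Rmax 0 (3 - Re s))) as [M0 HM0]. apply Rmax_l.
    set (M := S M0).
    assert (HMs : - (INR M + 1) < Re s).
    { unfold M. rewrite S_INR. pose proof (Rmax_r 0 (3 - Re s)). lra. }
    assert (Fin : forall K, exists d, 0 < d /\ forall m, (m <= K)%nat -> - (INR m + 1) < Re s ->
       forall w, Cmod (w - s)%C < d -> w <> s -> Zs m w = Zs M w).
    { assert (Step : forall m, exists d, 0 < d /\ (- (INR m + 1) < Re s ->
         forall w, Cmod (w - s)%C < d -> w <> s -> Zs m w = Zs M w)).
      { intros m. destruct (classic (- (INR m + 1) < Re s)) as [Hm|Hm].
        - set (X := Rmax (- (INR m + 1)) (- (INR M + 1))).
          destruct (identity_half_plane (fun w => Zs m w - Zs M w)%C X) with (s := s) as [d [Hd H]].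
          + intros v Hv. apply mero_minus; apply HM; eapply Rle_lt_trans; [|exact Hv| |exact Hv]; [apply Rmax_l|apply Rmax_r].
          + intros v Hv. rewrite (is_zeta_sum_unique L v (Zs m v) (Zs M v)); [ring|apply HS, Hv|apply HS, Hv].
          + apply Rmax_lub_lt; assumption.
          + exists d. split. exact Hd. intros _ w Hw Nw. specialize (H w Hw Nw). simpl in H.
            replace (Zs m w) with (Zs m w - Zs M w + Zs M w)%C by ring. rewrite H. ring.
        - exists 1. split. lra. intros; contradiction. }
      induction K.
      - destruct (Step 0%nat) as [d [Hd H]]. exists d. split. exact Hd. intros m Hm0. replace m with 0%nat by lia. exact H.
      - destruct IHK as [d1 [Hd1 H1]]. destruct (Step (S K)) as [d2 [Hd2 H2]].
        exists (Rmin d1 d2). split. apply Rmin_glb_lt; assumption.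
        intros m Hm Hms w Hw Nw.
        assert (w1 : Cmod (w - s)%C < d1) by (by_Rmin Hw).
        assert (w2 : Cmod (w - s)%C < d2) by (by_Rmin Hw).
        destruct (Nat.eq_dec m (S K)) as [->|Ne]. apply H2; assumption. apply H1; try assumption. lia. }
    destruct (Fin M) as [d [Hd H]].
    apply mero_ext with (Zs M); [|apply HM, HMs].
    exists (Rmin d (1 / 2)). split. apply Rmin_glb_lt; lra.
    intros w Hw Nw. symmetry.
    assert (w1 : Cmod (w - s)%C < d) by (by_Rmin Hw).
    assert (w2 : Cmod (w - s)%C < 1 / 2) by (by_Rmin Hw).
    pose proof (abs_fst_le_Cmod (w - s)%C) as A. simpl in A.
    assert (A' : Rabs (fst w + - fst s) < 1 / 2) by lra. apply Rabs_def2 in A'.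
    unfold Re in *. apply H; try assumption.
    + apply INR_le. eapply Rle_trans. apply Hb. unfold M. rewrite S_INR.
      apply Rmax_lub. pose proof (pos_INR M0); lra. 
      pose proof (Rmax_r 0 (3 - fst s)). lra.
    + specialize (Hn w). lra.
  - intros s Hs. apply HS, Hs.
  - apply near_impl with (fun w => - (1 / 2) < Re w).
    + intros w Hw. unfold n. destruct Rlt_dec; [reflexivity|contradiction].
    + apply near_lt_Re. simpl. lra.
Qed.

(** * The Euler-Maclaurin formula *)

(** Sums over [j < N], the empty sum included: the Euler-Maclaurin formula of order 0 has no
    boundary terms. *)
Fixpoint Rsum (N : nat) (g : nat -> R) : R :=
  match N with O => 0 | S n => Rsum n g + g n end.

Fixpoint Csum (N : nat) (g : nat -> C) : C :=
  match N with O => RtoC 0 | S n => (Csum n g + g n)%C end.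

Lemma Csum_S N g : Csum (S N) g = (Csum N g + g N)%C.
Proof. reflexivity. Qed.

Lemma Csum_fst N g : fst (Csum N g) = Rsum N (fun j => fst (g j)).
Proof. induction N; simpl. reflexivity. rewrite IHN. reflexivity. Qed.

Lemma Csum_snd N g : snd (Csum N g) = Rsum N (fun j => snd (g j)).
Proof. induction N; simpl. reflexivity. rewrite IHN. reflexivity. Qed.

Lemma Csum_ext N f g : (forall j, (j < N)%nat -> f j = g j) -> Csum N f = Csum N g.
Proof. induction N; intros H; simpl. reflexivity. rewrite IHN, H by auto. reflexivity. Qed.

Lemma Rsum_ext N f g : (forall j, (j < N)%nat -> f j = g j) -> Rsum N f = Rsum N g.
Proof. induction N; intros H; simpl. reflexivity. rewrite IHN, H by auto. reflexivity. Qed.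

Lemma Csum_zero n : Csum n (fun _ => RtoC 0) = 0%C.
Proof. induction n as [|n IHn]; simpl. reflexivity. rewrite IHn. ring. Qed.

Lemma Csum_split (b : nat -> R) (f g h : nat -> C) n :
  Csum n (fun j => b j * (f j - h j))%C =
  (Csum n (fun j => b j * (g j - h j))%C + Csum n (fun j => b j * (f j - g j))%C)%C.
Proof. induction n as [|n IHn]; simpl. ring. rewrite IHn. ring. Qed.

Definition CInt (f : R -> C) (a b : R) : C :=
  (RInt (fun x => fst (f x)) a b, RInt (fun x => snd (f x)) a b).

Definition rder (f : R -> C) (x : R) (l : C) : Prop :=
  is_derive (fun t => fst (f t)) x (fst l) /\ is_derive (fun t => snd (f t)) x (snd l).

Definition rcont (f : R -> C) (x : R) : Prop :=
  continuous (fun t => fst (f t)) x /\ continuous (fun t => snd (f t)) x.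

Lemma rder_rcont f x l : rder f x l -> rcont f x.
Proof.
  intros [H1 H2]. split; apply (ex_derive_continuous (V := RN)); eexists; eassumption.
Qed.

Lemma ex_RInt_Chas (f : R -> R) (a b : R) : (forall x, Rmin a b <= x <= Rmax a b -> continuous f x) -> ex_RInt f a b.
Proof. apply (ex_RInt_continuous (V := RCN)). Qed.

Lemma by_parts (u v u' v' : R -> R) (a b : R) : a <= b ->
  (forall x, a <= x <= b -> is_derive u x (u' x)) -> (forall x, a <= x <= b -> is_derive v x (v' x)) ->
  (forall x, a <= x <= b -> continuous u' x) -> (forall x, a <= x <= b -> continuous v' x) ->
  RInt (fun x => u x * v' x) a b = u b * v b - u a * v a - RInt (fun x => u' x * v x) a b.
Proof.
  intros Hab Hu Hv Cu Cv.
  assert (cu : forall x, a <= x <= b -> continuous u x).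
  { intros x Hx. apply (ex_derive_continuous (V := RN)). eexists; apply Hu, Hx. }
  assert (cv : forall x, a <= x <= b -> continuous v x).
  { intros x Hx. apply (ex_derive_continuous (V := RN)). eexists; apply Hv, Hx. }
  assert (I1 : ex_RInt (fun x => u x * v' x) a b).
  { apply ex_RInt_cont. exact Hab. intros x Hx. apply (continuous_mult u); auto. }
  assert (I2 : ex_RInt (fun x => u' x * v x) a b).
  { apply ex_RInt_cont. exact Hab. intros x Hx. apply (continuous_mult u'); auto. }
  assert (E : is_RInt (fun x => u' x * v x + u x * v' x) a b (minus (u b * v b) (u a * v a))).
  { apply (is_RInt_derive (V := RCN) (fun x => u x * v x)).
    - intros x Hx. rewrite Rmin_left, Rmax_right in Hx by exact Hab.
      apply (is_derive_mult u v); auto. intros; apply Rmult_comm.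
    - intros x Hx. rewrite Rmin_left, Rmax_right in Hx by exact Hab.
      apply (continuous_plus (V := RN) (fun x => u' x * v x) (fun x => u x * v' x)).
      apply (continuous_mult u'); auto. apply (continuous_mult u); auto. }
  apply (is_RInt_unique (V := RCN)) in E.
  rewrite (RInt_plus (V := RCN) (fun x => u' x * v x) (fun x => u x * v' x)) in E by assumption.
  unfold plus, minus, opp in E; simpl in E. unfold plus in E; simpl in E. lra.
Qed.

(* With [K_1 x = x - 1/2] and [K_(N+1)' = - (K_N - mean K_N)], [K_(N+1) 0 = K_(N+1) 1 = 0],
   each integration by parts contributes one boundary term, with coefficient [mean K_N]. *)
Lemma euler_maclaurin_kernel (N : nat) : exists (b : nat -> R) (K : R -> R), (forall x, continuous K x) /\
  forall (f : nat -> R -> R) (x0 : R),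
    (forall j x, x0 <= x <= x0 + 1 -> is_derive (f j) x (f (S j) x)) ->
    (f 0%nat x0 + f 0%nat (x0 + 1)) / 2 - RInt (f 0%nat) x0 (x0 + 1) =
    Rsum N (fun j => b j * (f (S j) (x0 + 1) - f (S j) x0)) + RInt (fun x => K (x - x0) * f (S (S N)) x) x0 (x0 + 1).
Proof.
  assert (CF : forall (f : nat -> R -> R) x0, (forall j x, x0 <= x <= x0 + 1 -> is_derive (f j) x (f (S j) x)) ->
      forall j x, x0 <= x <= x0 + 1 -> continuous (f j) x).
  { intros f x0 Hf j x Hx. apply (ex_derive_continuous (V := RN)). eexists. apply Hf, Hx. }
  assert (CS : forall (K : R -> R) x0 x, (forall x, continuous K x) -> continuous (fun x => K (x - x0)) x).
  { intros K x0 x HK. apply (continuous_comp (fun x => x - x0) K); [|apply HK].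
    apply (ex_derive_continuous (V := RN)). auto_derive. auto. }
  induction N as [|N IH].
  (* The kernel after two integrations by parts: minus the primitive of [x - 1 / 2] that vanishes at
     0 and at 1. As [x - 1 / 2] has mean 0, no boundary term arises. *)
  - exists (fun _ => 0), (fun x => (x - x ^ 2) / 2). split.
    { intros x. apply (ex_derive_continuous (V := RN)). auto_derive. auto. }
    intros f x0 Hf. simpl Rsum.
    assert (D1 : forall x, is_derive (fun x => x - x0 - 1 / 2) x 1) by (intros x; auto_derive; [auto|ring]).
    assert (D2 : forall x, is_derive (fun x => (x - x0 - (x - x0) ^ 2) / 2) x (- (x - x0 - 1 / 2))).
    { intros x; auto_derive; [auto|field]. }
    assert (C1 : forall x, continuous (fun x => x - x0 - 1 / 2) x).
    { intros x. apply (ex_derive_continuous (V := RN)). eexists; apply D1. }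
    rewrite (by_parts (fun x => (x - x0 - (x - x0) ^ 2) / 2) (f 1%nat) (fun x => - (x - x0 - 1 / 2)) (f 2%nat)); [|lra|intros; apply D2|apply Hf| |apply (CF f x0 Hf)].
    2:{ intros x _. apply (continuous_opp (fun x => x - x0 - 1 / 2)), C1. }
    rewrite (RInt_ext (fun x => - (x - x0 - 1 / 2) * f 1%nat x) (fun x => opp ((x - x0 - 1 / 2) * f 1%nat x))).
    2:{ intros x _. unfold opp; simpl. ring. }
    rewrite (RInt_opp (V := RCN)).
    2:{ apply ex_RInt_cont. lra. intros x Hx. apply (continuous_mult (fun x => x - x0 - 1 / 2)). apply C1. apply (CF f x0 Hf), Hx. }
    rewrite (by_parts (fun x => x - x0 - 1 / 2) (f 0%nat) (fun _ => 1) (f 1%nat)); [|lra|intros; apply D1|apply Hf| |apply (CF f x0 Hf)].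
    2:{ intros x _. apply continuous_const. }
    rewrite (RInt_ext (fun x => 1 * f 0%nat x) (f 0%nat)) by (intros; apply Rmult_1_l).
    unfold opp; simpl. field.
  - destruct IH as (b & K & HK & HE).
    set (mu := (RInt K 0 1 : R)).
    set (K1 := fun x => - RInt (fun t => K t - mu) 0 x).
    assert (Ck : forall x, continuous (fun t => K t - mu) x).
    { intros x. apply (continuous_minus K (fun _ => mu)). apply HK. apply continuous_const. }
    assert (Ik : forall x y, ex_RInt (fun t => K t - mu) x y).
    { intros x y. apply ex_RInt_Chas. intros; apply Ck. }
    assert (DK1 : forall x, is_derive K1 x (- (K x - mu))).
    { intros x. apply (is_derive_opp (fun x => RInt (fun t => K t - mu) 0 x)).
      apply (is_derive_RInt (V := RN) (fun t => K t - mu) (fun x => RInt (fun t => K t - mu) 0 x) 0 x). exists (mkposreal 1 Rlt_0_1). intros y _. apply (RInt_correct (V := RCN)), Ik.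
      apply Ck. }
    assert (K1_0 : K1 0 = 0). { unfold K1. rewrite RInt_point. apply Ropp_0. }
    assert (K1_1 : K1 1 = 0).
    { unfold K1. rewrite (RInt_minus (V := RCN) K (fun _ => mu)).
      rewrite RInt_const. fold mu. unfold minus, plus, opp, scal; simpl; unfold mult; simpl. ring.
      apply ex_RInt_Chas; intros; apply HK. apply ex_RInt_const. }
    exists (fun j => if Nat.eq_dec j N then mu else b j), K1. split.
    { intros x. apply (ex_derive_continuous (V := RN)). eexists. apply DK1. }
    intros f x0 Hf. rewrite (HE f x0 Hf). simpl Rsum.
    destruct (Nat.eq_dec N N) as [_|Ne]; [|contradiction].
    rewrite (Rsum_ext N (fun j => (if Nat.eq_dec j N then mu else b j) * (f (S j) (x0 + 1) - f (S j) x0))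
       (fun j => b j * (f (S j) (x0 + 1) - f (S j) x0))).
    2:{ intros j Hj. destruct (Nat.eq_dec j N); [lia|reflexivity]. }
    rewrite Rplus_assoc. f_equal.
    rewrite (by_parts (fun x => K1 (x - x0)) (f (S (S N))) (fun x => - (K (x - x0) - mu)) (f (S (S (S N))))).
    + replace (x0 + 1 - x0) with 1 by ring. replace (x0 - x0) with 0 by ring. rewrite K1_0, K1_1.
      assert (E1 : RInt (fun x => - (K (x - x0) - mu) * f (S (S N)) x) x0 (x0 + 1) =
                   mu * (f (S N) (x0 + 1) - f (S N) x0) - RInt (fun x => K (x - x0) * f (S (S N)) x) x0 (x0 + 1)).
      { assert (E2 : is_RInt (fun x => mu * f (S (S N)) x) x0 (x0 + 1) (mu * (f (S N) (x0 + 1) - f (S N) x0))).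
        { apply (is_RInt_scal (V := RN)). 
          apply (is_RInt_derive (V := RCN)).
          intros x Hx. rewrite Rmin_left, Rmax_right in Hx by lra. apply Hf, Hx.
          intros x Hx. rewrite Rmin_left, Rmax_right in Hx by lra. apply (CF f x0 Hf), Hx. }
        rewrite <- (is_RInt_unique _ _ _ _ E2).
        rewrite <- (RInt_minus (V := RCN) (fun x => mu * f (S (S N)) x) (fun x => K (x - x0) * f (S (S N)) x)).
        apply RInt_ext. intros x _. unfold minus, plus, opp; simpl. ring.
        eexists; exact E2.
        apply ex_RInt_cont. lra. intros x Hx. apply (continuous_mult (fun x => K (x - x0))).
        apply CS, HK. apply (CF f x0 Hf), Hx. }
      rewrite E1. lra.
    + lra.
    + intros x _. replace (- (K (x - x0) - mu)) with (scal 1 (- (K (x - x0) - mu))) by (unfold scal; simpl; unfold mult; simpl; ring).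
      apply (is_derive_comp K1 (fun x => x - x0)). apply DK1. auto_derive. auto. ring.
    + apply Hf.
    + intros x _. apply (continuous_opp (fun x => K (x - x0) - mu)).
      apply (continuous_minus (fun x => K (x - x0)) (fun _ => mu)). apply CS, HK. apply continuous_const.
    + apply (CF f x0 Hf).
Qed.

(** The remainder is written without the kernel, as trapezoid minus integral minus boundary terms,
    so that it is easily differentiated in a parameter of [f] and telescopes; the kernel survives
    only in the constant of [EM_bound]. *)
Definition EMrem (b : nat -> R) (N : nat) (f : nat -> R -> C) (x0 : R) : C :=
  ((f 0%nat x0 + f 0%nat (x0 + 1)%R) / 2 - CInt (f 0%nat) x0 (x0 + 1)
   - Csum N (fun j => b j * (f (S j) (x0 + 1)%R - f (S j) x0)))%C.

Definition EM_bound (b : nat -> R) (N : nat) (A : R) : Prop :=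
  forall (f : nat -> R -> C) (x0 M : R),
    (forall j x, x0 <= x <= x0 + 1 -> rder (f j) x (f (S j) x)) ->
    (forall x, x0 <= x <= x0 + 1 -> Cmod (f (S (S N)) x) <= M) ->
    Cmod (EMrem b N f x0) <= A * M.

Theorem euler_maclaurin (N : nat) : exists (b : nat -> R) (A : R), 0 <= A /\ EM_bound b N A.
Proof.
  destruct (euler_maclaurin_kernel N) as (b & K & HK & HE).
  destruct (continuous_bounded K 0 1) as (A & HA & HKA). lra. intros; apply HK.
  exists b, (2 * A). split. lra.
  intros f x0 M Hd HM.
  assert (B : forall g : nat -> R -> R, (forall j x, x0 <= x <= x0 + 1 -> is_derive (g j) x (g (S j) x)) ->
     (forall x, x0 <= x <= x0 + 1 -> Rabs (g (S (S N)) x) <= M) ->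
     Rabs ((g 0%nat x0 + g 0%nat (x0 + 1)) / 2 - RInt (g 0%nat) x0 (x0 + 1) -
           Rsum N (fun j => b j * (g (S j) (x0 + 1) - g (S j) x0))) <= A * M).
  { intros g Hg Hgm. rewrite (HE g x0 Hg).
    match goal with |- Rabs (?u + ?v - ?u) <= _ => replace (u + v - u) with v by lra end.
    replace (A * M) with ((x0 + 1 - x0) * (A * M)) by ring.
    apply abs_RInt_le_const. lra.
    - apply ex_RInt_cont. lra. intros x Hx. apply (continuous_mult (fun x => K (x - x0))).
      apply (continuous_comp (fun x => x - x0) K); [|apply HK].
      apply (ex_derive_continuous (V := RN)). auto_derive. auto.
      apply (ex_derive_continuous (V := RN)). eexists. apply Hg, Hx.
    - intros t Ht. rewrite Rabs_mult. apply Rmult_le_compat; try apply Rabs_pos.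
      apply HKA. lra. apply Hgm, Ht. }
  assert (B1 := B (fun j x => fst (f j x)) (fun j x Hx => proj1 (Hd j x Hx))
     (fun x Hx => Rle_trans _ _ _ (abs_fst_le_Cmod _) (HM x Hx))).
  assert (B2 := B (fun j x => snd (f j x)) (fun j x Hx => proj2 (Hd j x Hx))
     (fun x Hx => Rle_trans _ _ _ (abs_snd_le_Cmod _) (HM x Hx))).
  eapply Rle_trans. apply Cmod_le_abs.
  replace (fst (EMrem b N f x0)) with ((fst (f 0%nat x0) + fst (f 0%nat (x0 + 1))) / 2 - RInt (fun x => fst (f 0%nat x)) x0 (x0 + 1) -
           Rsum N (fun j => b j * (fst (f (S j) (x0 + 1)) - fst (f (S j) x0)))).
  2:{ unfold EMrem. simpl. rewrite Csum_fst.
      rewrite (Rsum_ext N (fun j => fst (b j * (f (S j) (x0 + 1)%R - f (S j) x0))%C) (fun j => b j * (fst (f (S j) (x0 + 1)) - fst (f (S j) x0)))).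
      field. intros j _. simpl. ring. }
  replace (snd (EMrem b N f x0)) with ((snd (f 0%nat x0) + snd (f 0%nat (x0 + 1))) / 2 - RInt (fun x => snd (f 0%nat x)) x0 (x0 + 1) -
           Rsum N (fun j => b j * (snd (f (S j) (x0 + 1)) - snd (f (S j) x0)))).
  2:{ unfold EMrem. simpl. rewrite Csum_snd.
      rewrite (Rsum_ext N (fun j => snd (b j * (f (S j) (x0 + 1)%R - f (S j) x0))%C) (fun j => b j * (snd (f (S j) (x0 + 1)) - snd (f (S j) x0)))).
      field. intros j _. simpl. ring. }
  lra.
Qed.

(** * Derivatives in a real variable; the family [Fj] of derivatives of [(x^2 + q)^(-s)] *)

Lemma rder_mult f g x lf lg : rder f x lf -> rder g x lg ->
  rder (fun t => f t * g t)%C x (lf * g x + f x * lg)%C.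
Proof.
  intros [F1 F2] [G1 G2].
  assert (M := fun u v lu lv Hu Hv => is_derive_mult (K := R_AbsRing) u v x lu lv Hu Hv Rmult_comm).
  split; simpl.
  - replace (fst lf * fst (g x) - snd lf * snd (g x) + (fst (f x) * fst lg - snd (f x) * snd lg)) with
      ((fst lf * fst (g x) + fst (f x) * fst lg) - (snd lf * snd (g x) + snd (f x) * snd lg)) by ring.
    apply (is_derive_minus (V := RN) (fun t => fst (f t) * fst (g t)) (fun t => snd (f t) * snd (g t))); apply M; assumption.
  - replace (fst lf * snd (g x) + snd lf * fst (g x) + (fst (f x) * snd lg + snd (f x) * fst lg)) with
      ((fst lf * snd (g x) + fst (f x) * snd lg) + (snd lf * fst (g x) + snd (f x) * fst lg)) by ring.
    apply (is_derive_plus (V := RN) (fun t => fst (f t) * snd (g t)) (fun t => snd (f t) * fst (g t))); apply M; assumption.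
Qed.

Lemma rder_plus f g x lf lg : rder f x lf -> rder g x lg -> rder (fun t => f t + g t)%C x (lf + lg)%C.
Proof.
  intros [F1 F2] [G1 G2]. split; apply (is_derive_plus (V := RN)); assumption.
Qed.

Lemma rder_const a x : rder (fun _ => a) x 0%C.
Proof.
  split; [exact (is_derive_const (V := RN) (fst a) x)|exact (is_derive_const (V := RN) (snd a) x)].
Qed.

Lemma rder_scal a f x l : rder f x l -> rder (fun t => a * f t)%C x (a * l)%C.
Proof.
  intros H. replace (a * l)%C with (0 * f x + a * l)%C by ring.
  apply (rder_mult (fun _ => a) f). apply rder_const. exact H.
Qed.

Lemma rder_RtoC (f : R -> R) (x l : R) : is_derive f x l -> rder (fun t => RtoC (f t)) x (RtoC l).
Proof. intros H. split. exact H. exact (is_derive_const (V := RN) 0 x). Qed.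

Lemma rder_comp f (g : R -> R) x l d : rder f (g x) l -> is_derive g x d ->
  rder (fun t => f (g t)) x (d * l)%C.
Proof.
  intros [H1 H2] Hg. split; simpl.
  - replace (d * fst l - 0 * snd l) with (scal d (fst l)) by (unfold scal; simpl; unfold mult; simpl; ring).
    apply (is_derive_comp (fun t => fst (f t)) g); assumption.
  - replace (d * snd l + 0 * fst l) with (scal d (snd l)) by (unfold scal; simpl; unfold mult; simpl; ring).
    apply (is_derive_comp (fun t => snd (f t)) g); assumption.
Qed.

Lemma rder_ext f g x l : (forall t, f t = g t) -> rder f x l -> rder g x l.
Proof.
  intros E [H1 H2]. split.
  - apply (is_derive_ext (fun t => fst (f t))); [|exact H1]. intros t; rewrite E; reflexivity.
  - apply (is_derive_ext (fun t => snd (f t))); [|exact H2]. intros t; rewrite E; reflexivity.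
Qed.

Lemma rder_Rcpow (e : C) (y : R) : 0 < y -> rder (fun y => Rcpow y e) y (e * Rcpow y (e - 1))%C.
Proof.
  intros Hy.
  replace (e * Rcpow y (e - 1))%C with ((/ y)%R * (e * Rcpow y e))%C.
  2:{ replace e with (e - 1 + 1)%C at 2 by ring. rewrite Rcpow_plus, Rcpow_1 by exact Hy.
      rewrite RtoC_inv by lra. field. intros E. injection E. lra. }
  apply rder_ext with (fun y => Cexp (0 + ln y * e)%C).
  { intros t. unfold Rcpow. f_equal. ring. }
  apply (rder_comp (fun t => Cexp (0 + t * e)%C) ln).
  - replace (Rcpow y e) with (Cexp (0 + ln y * e)%C) by (unfold Rcpow; f_equal; ring).
    apply (is_derive_segment Cexp 0 e). apply Cder_Cexp.
  - apply is_derive_Reals. apply derivable_pt_lim_ln. exact Hy.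
Qed.

(* [(kappa, i, k)] stands for the function [kappa(s) x^i (x^2 + q)^(- s - k)]. *)
Definition term := ((C -> C) * nat * nat)%type.

Definition tval (t : term) (q : R) (s : C) (x : R) : C :=
  let '(kappa, i, k) := t in (kappa s * (x ^ i)%R * Rcpow (x ^ 2 + q) (- s - INR k))%C.

Fixpoint lval (l : list term) (q : R) (s : C) (x : R) : C :=
  match l with nil => RtoC 0 | cons t l' => (tval t q s x + lval l' q s x)%C end.

(** The product rule. For [i = 0] the first term is left out rather than multiplied by 0, since it
    would violate the weight relation [2 k = i + j] of [good_term]. *)
Definition tder (t : term) : list term :=
  let '(kappa, i, k) := t in
  let t2 := (fun s => (-2) * (s + INR k) * kappa s, S i, S k)%C in
  match i with
  | O => t2 :: nil
  | S i' => (fun s => (INR i * kappa s)%C, i', k) :: t2 :: nil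
  end.

Fixpoint fam (j : nat) : list term :=
  match j with
  | O => (fun _ => RtoC 1, 0%nat, 0%nat) :: nil
  | S j' => flat_map tder (fam j')
  end.

(* The [j]-th derivative in [x] of [(x^2 + q)^(-s)]. *)
Definition Fj (j : nat) (q : R) (s : C) (x : R) : C := lval (fam j) q s x.

Lemma lval_app l1 l2 q s x : lval (l1 ++ l2) q s x = (lval l1 q s x + lval l2 q s x)%C.
Proof. induction l1; simpl. ring. rewrite IHl1. ring. Qed.

Lemma Fj_0 q s x : Fj 0 q s x = Rcpow (x ^ 2 + q) (- s).
Proof.
  unfold Fj. simpl. replace (- s - 0%R)%C with (- s)%C by ring. rewrite Rmult_1_r. ring.
Qed.

Lemma rder_tval t q s x : 0 < x ^ 2 + q -> rder (tval t q s) x (lval (tder t) q s x).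
Proof.
  destruct t as [[kappa i] k]. intros Hx.
  assert (D : rder (fun x => Rcpow (x ^ 2 + q) (- s - INR k)) x
    ((2 * x)%R * ((- s - INR k) * Rcpow (x ^ 2 + q) (- s - INR k - 1)))%C).
  { apply (rder_comp (fun y => Rcpow y (- s - INR k)) (fun x => x ^ 2 + q)).
    apply rder_Rcpow, Hx. auto_derive. auto. ring. }
  assert (Ek : (- s - INR k - 1)%C = (- s - INR (S k))%C) by (rewrite S_INR, RtoC_plus; ring).
  rewrite Ek in D.
  assert (P : rder (fun x => kappa s * (x ^ i)%R)%C x (kappa s * (INR i * x ^ pred i)%R)%C).
  { apply rder_scal. apply rder_RtoC. auto_derive. auto. ring. }
  pose proof (rder_mult _ _ _ _ _ P D) as Q. cbv beta in Q.
  unfold tval at 1.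
  replace (lval (tder (kappa, i, k)) q s x) with
   (kappa s * (INR i * x ^ pred i)%R * Rcpow (x ^ 2 + q) (- s - INR k) +
      kappa s * (x ^ i)%R * ((2 * x)%R * ((- s - INR k) * Rcpow (x ^ 2 + q) (- s - INR (S k)))))%C.
  exact Q.
  destruct i as [|i]; unfold tder, lval, tval.
  - simpl pow. rewrite !RtoC_mult. simpl INR. ring.
  - change (pred (S i)) with i. change (x ^ S (S i)) with (x * x ^ S i).
    set (w := x ^ S i). rewrite !RtoC_mult. ring.
Qed.

Lemma rder_lval l q s x : 0 < x ^ 2 + q -> rder (lval l q s) x (lval (flat_map tder l) q s x).
Proof.
  intros Hx. induction l as [|t l IH]; simpl.
  - apply rder_const.
  - rewrite lval_app. apply (rder_plus (tval t q s) (lval l q s)). apply rder_tval, Hx. exact IH.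
Qed.

Lemma rder_Fj j q s x : 0 < x ^ 2 + q -> rder (Fj j q s) x (Fj (S j) q s x).
Proof. apply rder_lval. Qed.

(** The relation [2 k = i + j] encodes the decay [(x^2 + q)^(- s - j / 2)]. That [kappa] vanishes at
    0 for [j > 0] reflects that [(x^2 + q)^0] is constant; the clause on [j = 0] starts the
    induction for it. *)
Definition good_term (j : nat) (t : term) : Prop :=
  let '(kappa, i, k) := t in (forall s, holo_at kappa s) /\ (2 * k = i + j)%nat /\
  (j = 0%nat -> i = 0%nat /\ k = 0%nat) /\ ((0 < j)%nat -> kappa 0%C = 0%C).

Lemma fam_good j : List.Forall (good_term j) (fam j).
Proof.
  induction j.
  - simpl. constructor; [|constructor]. split; [|split; [|split]]; try lia. intros; apply holo_at_const.
  - simpl. apply Forall_flat_map. eapply Forall_impl; [|exact IHj].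
    intros [[kappa i] k] (H1 & H2 & H3 & H4).
    assert (G : good_term (S j) (fun s => (-2) * (s + INR k) * kappa s, S i, S k)%C).
    { split; [|split; [|split]]; try lia.
      - intros s. apply holo_at_mult; [|apply H1]. apply holo_at_mult. apply holo_at_const.
        apply holo_at_plus. apply holo_at_id. apply holo_at_const.
      - intros _. destruct j as [|j].
        + destruct H3 as [_ H3]; [reflexivity|]. subst k. simpl. ring.
        + rewrite H4 by lia. ring. }
    unfold tder. destruct i as [|i]. { constructor; [exact G|constructor]. }
    constructor; [|constructor; [exact G|constructor]].
    split; [|split; [|split]]; try lia.
    + intros s. apply holo_at_mult. apply holo_at_const. apply H1.
    + intros _. destruct j as [|j]. lia. rewrite H4 by lia. ring.
Qed.

Lemma holo_tval j t q x : good_term j t -> forall s, holo_at (fun s => tval t q s x) s.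
Proof.
  destruct t as [[kappa i] k]. intros (H1 & _) s. unfold tval.
  apply holo_at_mult. apply holo_at_mult. apply H1. apply holo_at_const.
  apply (holo_at_Rcpow (x ^ 2 + q) (fun s => - s - INR k)%C).
  apply holo_at_minus; [|apply holo_at_const]. apply holo_at_opp, holo_at_id.
Qed.

Lemma holo_Fj j q x s : holo_at (fun s => Fj j q s x) s.
Proof.
  unfold Fj. pose proof (fam_good j) as G. revert G. generalize (fam j) as l. intros l G.
  induction G as [|t l Ht Hl IH]; simpl.
  - apply holo_at_const.
  - apply holo_at_plus. apply (holo_tval j), Ht. exact IH.
Qed.

Lemma Fj_at_0 j q x : Fj (S j) q 0 x = 0%C.
Proof.
  unfold Fj. pose proof (fam_good (S j)) as G. revert G. generalize (fam (S j)) as l. intros l G.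
  induction G as [|[[kappa i] k] l (_ & _ & _ & H) Hl IH]; simpl.
  - reflexivity.
  - rewrite IH, H by lia. ring.
Qed.

(** The power of [x] is absorbed by [|x| <= (x^2 + q)^(1/2)], and continuity bounds [kappa] near
    [s0]. The constants are uniform in [q] and [x], which the sums over [m] and [n] require. *)
Lemma tval_bound j t s0 : good_term j t -> exists r A, 0 < r /\ 0 <= A /\ forall s, Cmod (s - s0)%C < r -> forall q x, 0 <= q -> 0 < x ^ 2 + q ->
    Cmod (tval t q s x) <= A * exp (- (Re s + INR j / 2) * ln (x ^ 2 + q)).
Proof.
  destruct t as [[kappa i] k]. intros (H1 & H2 & _).
  destruct (H1 s0) as [l Hl]. apply Cder_Ccont in Hl.
  destruct (Hl 1 Rlt_0_1) as [r [Hr Hr1]].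
  exists r, (Cmod (kappa s0) + 1). split. exact Hr. split. pose proof (Cmod_ge_0 (kappa s0)); lra.
  intros s Hs q x Hq Hx. unfold tval.
  rewrite !Cmod_mult, Cmod_R, Cmod_Rcpow.
  assert (K : Cmod (kappa s) <= Cmod (kappa s0) + 1).
  { specialize (Hr1 (s - s0)%C Hs). replace (s0 + (s - s0))%C with s in Hr1 by ring.
    replace (kappa s) with (kappa s0 + (kappa s - kappa s0))%C by ring.
    eapply Rle_trans. apply Cmod_triangle. lra. }
  rewrite Rmult_assoc. apply Rmult_le_compat. apply Cmod_ge_0.
  apply Rmult_le_pos. apply Rabs_pos. apply Rlt_le, exp_pos. exact K.
  set (y := x ^ 2 + q) in *.
  assert (X : Rabs x <= exp (/ 2 * ln y)).
  { apply Rsqr_incr_0. 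
    - unfold Rsqr. rewrite <- exp_plus. replace (/ 2 * ln y + / 2 * ln y) with (ln y) by field.
      rewrite exp_ln by exact Hx. rewrite <- Rabs_mult, Rabs_pos_eq by nra. unfold y; nra.
    - apply Rabs_pos.
    - apply Rlt_le, exp_pos. }
  assert (Xi : Rabs (x ^ i) <= exp (INR i / 2 * ln y)).
  { rewrite <- RPow_abs. eapply Rle_trans. apply pow_incr. split. apply Rabs_pos. exact X.
    right. clear. induction i. simpl. replace (0 / 2 * ln y) with 0 by field. rewrite exp_0; reflexivity.
    simpl pow. rewrite IHi, <- exp_plus, S_INR. f_equal. field. }
  apply Rle_trans with (exp (INR i / 2 * ln y) * exp (Re (- s - INR k) * ln y)).
  apply Rmult_le_compat_r. apply Rlt_le, exp_pos. exact Xi.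
  rewrite <- exp_plus. right. f_equal.
  assert (Ek : 2 * INR k = INR i + INR j) by (rewrite <- (plus_INR i j), <- H2, mult_INR; simpl; ring).
  unfold Re; simpl. unfold Re in *. replace (INR i) with (2 * INR k - INR j) by lra. field.
Qed.

Lemma Fj_bound j s0 : exists r A, 0 < r /\ 0 <= A /\ forall s, Cmod (s - s0)%C < r -> forall q x, 0 <= q -> 0 < x ^ 2 + q ->
    Cmod (Fj j q s x) <= A * exp (- (Re s + INR j / 2) * ln (x ^ 2 + q)).
Proof.
  unfold Fj. pose proof (fam_good j) as G. revert G. generalize (fam j) as l. intros l G.
  induction G as [|t l Ht Hl IH].
  - exists 1, 0. split. lra. split. lra. intros. simpl. rewrite Cmod_0. lra.
  - destruct IH as (r1 & A1 & P1 & P2 & P3). destruct (tval_bound j t s0 Ht) as (r2 & A2 & Q1 & Q2 & Q3).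
    exists (Rmin r1 r2), (A1 + A2). split. apply Rmin_glb_lt; lra. split. lra.
    intros s Hs q x Hq Hx. simpl. eapply Rle_trans. apply Cmod_triangle.
    assert (s1 : Cmod (s - s0)%C < r1) by (by_Rmin Hs).
    assert (s2 : Cmod (s - s0)%C < r2) by (by_Rmin Hs).
    specialize (P3 s s1 q x Hq Hx). specialize (Q3 s s2 q x Hq Hx).
    rewrite Rmult_plus_distr_r, Rplus_comm. apply Rplus_le_compat; assumption.
Qed.

(** * Limits, series and integrals of complex functions *)

Definition is_CInt (f : R -> C) (a b : R) (I : C) : Prop :=
  is_RInt (fun x => fst (f x)) a b (fst I) /\ is_RInt (fun x => snd (f x)) a b (snd I).

Lemma is_CInt_unique f a b I : is_CInt f a b I -> CInt f a b = I.
Proof. intros [H1 H2]. apply Ceq; apply (is_RInt_unique (V := RCN)); assumption. Qed.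

Lemma is_CInt_cont f a b : (forall x, Rmin a b <= x <= Rmax a b -> rcont f x) -> is_CInt f a b (CInt f a b).
Proof.
  intros H. split; apply (RInt_correct (V := RCN)); apply ex_RInt_Chas; intros x Hx; apply (H x Hx).
Qed.

Lemma is_CInt_plus f g a b I J : is_CInt f a b I -> is_CInt g a b J -> is_CInt (fun x => f x + g x)%C a b (I + J)%C.
Proof. intros [H1 H2] [H3 H4]. split; apply (is_RInt_plus (V := RN)); assumption. Qed.

Lemma is_CInt_scal c f a b I : is_CInt f a b I -> is_CInt (fun x => c * f x)%C a b (c * I)%C.
Proof.
  intros [H1 H2]. split; simpl.
  - apply (is_RInt_minus (V := RN) (fun x => fst c * fst (f x)) (fun x => snd c * snd (f x)));
    apply (is_RInt_scal (V := RN)); assumption.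
  - apply (is_RInt_plus (V := RN) (fun x => fst c * snd (f x)) (fun x => snd c * fst (f x)));
    apply (is_RInt_scal (V := RN)); assumption.
Qed.

Lemma is_CInt_ext f g a b I : (forall x, Rmin a b < x < Rmax a b -> f x = g x) -> is_CInt f a b I -> is_CInt g a b I.
Proof.
  intros E [H1 H2]. split.
  - apply (is_RInt_ext (V := RN) (fun x => fst (f x))); [|exact H1]. intros x Hx. rewrite E by exact Hx. reflexivity.
  - apply (is_RInt_ext (V := RN) (fun x => snd (f x))); [|exact H2]. intros x Hx. rewrite E by exact Hx. reflexivity.
Qed.

Lemma is_CInt_minus f g a b I J : is_CInt f a b I -> is_CInt g a b J -> is_CInt (fun x => f x - g x)%C a b (I - J)%C.
Proof. intros [H1 H2] [H3 H4]. split; apply (is_RInt_minus (V := RN)); assumption. Qed.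

Lemma is_CInt_Chasles f a b c I J : is_CInt f a b I -> is_CInt f b c J -> is_CInt f a c (I + J)%C.
Proof. intros [H1 H2] [H3 H4]. split; eapply (is_RInt_Chasles (V := RN)); eassumption. Qed.

Lemma is_CInt_bound f a b I M : a <= b -> is_CInt f a b I -> (forall x, a <= x <= b -> Cmod (f x) <= M) ->
  Cmod I <= 2 * (b - a) * M.
Proof.
  intros Hab [H1 H2] HM.
  assert (B1 : Rabs (fst I) <= (b - a) * M).
  { rewrite <- (is_RInt_unique (V := RCN) _ _ _ _ H1).
    apply abs_RInt_le_const. exact Hab. eexists; exact H1. intros x Hx. eapply Rle_trans. apply abs_fst_le_Cmod. apply HM, Hx. }
  assert (B2 : Rabs (snd I) <= (b - a) * M).
  { rewrite <- (is_RInt_unique (V := RCN) _ _ _ _ H2).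
    apply abs_RInt_le_const. exact Hab. eexists; exact H2. intros x Hx. eapply Rle_trans. apply abs_snd_le_Cmod. apply HM, Hx. }
  eapply Rle_trans. apply Cmod_le_abs. lra.
Qed.

Lemma is_CInt_derive f df a b : a <= b -> (forall x, a <= x <= b -> rder f x (df x)) ->
  (forall x, a <= x <= b -> rcont df x) -> is_CInt df a b (f b - f a)%C.
Proof.
  intros Hab H1 H2.
  split; [apply (is_RInt_derive (V := RCN) (fun x => fst (f x)) (fun x => fst (df x)))
         |apply (is_RInt_derive (V := RCN) (fun x => snd (f x)) (fun x => snd (df x)))];
  intros x Hx; rewrite Rmin_left, Rmax_right in Hx by exact Hab.
  apply (H1 x Hx). apply (H2 x Hx). apply (H1 x Hx). apply (H2 x Hx).
Qed.

(** The counterpart of [weierstrass] for integrals: the quadratic remainder of [taylor1_bound] is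
    uniform in [x] and is integrated. *)
Lemma CInt_param (g : R -> C -> C) (dg : R -> C) (a b : R) (z : C) (r M : R) : a <= b -> 0 < r ->
  (forall x w, a <= x <= b -> Cmod (w - z)%C < r -> holo_at (g x) w) ->
  (forall x w, a <= x <= b -> Cmod (w - z)%C < r -> Cmod (g x w) <= M) ->
  (forall x, a <= x <= b -> Cder (g x) z (dg x)) ->
  (forall x w, a <= x <= b -> rcont (fun x => g x w) x) ->
  (forall x, a <= x <= b -> rcont dg x) ->
  Cder (fun w => CInt (fun x => g x w) a b) z (CInt dg a b).
Proof.
  intros Hab Hr Hg HM Hd C1 C2 eps He.
  assert (M0 : 0 <= M).
  { eapply Rle_trans. apply (Cmod_ge_0 (g a z)). apply HM. lra. rewrite Csub_diag, Cmod_0; lra. }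
  set (K := 2 * (b - a) * (2048 * M / r ^ 2)).
  assert (K0 : 0 <= K).
  { unfold K. apply Rmult_le_pos. lra. apply Rle_div_r. apply pow_lt, Hr. lra. }
  exists (Rmin (r / 4) (eps / (1 + K))). split.
  apply Rmin_glb_lt. lra. apply Rdiv_lt_0_compat; lra.
  intros h Hh.
  assert (h1 : Cmod h < r / 4) by (by_Rmin Hh).
  assert (h2 : Cmod h < eps / (1 + K)) by (by_Rmin Hh).
  assert (I1 : forall w, is_CInt (fun x => g x w) a b (CInt (fun x => g x w) a b)).
  { intros w. apply is_CInt_cont. intros x Hx. rewrite Rmin_left, Rmax_right in Hx by lra. apply C1, Hx. }
  assert (I2 : is_CInt dg a b (CInt dg a b)).
  { apply is_CInt_cont. intros x Hx. rewrite Rmin_left, Rmax_right in Hx by lra. apply C2, Hx. }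
  pose proof (is_CInt_minus _ _ _ _ _ _ (is_CInt_minus _ _ _ _ _ _ (I1 (z + h)%C) (I1 z)) (is_CInt_scal h _ _ _ _ I2)) as I3.
  eapply Rle_trans.
  - apply (is_CInt_bound _ _ _ _ (2048 * M / r ^ 2 * Cmod h ^ 2) Hab I3).
    intros x Hx. rewrite <- (Cder_C_derive _ _ _ (Hd x Hx)). apply taylor1_bound; auto.
  - replace (2 * (b - a) * (2048 * M / r ^ 2 * Cmod h ^ 2)) with (K * Cmod h * Cmod h) by (unfold K; ring).
    apply Rmult_le_compat_r. apply Cmod_ge_0.
    apply Rmult_lt_compat_r with (r := 1 + K) in h2; [|lra].
    replace (eps / (1 + K) * (1 + K)) with eps in h2 by (field; lra).
    pose proof (Cmod_ge_0 h). nra.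
Qed.

Definition Clim (a : nat -> C) (l : C) : Prop :=
  is_lim_seq (fun n => fst (a n)) (fst l) /\ is_lim_seq (fun n => snd (a n)) (snd l).

Lemma Rsum_sum_n (a : nat -> R) n : Rsum (S n) a = sum_n a n.
Proof. induction n. rewrite sum_O. simpl. ring. rewrite sum_Sn, <- IHn. reflexivity. Qed.

Lemma is_series_Rsum (a : nat -> R) (l : R) : is_series a l <-> is_lim_seq (fun n => Rsum n a) l.
Proof.
  rewrite (is_lim_seq_incr_1 (fun n => Rsum n a) l). unfold is_series, is_lim_seq.
  split; apply filterlim_ext; intros n; [symmetry|]; apply Rsum_sum_n.
Qed.

Lemma is_Cser_Csum a l : is_Cser a l <-> Clim (fun n => Csum n a) l.
Proof.
  unfold is_Cser, Clim. rewrite !is_series_Rsum.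
  split; intros [H1 H2]; split; (eapply is_lim_seq_ext; [|eassumption]); intros n; simpl;
  rewrite ?Csum_fst, ?Csum_snd; reflexivity.
Qed.

Lemma Clim_unique a l m : Clim a l -> Clim a m -> l = m.
Proof.
  intros [H1 H2] [H3 H4]. apply is_lim_seq_unique in H1, H2, H3, H4. apply Ceq; congruence.
Qed.

Lemma Clim_ext a b l : (forall n, a n = b n) -> Clim a l -> Clim b l.
Proof.
  intros E [H1 H2]. split; (eapply is_lim_seq_ext; [|eassumption]); intros n; simpl; rewrite E; reflexivity.
Qed.

Lemma Clim_plus a b l m : Clim a l -> Clim b m -> Clim (fun n => a n + b n)%C (l + m)%C.
Proof. intros [H1 H2] [H3 H4]. split; apply is_lim_seq_plus'; assumption. Qed.

Lemma Clim_const c : Clim (fun _ => c) c.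
Proof. split; apply is_lim_seq_const. Qed.

Lemma Clim_scal c a l : Clim a l -> Clim (fun n => c * a n)%C (c * l)%C.
Proof.
  intros [H1 H2].
  assert (S : forall (k : R) u (v : R), is_lim_seq u v -> is_lim_seq (fun n => k * u n) (k * v)).
  { intros k u v H. apply (is_lim_seq_scal_l u k v H). }
  split; simpl.
  - apply is_lim_seq_minus'; apply S; assumption.
  - apply is_lim_seq_plus'; apply S; assumption.
Qed.

Lemma Clim_opp a l : Clim a l -> Clim (fun n => - a n)%C (- l)%C.
Proof.
  intros H. apply (Clim_scal (-1)) in H. replace (- l)%C with (-1 * l)%C by ring.
  eapply Clim_ext; [|exact H]. intros n. cbv beta. ring.
Qed.

Lemma Clim_minus a b l m : Clim a l -> Clim b m -> Clim (fun n => a n - b n)%C (l - m)%C.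
Proof. intros H1 H2. apply (Clim_plus a (fun n => - b n)%C). exact H1. apply Clim_opp, H2. Qed.

Lemma Clim_Csum N (a : nat -> nat -> C) (l : nat -> C) : (forall j, (j < N)%nat -> Clim (a j) (l j)) ->
  Clim (fun n => Csum N (fun j => a j n)) (Csum N l).
Proof.
  induction N; intros H; simpl. apply Clim_const.
  apply Clim_plus; auto.
Qed.

Lemma Clim_0 a (e : nat -> R) : (forall n, Cmod (a n) <= e n) -> is_lim_seq e 0 -> Clim a 0%C.
Proof.
  intros H He.
  assert (G : forall u, (forall n, Rabs (u n) <= e n) -> is_lim_seq u 0).
  { intros u Hu. apply is_lim_seq_abs_0.
    apply (is_lim_seq_le_le (fun _ => 0) _ e). intros n; split. apply Rabs_pos. apply Hu.
    apply is_lim_seq_const. exact He. }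
  split; apply G; intros n; (eapply Rle_trans; [|apply H]). apply abs_fst_le_Cmod. apply abs_snd_le_Cmod.
Qed.

Lemma Clim_RtoC (u : nat -> R) (l : R) : is_lim_seq u l -> Clim (fun n => RtoC (u n)) (RtoC l).
Proof. intros H. split. exact H. apply is_lim_seq_const. Qed.

Lemma Clim_subseq a l (phi : nat -> nat) : filterlim phi eventually eventually -> Clim a l -> Clim (fun n => a (phi n)) l.
Proof.
  intros F [H1 H2].
  split; [apply (filterlim_comp _ _ _ phi (fun n => fst (a n)) _ _ _ F H1)
         |apply (filterlim_comp _ _ _ phi (fun n => snd (a n)) _ _ _ F H2)].
Qed.

(** Real powers keep the form [exp (- p * ln x)] throughout, in which [Cmod_Rcpow] produces them. *)
Lemma is_lim_seq_exp_ln (p : R) : 0 < p -> is_lim_seq (fun n => exp (- p * ln (INR n + 1))) 0.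
Proof.
  intros Hp.
  apply (filterlim_comp _ _ _ (fun n => - p * ln (INR n + 1)) exp eventually (Rbar_locally m_infty) (locally 0)).
  2: exact is_lim_exp_m.
  change (is_lim_seq (fun n => - p * ln (INR n + 1)) m_infty).
  apply is_lim_seq_ext with (fun n => - (p * ln (INR n + 1))). intros; ring.
  apply (is_lim_seq_opp _ p_infty).
  replace p_infty with (Rbar_mult p p_infty).
  2:{ simpl. destruct Rle_dec; [|lra]. destruct Rle_lt_or_eq_dec; [reflexivity|lra]. }
  apply is_lim_seq_scal_l.
  apply (filterlim_comp _ _ _ (fun n => INR n + 1) ln eventually (Rbar_locally p_infty) (Rbar_locally p_infty)).
  2: exact is_lim_ln_p.
  change (is_lim_seq (fun n => INR n + 1) p_infty).
  apply is_lim_seq_plus with p_infty 1. apply is_lim_seq_INR. apply is_lim_seq_const. reflexivity.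
Qed.

(** By the mean value theorem the terms are dominated by differences of [x^(1 - p) / (p - 1)], which
    telescope. *)
Lemma ex_series_power (p : R) : 1 < p -> ex_series (fun n => exp (- p * ln (INR n + 1))).
Proof.
  intros Hp. apply ex_series_incr_1.
  set (g := fun x => exp ((1 - p) * ln x)).
  assert (T : ex_series (fun n => / (p - 1) * (g (INR n + 1) - g (INR n + 2)))).
  { apply (ex_series_scal (V := RN)). exists (g 1). apply is_series_Rsum.
    apply is_lim_seq_ext with (fun n => g 1 - g (INR n + 1)).
    { induction n. simpl. replace (0 + 1) with 1 by ring. ring.
      simpl Rsum. rewrite <- IHn, S_INR. replace (INR n + 1 + 1) with (INR n + 2) by ring. ring. }
    replace (Finite (g 1)) with (Finite (g 1 - 0)) by (f_equal; ring).
    apply is_lim_seq_minus'. apply is_lim_seq_const.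
    apply is_lim_seq_ext with (fun n => exp (- (p - 1) * ln (INR n + 1))).
    intros n. unfold g. f_equal. ring. apply is_lim_seq_exp_ln. lra. }
  apply (ex_series_le (V := RCN) _ _) with (2 := T).
  intros n. change (Rabs (exp (- p * ln (INR (S n) + 1))) <= / (p - 1) * (g (INR n + 1) - g (INR n + 2))).
  rewrite Rabs_pos_eq by apply Rlt_le, exp_pos.
  rewrite <- (S_INR n). set (x := INR (S n)).
  assert (Hx : 1 <= x) by (unfold x; rewrite S_INR; pose proof (pos_INR n); lra).
  replace (INR n + 2) with (x + 1) by (unfold x; rewrite S_INR; ring).
  destruct (MVT_gen g x (x + 1) (fun t => (1 - p) / t * exp ((1 - p) * ln t))) as [c [Hc E]].
  { intros t Ht. rewrite Rmin_left, Rmax_right in Ht by lra. unfold g. auto_derive. lra. field. lra. }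
  { intros t Ht. rewrite Rmin_left, Rmax_right in Ht by lra. apply continuity_pt_filterlim.
    apply (ex_derive_continuous (V := RN)). unfold g. auto_derive. lra. }
  rewrite Rmin_left, Rmax_right in Hc by lra.
  replace (g x - g (x + 1)) with ((p - 1) * (exp ((1 - p) * ln c) / c)).
  2:{ replace (g x - g (x + 1)) with (- (g (x + 1) - g x)) by ring. rewrite E. field. lra. }
  rewrite <- Rmult_assoc, Rinv_l, Rmult_1_l by lra.
  replace (exp ((1 - p) * ln c) / c) with (exp (- p * ln c)).
  2:{ replace ((1 - p) * ln c) with (ln c + - p * ln c) by ring. rewrite exp_plus, exp_ln by lra. field. lra. }
  apply exp_le. assert (ln c <= ln (x + 1)) by (apply ln_le; lra). nra.
Qed.

(** For [z >= 1] a larger exponent only helps; for [k <= z < 1] it costs at most the factor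
    [k^(-d)]. This replaces the exponent, which moves with [s], by a fixed one. *)
Lemma exp_ln_compare (k p P d y z : R) : 0 < k <= 1 -> k <= z -> z <= y -> 0 <= p -> p <= P <= p + d ->
  exp (- P * ln y) <= exp (- d * ln k) * exp (- p * ln z).
Proof.
  intros Hk Hz Hy Hp HP. rewrite <- exp_plus. apply exp_le.
  assert (L1 : ln z <= ln y) by (apply ln_le; lra).
  assert (L2 : ln k <= ln z) by (apply ln_le; lra).
  assert (L3 : ln k <= 0) by (rewrite <- ln_1; apply ln_le; lra).
  apply Rle_trans with (- P * ln z).
  { assert (P * ln z <= P * ln y) by (apply Rmult_le_compat_l; lra). lra. }
  replace (- P * ln z) with (- p * ln z + (P - p) * (- ln z)) by ring.
  assert ((P - p) * (- ln z) <= (P - p) * (- ln k)) by (apply Rmult_le_compat_l; lra).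
  assert ((P - p) * (- ln k) <= d * (- ln k)) by (apply Rmult_le_compat_r; lra). lra.
Qed.

(** * Euler-Maclaurin remainders of powers *)

Lemma Fj_rcont j q s x : 0 < x ^ 2 + q -> rcont (Fj j q s) x.
Proof. intros H. eapply rder_rcont. apply rder_Fj, H. Qed.

Lemma continuous_ln_quad q x : 0 < x ^ 2 + q -> continuous (fun x => ln (x ^ 2 + q)) x.
Proof. intros H. apply (ex_derive_continuous (V := RN)). auto_derive. exact H. Qed.

Definition dF0 (q : R) (z : C) (x : R) : C := (- ln (x ^ 2 + q) * Fj 0 q z x)%C.

Lemma Cder_F0 q x z : Cder (fun s => Fj 0 q s x) z (dF0 q z x).
Proof.
  unfold dF0. apply Cder_ext with (fun s => Rcpow (x ^ 2 + q) (- s)).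
  intros w; symmetry; apply Fj_0.
  rewrite Fj_0. replace (- ln (x ^ 2 + q) * Rcpow (x ^ 2 + q) (- z))%C
    with ((- (1)) * (ln (x ^ 2 + q) * Rcpow (x ^ 2 + q) (- z)))%C by ring.
  apply (Cder_comp (Rcpow (x ^ 2 + q)) (fun s => - s)%C). apply Cder_Rcpow.
  apply Cder_opp, Cder_id.
Qed.

Lemma rcont_dF0 q z x : 0 < x ^ 2 + q -> rcont (dF0 q z) x.
Proof.
  intros H. eapply rder_rcont. unfold dF0. apply rder_mult; [|apply rder_Fj, H].
  apply rder_ext with (fun x => RtoC (- ln (x ^ 2 + q))).
  intros t. apply RtoC_opp.
  apply rder_RtoC. auto_derive. exact H. reflexivity.
Qed.

Lemma Cder_CInt_F0 q a b z : a <= b -> (forall x, a <= x <= b -> 0 < x ^ 2 + q) ->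
  Cder (fun s => CInt (Fj 0 q s) a b) z (CInt (dF0 q z) a b).
Proof.
  intros Hab Hq.
  destruct (continuous_bounded (fun x => ln (x ^ 2 + q)) a b Hab) as (B & HB & HB1).
  { intros x Hx. apply continuous_ln_quad, Hq, Hx. }
  apply (CInt_param (fun x s => Fj 0 q s x) (dF0 q z) a b z 1 (exp ((Cmod z + 1) * B)) Hab Rlt_0_1).
  - intros x w _ _. apply holo_Fj.
  - intros x w Hx Hw. rewrite Fj_0, Cmod_Rcpow. apply exp_le.
    eapply Rle_trans. apply Rle_abs. rewrite Rabs_mult.
    apply Rmult_le_compat; try apply Rabs_pos; [|apply HB1, Hx].
    eapply Rle_trans. apply (re_le_Cmod (- w)%C). rewrite Cmod_opp.
    replace w with ((w - z) + z)%C by ring. eapply Rle_trans. apply Cmod_triangle. lra.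
  - intros x _. apply Cder_F0.
  - intros x w Hx. apply (Fj_rcont 0), Hq, Hx.
  - intros x Hx. apply rcont_dF0, Hq, Hx.
Qed.

Lemma Cder_Csum N (f : nat -> C -> C) (l : nat -> C) z : (forall j, (j < N)%nat -> Cder (f j) z (l j)) ->
  Cder (fun w => Csum N (fun j => f j w)) z (Csum N l).
Proof.
  induction N; intros H; simpl. apply Cder_const. apply Cder_plus; auto.
Qed.

Definition EMder (b : nat -> R) (N : nat) (q : R) (z : C) (x0 : R) : C :=
  ((dF0 q z x0 + dF0 q z (x0 + 1)%R) / 2 - CInt (dF0 q z) x0 (x0 + 1)
   - Csum N (fun j => b j * (C_derive (fun s => Fj (S j) q s (x0 + 1)%R) z - C_derive (fun s => Fj (S j) q s x0) z)))%C.

Lemma Cder_EMrem b N q z x0 : (forall x, x0 <= x <= x0 + 1 -> 0 < x ^ 2 + q) ->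
  Cder (fun s => EMrem b N (fun j => Fj j q s) x0) z (EMder b N q z x0).
Proof.
  intros Hq. unfold EMrem, EMder. apply Cder_minus. apply Cder_minus.
  - unfold Cdiv.
    replace ((dF0 q z x0 + dF0 q z (x0 + 1)%R) * / 2)%C with
      ((dF0 q z x0 + dF0 q z (x0 + 1)%R) * / 2 + (Fj 0 q z x0 + Fj 0 q z (x0 + 1)%R) * 0)%C by ring.
    apply (Cder_mult (fun s => Fj 0 q s x0 + Fj 0 q s (x0 + 1)%R)%C (fun _ => / 2)%C); [|apply Cder_const].
    apply Cder_plus; apply Cder_F0.
  - apply Cder_CInt_F0. lra. exact Hq.
  - apply Cder_Csum. intros j _. apply Cder_scal. apply Cder_minus; apply holo_C_derive, holo_Fj.
Qed.

Section EulerMaclaurin.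

Variables (N : nat) (b : nat -> R) (A : R).
Hypothesis HA : 0 <= A.
Hypothesis HEM : EM_bound b N A.

Definition emF (q : R) (s : C) (x0 : R) : C := EMrem b N (fun j => Fj j q s) x0.

(* [p] is the exponent of decay guaranteed for all [s] close to [s0]. *)
Lemma emF_bound (s0 : C) (p : R) : 0 <= p -> p < Re s0 + (INR N + 2) / 2 ->
  exists r D, 0 < r /\ 0 <= D /\ forall s, Cmod (s - s0)%C < r ->
  forall k q x0 y, 0 < k <= 1 -> 0 <= q -> k <= y -> (forall x, x0 <= x <= x0 + 1 -> y <= x ^ 2 + q) ->
    Cmod (emF q s x0) <= D * exp (- (2 * (Re s0 + (INR N + 2) / 2 - p)) * ln k) * exp (- p * ln y).
Proof.
  intros Hp0 Hp. destruct (Fj_bound (S (S N)) s0) as (r & D & Hr & HD & HF).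
  set (P0 := Re s0 + (INR N + 2) / 2) in *.
  exists (Rmin r (P0 - p)), (A * D). split. apply Rmin_glb_lt; lra.
  split. apply Rmult_le_pos; assumption.
  intros s Hs k q x0 y Hk Hq Hky Hx.
  assert (s1 : Cmod (s - s0)%C < r) by (by_Rmin Hs).
  assert (s2 : Cmod (s - s0)%C < P0 - p) by (by_Rmin Hs).
  rewrite !Rmult_assoc. apply HEM.
  - intros j x Hxx. apply rder_Fj. specialize (Hx x Hxx). lra.
  - intros x Hxx. specialize (Hx x Hxx).
    eapply Rle_trans. apply (HF s s1); lra.
    apply Rmult_le_compat_l. exact HD.
    pose proof (abs_fst_le_Cmod (s - s0)%C) as B. simpl in B.
    assert (B2 : Rabs (fst s + - fst s0) < P0 - p) by lra. apply Rabs_def2 in B2.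
    apply (exp_ln_compare k p _ (2 * (P0 - p)) _ y); try lra.
    unfold P0, Re in *. rewrite !S_INR. lra.
Qed.

(** With [q = 0] the function [x^(-2 s)] may be singular at 0, so the intervals start at 1. *)
Definition zterm (n : nat) (s : C) : C := emF 0 s (INR n + 1).

Lemma zterm_holo n s : holo_at (zterm n) s.
Proof.
  eexists. apply Cder_EMrem. intros x Hx. pose proof (pos_INR n). nra.
Qed.

Lemma zterm_bound s0 : - (INR N + 1) / 2 < Re s0 -> exists r e, 0 < r /\ ex_series e /\
  forall n s, Cmod (s - s0)%C < r -> Cmod (zterm n s) <= e n.
Proof.
  intros Hs0. set (P0 := Re s0 + (INR N + 2) / 2).
  assert (HP0 : / 2 < P0) by (unfold P0; lra).
  (* Above [1/2], so that the sum of [(n + 1)^(- 2 p)] converges, and below [P0], to leave room for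
     [s] around [s0]. *)
  set (p := (P0 + / 2) / 2).
  destruct (emF_bound s0 p) as (r & D & Hr & HD & H). unfold p; lra. fold P0. unfold p; lra.
  exists r, (fun n => D * exp (- (2 * p) * ln (INR n + 1))). split. exact Hr. split.
  - apply (ex_series_scal (V := RN)). apply ex_series_power. unfold p. lra.
  - intros n s Hs. pose proof (pos_INR n).
    eapply Rle_trans. apply (H s Hs 1 0 (INR n + 1) ((INR n + 1) ^ 2)); try lra.
    nra. intros x Hx. assert ((INR n + 1) ^ 2 <= x ^ 2) by (apply pow_incr; lra). lra.
    rewrite ln_1, Rmult_0_r, exp_0, Rmult_1_r. right. f_equal. f_equal.
    replace ((INR n + 1) ^ 2) with ((INR n + 1) * (INR n + 1)) by ring. rewrite ln_mult by lra. ring.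
Qed.

Definition rterm (a : R) (n : nat) (s : C) : C :=
  (emF (a ^ 2) s (INR n) + emF (a ^ 2) s (- INR n - 1))%C.

Lemma rterm_holo a n s : 0 < a -> holo_at (rterm a n) s.
Proof.
  intros Ha. apply holo_at_plus; eexists; apply Cder_EMrem; intros x Hx; nra.
Qed.

(** The inequality of the means bounds [n^2 + a^2] below by a multiple of the product [a (n + 1)].
    The estimate thus factorizes into powers of [a] and of [n + 1], both with an exponent above 1,
    and can be summed over [n] and then over [a = m u]. *)
Lemma rterm_bound s0 a0 : - INR N / 2 < Re s0 -> 0 < a0 -> exists r D p, 0 < r /\ 0 <= D /\ 1 < p /\
  forall n s a, Cmod (s - s0)%C < r -> a0 <= a ->
    Cmod (rterm a n s) <= D * exp (- p * ln a) * exp (- p * ln (INR n + 1)).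
Proof.
  intros Hs0 Ha0. set (P0 := Re s0 + (INR N + 2) / 2).
  assert (HP0 : 1 < P0) by (unfold P0; lra).
  set (p := (P0 + 1) / 2).
  destruct (emF_bound s0 p) as (r & D & Hr & HD & H). unfold p; lra. fold P0. unfold p; lra.
  (* For [n = 0] there is only [a^2], which is at least [k a] because [a >= a0]; for [n >= 1],
     [k <= 1] is what counts. *)
  set (k := Rmin 1 a0). assert (Hk : 0 < k) by (apply Rmin_glb_lt; lra).
  assert (Hk1 : k <= 1) by apply Rmin_l. assert (Hk2 : k <= a0) by apply Rmin_r.
  set (E := exp (- (2 * (Re s0 + (INR N + 2) / 2 - p)) * ln (k * k))).
  exists r, (2 * (D * E * exp (- p * ln k))), p. split. exact Hr. split.
  { pose proof (exp_pos (- p * ln k)). pose proof (exp_pos (- (2 * (Re s0 + (INR N + 2) / 2 - p)) * ln (k * k))). fold E in H1.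
    repeat apply Rmult_le_pos; lra. }
  split. unfold p; lra.
  intros n s a Hs Ha.
  pose proof (pos_INR n) as Hn.
  set (y := k * (a * (INR n + 1))).
  assert (Hy : k * k <= y).
  { unfold y. apply Rmult_le_compat_l. lra. nra. }
  assert (Bd : forall x, INR n <= Rabs x -> y <= x ^ 2 + a ^ 2).
  { intros x Hx. rewrite <- (pow2_abs x).
    assert (L1 : INR n ^ 2 + a ^ 2 <= Rabs x ^ 2 + a ^ 2) by nra.
    eapply Rle_trans; [|exact L1]. unfold y.
    destruct n as [|n].
    - simpl INR. replace (0 + 1) with 1 by ring. nra.
    - rewrite S_INR in *. pose proof (pos_INR n). set (m := INR n + 1) in *.
      assert (k * (a * (m + 1)) <= 1 * (a * (m + 1))) by (apply Rmult_le_compat_r; nra).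
      assert (0 <= a * (m - 1)) by (apply Rmult_le_pos; unfold m; lra).
      assert (a * (m + 1) <= 2 * (m * a)) by lra.
      pose proof (Rle_0_sqr (m - a)). unfold Rsqr in *. nra. }
  assert (Ey : exp (- p * ln y) = exp (- p * ln k) * exp (- p * ln a) * exp (- p * ln (INR n + 1))).
  { unfold y. rewrite !ln_mult by nra. rewrite <- !exp_plus. f_equal. ring. }
  assert (kk : 0 < k * k <= 1) by nra.
  unfold rterm. eapply Rle_trans. apply Cmod_triangle.
  assert (B1 := H s Hs (k * k) (a ^ 2) (INR n) y kk ltac:(nra) Hy
     ltac:(intros x Hx; apply Bd; rewrite Rabs_pos_eq; lra)).
  assert (B2 := H s Hs (k * k) (a ^ 2) (- INR n - 1) y kk ltac:(nra) Hy
     ltac:(intros x Hx; apply Bd; rewrite Rabs_left1; lra)).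
  fold E in B1, B2. rewrite Ey in B1, B2. lra.
Qed.

(** The boundary terms and the integrals telescope, and the trapezoids form the plain sum corrected
    by half the difference of the end values. *)
Lemma emF_sum_right q s y M : (forall x, y <= x -> 0 < x ^ 2 + q) ->
  Csum M (fun n => emF q s (y + INR n)) =
  (Csum M (fun n => Fj 0 q s (y + INR n)%R) + (Fj 0 q s (y + INR M)%R - Fj 0 q s y) / 2
   - CInt (Fj 0 q s) y (y + INR M)
   - Csum N (fun j => b j * (Fj (S j) q s (y + INR M)%R - Fj (S j) q s y)))%C.
Proof.
  intros Hq. induction M.
  - simpl. replace (y + 0) with y by ring.
    rewrite (is_CInt_unique (Fj 0 q s) y y 0%C).
    2:{ split; apply (is_RInt_point (V := RN)). }
    rewrite (Csum_ext N _ (fun _ => RtoC 0)) by (intros; ring).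
    rewrite Csum_zero. field.
  - rewrite !(Csum_S M), IHM. unfold emF at 1, EMrem. rewrite S_INR, <- (Rplus_assoc y (INR M) 1).
    pose proof (pos_INR M).
    rewrite (is_CInt_unique (Fj 0 q s) y (y + INR M + 1) (CInt (Fj 0 q s) y (y + INR M) + CInt (Fj 0 q s) (y + INR M) (y + INR M + 1))%C).
    2:{ eapply is_CInt_Chasles; apply is_CInt_cont; intros x Hx; rewrite Rmin_left, Rmax_right in Hx by lra; apply (Fj_rcont 0), Hq; lra. }
    rewrite (Csum_split b (fun j => Fj (S j) q s (y + INR M + 1)%R) (fun j => Fj (S j) q s (y + INR M)%R) (fun j => Fj (S j) q s y)). field.
Qed.

Lemma emF_sum_left q s M : (forall x, x <= 0 -> 0 < x ^ 2 + q) ->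
  Csum M (fun n => emF q s (- INR n - 1)) =
  (Csum M (fun n => Fj 0 q s (- INR n - 1)%R) + (Fj 0 q s 0%R - Fj 0 q s (- INR M)%R) / 2
   - CInt (Fj 0 q s) (- INR M) 0
   - Csum N (fun j => b j * (Fj (S j) q s 0%R - Fj (S j) q s (- INR M)%R)))%C.
Proof.
  intros Hq. induction M.
  - simpl. rewrite Ropp_0.
    rewrite (is_CInt_unique (Fj 0 q s) 0 0 0%C).
    2:{ split; apply (is_RInt_point (V := RN)). }
    rewrite (Csum_ext N _ (fun _ => RtoC 0)) by (intros; ring).
    rewrite Csum_zero. field.
  - rewrite !(Csum_S M), IHM. unfold emF at 1, EMrem. rewrite S_INR.
    pose proof (pos_INR M).
    replace (- INR M - 1 + 1) with (- INR M) by ring. replace (- (INR M + 1)) with (- INR M - 1) by ring.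
    rewrite (is_CInt_unique (Fj 0 q s) (- INR M - 1) 0 (CInt (Fj 0 q s) (- INR M - 1) (- INR M) + CInt (Fj 0 q s) (- INR M) 0)%C).
    2:{ eapply is_CInt_Chasles; apply is_CInt_cont; intros x Hx; rewrite Rmin_left, Rmax_right in Hx by lra; apply (Fj_rcont 0), Hq; lra. }
    rewrite (Csum_split b (fun j => Fj (S j) q s 0%R) (fun j => Fj (S j) q s (- INR M)%R) (fun j => Fj (S j) q s (- INR M - 1)%R)). field.
Qed.

End EulerMaclaurin.

(** * Analytic continuation *)

Lemma Clim_Cmod_0 a : is_lim_seq (fun n => Cmod (a n)) 0 -> Clim a 0%C.
Proof. apply Clim_0. intros; lra. Qed.

Lemma Fj_0_q0 s x : 0 < x -> Fj 0 0 s x = Rcpow x (- (2) * s).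
Proof.
  intros Hx. rewrite Fj_0. unfold Rcpow. f_equal.
  replace (x ^ 2 + 0) with (x * x) by ring. rewrite ln_mult by exact Hx. rewrite RtoC_plus. ring.
Qed.

Lemma Fj_lim_0 j q s (x : nat -> R) : 0 <= q -> (forall n, INR n + 1 <= Rabs (x n)) -> 0 < Re s ->
  Clim (fun n => Fj j q s (x n)) 0%C.
Proof.
  intros Hq Hx Hs. destruct (Fj_bound j s) as (r & D & Hr & HD & H).
  specialize (H s). replace (s - s)%C with (RtoC 0) in H by ring. rewrite Cmod_0 in H. specialize (H Hr).
  pose proof (pos_INR j) as Hj.
  apply (Clim_0 _ (fun n => D * exp (- (2 * Re s + INR j) * ln (INR n + 1)))).
  - intros n. pose proof (pos_INR n). specialize (Hx n).
    assert (L : (INR n + 1) ^ 2 <= x n ^ 2 + q).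
    { rewrite <- (pow2_abs (x n)). assert ((INR n + 1) ^ 2 <= Rabs (x n) ^ 2) by (apply pow_incr; lra). lra. }
    eapply Rle_trans. apply H. exact Hq. nra.
    apply Rmult_le_compat_l. exact HD. apply exp_le.
    apply Rle_trans with (- (Re s + INR j / 2) * ln ((INR n + 1) ^ 2)).
    assert (ln ((INR n + 1) ^ 2) <= ln (x n ^ 2 + q)) by (apply ln_le; nra). 
    assert ((Re s + INR j / 2) * ln ((INR n + 1) ^ 2) <= (Re s + INR j / 2) * ln (x n ^ 2 + q)) by (apply Rmult_le_compat_l; lra).
    lra.
    replace ((INR n + 1) ^ 2) with ((INR n + 1) * (INR n + 1)) by ring. rewrite ln_mult by lra. right. field.
  - replace (Finite 0) with (Rbar_mult D 0) by (simpl; f_equal; ring).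
    apply is_lim_seq_scal_l. apply is_lim_seq_exp_ln. lra.
Qed.

Lemma Clim_incr a l : Clim (fun n => a (S n)) l -> Clim a l.
Proof. intros [H1 H2]. split; apply is_lim_seq_incr_1; assumption. Qed.

Lemma is_CInt_const c u v : is_CInt (fun _ => c) u v ((v - u)%R * c)%C.
Proof.
  split; simpl.
  - replace ((v - u) * fst c - 0 * snd c) with (scal (v - u) (fst c)) by (unfold scal; simpl; unfold mult; simpl; ring).
    apply (is_RInt_const (V := RN)).
  - replace ((v - u) * snd c + 0 * fst c) with (scal (v - u) (snd c)) by (unfold scal; simpl; unfold mult; simpl; ring).
    apply (is_RInt_const (V := RN)).
Qed.

Lemma Cneq_0_Re (z : C) : Re z <> 0 -> z <> 0%C.
Proof. intros H E. apply H. rewrite E. reflexivity. Qed.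

(** * The continuation of the sum of [m^(-2 s)] *)

Section Zeta.

Variables (N : nat) (b : nat -> R) (A : R).
Hypothesis HA : 0 <= A.
Hypothesis HEM : EM_bound b N A.

(** Euler-Maclaurin on [[1, oo)]: half of the first term, the boundary terms at 1 and the
    remainders. The integral of [x^(-2 s)], which is [1 / (2 s - 1)] and brings in the pole, is
    added separately in [zhat]. *)
Definition zentire (s : C) : C :=
  (/ 2 - Csum N (fun j => b j * Fj (S j) 0 s 1) + Cser (fun n => zterm N b n s))%C.

(* The analytic continuation of the sum of [m^(-2s)] over [m >= 1]. *)
Definition zhat (s : C) : C := (zentire s + / (2 * s - 1))%C.

Lemma zser_holo s0 : - (INR N + 1) / 2 < Re s0 -> holo_at (fun s => Cser (fun n => zterm N b n s)) s0.
Proof.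
  intros H. destruct (zterm_bound N b A HA HEM s0 H) as (r & e & Hr & He & Hb).
  eexists. eapply (weierstrass (fun n s => zterm N b n s) e s0 r Hr).
  intros n w _. apply zterm_holo. intros n w Hw. apply Hb, Hw. exact He.
Qed.

Lemma holo_at_Csum n (f : nat -> C -> C) s : (forall j, holo_at (f j) s) -> holo_at (fun s => Csum n (fun j => f j s)) s.
Proof.
  intros H. induction n; simpl. apply holo_at_const. apply holo_at_plus. exact IHn. apply H.
Qed.

Lemma zentire_holo s0 : - (INR N + 1) / 2 < Re s0 -> holo_at zentire s0.
Proof.
  intros H. apply holo_at_plus; [|apply zser_holo, H]. apply holo_at_minus. apply holo_at_const.
  apply holo_at_Csum. intros j. apply holo_at_mult. apply holo_at_const. apply holo_Fj.
Qed.

Lemma zhat_holo s0 : - (INR N + 1) / 2 < Re s0 -> Re s0 <> / 2 -> holo_at zhat s0.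
Proof.
  intros H Hs. apply holo_at_plus. apply zentire_holo, H.
  eexists. apply (Cder_inv (fun s => 2 * s - 1)%C).
  - apply Cneq_0_Re. unfold Re in *; simpl. lra.
  - apply Cder_minus; [|apply Cder_const]. apply Cder_scal, Cder_id.
Qed.

Lemma zhat_mero s0 : - (INR N + 1) / 2 < Re s0 -> mero zhat s0.
Proof.
  intros H. apply mero_plus.
  - apply mero_holo. eapply holo_pt_Re; [|exact H]. apply zentire_holo.
  - apply mero_ext with (fun s => / (2 * s + - (1)))%C.
    exists 1. split. lra. intros; reflexivity.
    apply mero_inv_affine. intros E. injection E. lra.
Qed.

Lemma zterm_at_0 n : zterm N b n 0 = 0%C.
Proof.
  unfold zterm, emF, EMrem.
  rewrite (Csum_ext N _ (fun _ => RtoC 0)) by (intros; rewrite !Fj_at_0; ring).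
  rewrite Csum_zero.
  assert (F1 : forall x, Fj 0 0 0 x = 1%C) by (intros x; rewrite Fj_0; replace (- 0)%C with (RtoC 0) by ring; apply Rcpow_0).
  rewrite !F1. rewrite (is_CInt_unique _ _ _ 1%C). field.
  apply is_CInt_ext with (fun _ => RtoC 1). intros x _. symmetry; apply F1.
  pose proof (is_CInt_const 1 (INR n + 1) (INR n + 1 + 1)) as I1.
  replace (INR n + 1 + 1 - (INR n + 1)) with 1 in I1 by ring.
  rewrite Cmult_1_l in I1. exact I1.
Qed.

(** At [s = 0] the summed function is constant, so boundary terms and remainders vanish and
    [1/2 - 1] is left. *)
Lemma zhat_at_0 : zhat 0 = (- / 2)%C.
Proof.
  unfold zhat, zentire.
  rewrite (Csum_ext N _ (fun _ => RtoC 0)) by (intros; rewrite Fj_at_0; ring).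
  rewrite Csum_zero. rewrite (is_Cser_unique _ 0%C).
  2:{ apply is_Cser_Csum. eapply Clim_ext; [|apply (Clim_const 0%C)].
      intros n. cbv beta. rewrite (Csum_ext n _ (fun _ => RtoC 0)). symmetry; apply Csum_zero. intros; apply zterm_at_0. }
  field.
Qed.

(** The limit of [emF_sum_right] from [y = 1]: everything evaluated at [1 + M] vanishes because
    [Re s > 1/2]. *)
Lemma zhat_sum s : / 2 < Re s -> is_Cser (fun n => Fj 0 0 s (INR n + 1)) (zhat s).
Proof.
  intros Hs. pose proof (pos_INR N) as HN.
  destruct (zterm_bound N b A HA HEM s) as (r & e & Hr & He & Hb). lra.
  assert (S1 : is_Cser (fun n => zterm N b n s) (Cser (fun n => zterm N b n s))).
  { apply (is_Cser_bound _ e); [|exact He]. intros n. apply Hb.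
    rewrite Csub_diag, Cmod_0. exact Hr. }
  apply is_Cser_Csum in S1. apply is_Cser_Csum.
  assert (N1 : (1 - 2 * s)%C <> 0%C) by (apply Cneq_0_Re; unfold Re in *; simpl; lra).
  assert (N2 : (2 * s - 1)%C <> 0%C) by (apply Cneq_0_Re; unfold Re in *; simpl; lra).
  assert (EI : forall M, CInt (Fj 0 0 s) 1 (1 + INR M) = ((Rcpow (1 + INR M) (1 - 2 * s) - 1) / (1 - 2 * s))%C).
  { intros M. pose proof (pos_INR M). apply is_CInt_unique.
    replace ((Rcpow (1 + INR M) (1 - 2 * s) - 1) / (1 - 2 * s))%C with
      (/ (1 - 2 * s) * Rcpow (1 + INR M) (1 - 2 * s) - / (1 - 2 * s) * Rcpow 1 (1 - 2 * s))%C
      by (rewrite Rcpow_base_1; field; exact N1).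
    apply (is_CInt_derive (fun x => / (1 - 2 * s) * Rcpow x (1 - 2 * s))%C). lra.
    - intros x Hx. rewrite Fj_0_q0 by lra.
      replace (Rcpow x (- (2) * s)) with (/ (1 - 2 * s) * ((1 - 2 * s) * Rcpow x (1 - 2 * s - 1)))%C.
      apply rder_scal. apply rder_Rcpow. lra.
      replace (1 - 2 * s - 1)%C with (- (2) * s)%C by ring. field. exact N1.
    - intros x Hx. apply Fj_rcont. nra. }
  assert (L0 : Clim (fun M => Rcpow (1 + INR M) (1 - 2 * s)) 0%C).
  { apply Clim_Cmod_0. apply is_lim_seq_ext with (fun n => exp (- (2 * Re s - 1) * ln (INR n + 1))).
    intros n. rewrite Cmod_Rcpow, (Rplus_comm 1). f_equal. unfold Re; simpl. ring.
    apply is_lim_seq_exp_ln. lra. }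
  assert (LF : forall j, Clim (fun M => Fj j 0 s (1 + INR M)%R) 0%C).
  { intros j. apply Fj_lim_0. lra. intros n. pose proof (pos_INR n). rewrite Rabs_pos_eq; lra. lra. }
  apply Clim_ext with (fun M => Csum M (fun n => zterm N b n s) - / 2 * (Fj 0 0 s (1 + INR M)%R - Fj 0 0 s 1)
     + / (1 - 2 * s) * (Rcpow (1 + INR M) (1 - 2 * s) - 1)
     + Csum N (fun j => b j * (Fj (S j) 0 s (1 + INR M)%R - Fj (S j) 0 s 1)))%C.
  { intros M. replace (/ (1 - 2 * s) * (Rcpow (1 + INR M) (1 - 2 * s) - 1))%C with (CInt (Fj 0 0 s) 1 (1 + INR M))
      by (rewrite EI; field; exact N1).
    pose proof (emF_sum_right N b 0 s 1 M) as E.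
    rewrite (Csum_ext M (fun n => zterm N b n s) (fun n => emF N b 0 s (1 + INR n))).
    2:{ intros n _. unfold zterm. f_equal. ring. }
    rewrite E by (intros x Hx; nra).
    rewrite (Csum_ext M (fun n => Fj 0 0 s (INR n + 1)) (fun n => Fj 0 0 s (1 + INR n)%R)).
    2:{ intros n _. f_equal. ring. }
    field. }
  replace (zhat s) with (Cser (fun n => zterm N b n s) - / 2 * (0 - Fj 0 0 s 1) + / (1 - 2 * s) * (0 - 1)
     + Csum N (fun j => b j * (0 - Fj (S j) 0 s 1)))%C.
  - apply Clim_plus; [apply Clim_plus; [apply Clim_minus|]|].
    + exact S1.
    + apply (Clim_scal (/ 2) (fun M => Fj 0 0 s (1 + INR M)%R - Fj 0 0 s 1)%C).
      apply Clim_minus. apply LF. apply Clim_const.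
    + apply (Clim_scal (/ (1 - 2 * s)) (fun M => Rcpow (1 + INR M) (1 - 2 * s) - 1)%C).
      apply Clim_minus. exact L0. apply Clim_const.
    + apply (Clim_Csum N (fun j M => b j * (Fj (S j) 0 s (1 + INR M)%R - Fj (S j) 0 s 1))%C).
      intros j _. apply Clim_scal. apply Clim_minus. apply LF. apply Clim_const.
  - unfold zhat, zentire. rewrite Fj_0. replace (1 ^ 2 + 0) with 1 by ring. rewrite Rcpow_base_1.
    assert (Z : forall (f : nat -> C) n, Csum n (fun j => b j * (0 - f j))%C = (- Csum n (fun j => b j * f j))%C).
    { clear. intros f n. induction n as [|n IHn]; simpl. ring. rewrite IHn. ring. }
    rewrite (Z (fun j => Fj (S j) 0 s 1)).
    replace (/ (2 * s - 1))%C with (- / (1 - 2 * s))%C by (field; split; assumption).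
    field. exact N1.
Qed.

End Zeta.

(** * The integral of [(1 + x^2)^(-s)] over the line and its continuation *)

Definition cterm (n : nat) (s : C) : C :=
  (CInt (Fj 0 1 s) (INR n) (INR n + 1) + CInt (Fj 0 1 s) (- INR n - 1) (- INR n))%C.

(* The integral of [(1 + x^2)^(-s)] over the real line, for [Re s > 1/2]. *)
Definition c0 (s : C) : C := Cser (fun n => cterm n s).

Lemma Fj1_CInt s u v : is_CInt (Fj 0 1 s) u v (CInt (Fj 0 1 s) u v).
Proof. apply is_CInt_cont. intros x _. apply Fj_rcont. nra. Qed.

Lemma Cmod_Fj1 s x n : 0 <= Re s -> INR n <= Rabs x -> Cmod (Fj 0 1 s x) <= exp (- Re s * ln (INR n ^ 2 + 1)).
Proof.
  intros Hs Hx. rewrite Fj_0, Cmod_Rcpow. apply exp_le. pose proof (pos_INR n).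
  assert (INR n ^ 2 <= x ^ 2) by (rewrite <- (pow2_abs x); apply pow_incr; lra).
  assert (ln (INR n ^ 2 + 1) <= ln (x ^ 2 + 1)) by (apply ln_le; nra).
  unfold Re in *; simpl fst. nra.
Qed.

Lemma cterm_holo n s : holo_at (cterm n) s.
Proof.
  apply holo_at_plus; eexists; apply Cder_CInt_F0; try lra; intros; nra.
Qed.

Lemma cterm_bound s0 : / 2 < Re s0 -> exists r e, 0 < r /\ ex_series e /\
  forall n s, Cmod (s - s0)%C < r -> Cmod (cterm n s) <= e n.
Proof.
  intros Hs0. set (p := (Re s0 + / 2) / 2).
  exists (Re s0 - p), (fun n => 4 * (exp (- (2 * (Re s0 - p)) * ln (/ 2)) * exp (- p * ln (/ 2))) * exp (- (2 * p) * ln (INR n + 1))).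
  split. unfold p; lra. split.
  - apply (ex_series_scal (V := RN)). apply ex_series_power. unfold p; lra.
  - intros n s Hs. pose proof (pos_INR n) as Hn.
    pose proof (abs_fst_le_Cmod (s - s0)%C) as B. simpl in B.
    assert (B2 : Rabs (fst s + - fst s0) < Re s0 - p) by lra. apply Rabs_def2 in B2.
    assert (Hp : 0 < p) by (unfold p; lra).
    assert (Hps : 0 <= Re s) by (unfold Re in *; lra).
    assert (L : exp (- Re s * ln (INR n ^ 2 + 1)) <=
      exp (- (2 * (Re s0 - p)) * ln (/ 2)) * (exp (- p * ln (/ 2)) * exp (- (2 * p) * ln (INR n + 1)))).
    (* The comparison rests on [n^2 + 1 >= (n + 1)^2 / 2 >= 1 / 2]. *)
    { eapply Rle_trans. apply (exp_ln_compare (/ 2) p _ (2 * (Re s0 - p)) _ ((INR n + 1) * (INR n + 1) * / 2)).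
      lra. nra. pose proof (Rle_0_sqr (INR n - 1)); unfold Rsqr in *; nra. unfold p; lra. unfold Re in *. lra.
      right. f_equal. rewrite <- exp_plus. f_equal. rewrite !ln_mult by nra. ring. }
    assert (Bd : forall u v, v = u + 1 -> (forall x, u <= x <= v -> INR n <= Rabs x) ->
        Cmod (CInt (Fj 0 1 s) u v) <= 2 * exp (- Re s * ln (INR n ^ 2 + 1))).
    { intros u v -> Hx. replace 2 with (2 * (u + 1 - u)) by ring.
      apply (is_CInt_bound (Fj 0 1 s)). lra. apply Fj1_CInt. intros x Hxx. apply Cmod_Fj1.
      lra. apply Hx, Hxx. }
    unfold cterm. eapply Rle_trans. apply Cmod_triangle.
    assert (B3 := Bd (INR n) (INR n + 1) eq_refl ltac:(intros x Hx; rewrite Rabs_pos_eq; lra)).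
    assert (B4 := Bd (- INR n - 1) (- INR n) ltac:(lra) ltac:(intros x Hx; rewrite Rabs_left1; lra)).
    lra.
Qed.

Lemma c0_holo s0 : / 2 < Re s0 -> holo_at c0 s0.
Proof.
  intros H. destruct (cterm_bound s0 H) as (r & e & Hr & He & Hb).
  eexists. eapply (weierstrass (fun n s => cterm n s) e s0 r Hr).
  intros n w _. apply cterm_holo. intros n w Hw. apply Hb, Hw. exact He.
Qed.

Lemma Csum_cterm s M : Csum M (fun n => cterm n s) = CInt (Fj 0 1 s) (- INR M) (INR M).
Proof.
  induction M.
  - simpl. symmetry. rewrite Ropp_0. apply is_CInt_unique.
    split; apply (is_RInt_point (V := RN)).
  - rewrite Csum_S, IHM, S_INR. unfold cterm. symmetry. apply is_CInt_unique.
    replace (CInt (Fj 0 1 s) (- INR M) (INR M) + (CInt (Fj 0 1 s) (INR M) (INR M + 1) + CInt (Fj 0 1 s) (- INR M - 1) (- INR M)))%C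
     with (CInt (Fj 0 1 s) (- INR M - 1) (- INR M) + (CInt (Fj 0 1 s) (- INR M) (INR M) + CInt (Fj 0 1 s) (INR M) (INR M + 1)))%C by ring.
    replace (- (INR M + 1)) with (- INR M - 1) by ring.
    eapply is_CInt_Chasles. apply Fj1_CInt. eapply is_CInt_Chasles; apply Fj1_CInt.
Qed.

Lemma c0_lim_nat s : / 2 < Re s -> Clim (fun M => CInt (Fj 0 1 s) (- INR M) (INR M)) (c0 s).
Proof.
  intros Hs. destruct (cterm_bound s Hs) as (r & e & Hr & He & Hb).
  apply Clim_ext with (fun M => Csum M (fun n => cterm n s)). intros; apply Csum_cterm.
  apply is_Cser_Csum. apply (is_Cser_bound _ e); [|exact He]. intros n. apply Hb.
  rewrite Csub_diag, Cmod_0. exact Hr.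
Qed.

(** Scaling by [a] leads to the end points [M / a]. They are compared with the integers [phi M] just
    below; the two leftover pieces have length at most 1 and tend to 0. *)
Lemma c0_lim s a : / 2 < Re s -> 0 < a ->
  Clim (fun M => CInt (Fj 0 1 s) (- (INR M / a)) (INR M / a)) (c0 s).
Proof.
  intros Hs Ha.
  assert (Pos : forall M, 0 <= INR M / a) by (intros M; apply Rle_div_r; [lra|pose proof (pos_INR M); lra]).
  set (phi := fun M => proj1_sig (nfloor_ex (INR M / a) (Pos M))).
  assert (Hphi : forall M, INR (phi M) <= INR M / a < INR (phi M) + 1).
  { intros M. unfold phi. destruct (nfloor_ex (INR M / a) (Pos M)) as [n Hn]. simpl. exact Hn. }
  assert (F : filterlim phi eventually eventually).
  { intros P [K HK]. destruct (nfloor_ex (a * (INR K + 1))) as [M0 HM0].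
    pose proof (pos_INR K); nra.
    exists (S M0). intros M HM. apply HK. apply INR_le. 
    assert (INR K + 1 <= INR M / a).
    { apply Rle_div_r. lra. apply le_INR in HM. rewrite S_INR in HM. lra. }
    specialize (Hphi M). lra. }
  apply Clim_ext with (fun M => CInt (Fj 0 1 s) (- INR (phi M)) (INR (phi M)) +
     (CInt (Fj 0 1 s) (- (INR M / a)) (- INR (phi M)) + CInt (Fj 0 1 s) (INR (phi M)) (INR M / a)))%C.
  { intros M. symmetry. apply is_CInt_unique.
    match goal with |- is_CInt _ _ _ (?x + (?y + ?z))%C => replace (x + (y + z))%C with (y + (x + z))%C by ring end.
    eapply is_CInt_Chasles. apply Fj1_CInt. eapply is_CInt_Chasles; apply Fj1_CInt. }
  replace (c0 s) with (c0 s + 0)%C by ring.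
  apply Clim_plus. apply (Clim_subseq (fun M => CInt (Fj 0 1 s) (- INR M) (INR M)) (c0 s) phi F). apply c0_lim_nat, Hs.
  assert (E0 : Clim (fun n => RtoC (4 * exp (- Re s * ln (INR n ^ 2 + 1)))) 0%C).
  { apply (Clim_RtoC _ 0). replace (Finite 0) with (Rbar_mult 4 0) by (simpl; f_equal; ring).
    apply is_lim_seq_scal_l.
    apply (is_lim_seq_le_le (fun _ => 0) _ (fun n => exp (- Re s * ln (/ 2)) * exp (- (2 * Re s) * ln (INR n + 1)))).
    - intros n. split. apply Rlt_le, exp_pos. rewrite <- exp_plus. apply exp_le. pose proof (pos_INR n).
      assert (ln ((INR n + 1) * (INR n + 1) * / 2) <= ln (INR n ^ 2 + 1)).
      { apply ln_le. nra. pose proof (Rle_0_sqr (INR n - 1)); unfold Rsqr in *; nra. }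
      rewrite !ln_mult in H0 by nra. nra.
    - apply is_lim_seq_const.
    - replace (Finite 0) with (Rbar_mult (exp (- Re s * ln (/ 2))) 0) by (simpl; f_equal; ring).
      apply is_lim_seq_scal_l. apply is_lim_seq_exp_ln. lra. }
  apply (Clim_subseq _ _ phi F) in E0. destruct E0 as [E0 _]. unfold RtoC in E0; cbn [fst] in E0.
  eapply Clim_0; [|exact E0]. intros M. cbv beta. specialize (Hphi M). pose proof (pos_INR (phi M)).
  set (E := exp (- Re s * ln (INR (phi M) ^ 2 + 1))). assert (0 < E) by apply exp_pos.
  assert (Bd : forall u v, u <= v -> v <= u + 1 -> (forall x, u <= x <= v -> INR (phi M) <= Rabs x) ->
        Cmod (CInt (Fj 0 1 s) u v) <= 2 * E).
  { intros u v Huv Hv Hx. apply Rle_trans with (2 * (v - u) * E).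
    apply (is_CInt_bound (Fj 0 1 s)). lra. apply Fj1_CInt. intros x Hxx. apply Cmod_Fj1. lra. apply Hx, Hxx. nra. }
  eapply Rle_trans. apply Cmod_triangle.
  assert (B3 := Bd (INR (phi M)) (INR M / a) ltac:(lra) ltac:(lra) ltac:(intros x Hx; rewrite Rabs_pos_eq; lra)).
  assert (B4 := Bd (- (INR M / a)) (- INR (phi M)) ltac:(lra) ltac:(lra) ltac:(intros x Hx; rewrite Rabs_left1; lra)).
  lra.
Qed.

Lemma CInt_scaling s a u v : 0 < a ->
  CInt (Fj 0 (a ^ 2) s) (a * u) (a * v) = (Rcpow a (1 - 2 * s) * CInt (Fj 0 1 s) u v)%C.
Proof.
  intros Ha.
  assert (I : is_CInt (Fj 0 (a ^ 2) s) (a * u) (a * v) (CInt (Fj 0 (a ^ 2) s) (a * u) (a * v))).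
  { apply is_CInt_cont. intros x _. apply Fj_rcont. nra. }
  assert (I2 : is_CInt (fun x => Rcpow a (1 - 2 * s) * Fj 0 1 s x)%C u v (CInt (Fj 0 (a ^ 2) s) (a * u) (a * v))).
  { apply is_CInt_ext with (fun x => a * Fj 0 (a ^ 2) s (a * x + 0)%R)%C.
    - intros x _. rewrite !Fj_0.
      replace ((a * x + 0) ^ 2 + a ^ 2) with (a * a * (x ^ 2 + 1)) by ring.
      rewrite (Rcpow_mult_base (a * a)), (Rcpow_mult_base a a) by nra.
      replace (1 - 2 * s)%C with (1 + (- s + - s))%C by ring. rewrite !Rcpow_plus, Rcpow_1 by exact Ha. ring.
    - destruct I as [I1 I2]. split.
      + apply (is_RInt_ext (V := RN) (fun x => scal a (fst (Fj 0 (a ^ 2) s (a * x + 0))))).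
        intros x _. unfold scal; simpl; unfold mult; simpl. ring.
        apply (is_RInt_comp_lin (V := RN) (fun x => fst (Fj 0 (a ^ 2) s x)) a 0 u v).
        rewrite !Rplus_0_r. exact I1.
      + apply (is_RInt_ext (V := RN) (fun x => scal a (snd (Fj 0 (a ^ 2) s (a * x + 0))))).
        intros x _. unfold scal; simpl; unfold mult; simpl. ring.
        apply (is_RInt_comp_lin (V := RN) (fun x => snd (Fj 0 (a ^ 2) s x)) a 0 u v).
        rewrite !Rplus_0_r. exact I2. }
  rewrite <- (is_CInt_unique _ _ _ _ I2). apply is_CInt_unique. apply is_CInt_scal. apply Fj1_CInt.
Qed.

(** The combined integrand is the derivative of [x (x^2 + 1)^(-s)], which vanishes at both
    infinities for [Re s > 1/2]. *)
Lemma c0_rec s : / 2 < Re s -> ((1 - 2 * s) * c0 s + 2 * s * c0 (s + 1) = 0)%C.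
Proof.
  intros Hs.
  assert (Hs1 : / 2 < Re (s + 1)%C) by (unfold Re in *; simpl; lra).
  pose proof (Clim_plus _ _ _ _ (Clim_scal (1 - 2 * s)%C _ _ (c0_lim_nat s Hs)) (Clim_scal (2 * s)%C _ _ (c0_lim_nat _ Hs1))) as L.
  eapply Clim_unique. exact L.
  apply Clim_incr.
  apply Clim_ext with (fun M => INR (S M) * Rcpow (INR (S M) ^ 2 + 1) (- s) - (- INR (S M))%R * Rcpow ((- INR (S M)) ^ 2 + 1) (- s))%C.
  - intros M. set (m := INR (S M)). assert (Hm : 0 <= m) by apply pos_INR.
    assert (I : is_CInt (fun x => (1 - 2 * s) * Fj 0 1 s x + 2 * s * Fj 0 1 (s + 1) x)%C (- m) m
      (m * Rcpow (m ^ 2 + 1) (- s) - (- m)%R * Rcpow ((- m) ^ 2 + 1) (- s))%C).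
    { apply (is_CInt_derive (fun x => x * Rcpow (x ^ 2 + 1) (- s))%C). lra.
      - intros x _.
        assert (D : rder (fun x => x * Rcpow (x ^ 2 + 1) (- s))%C x
           (1%R * Rcpow (x ^ 2 + 1) (- s) + x * ((2 * x)%R * (- s * Rcpow (x ^ 2 + 1) (- s - 1))))%C).
        { apply (rder_mult (fun x => RtoC x)). apply rder_RtoC. auto_derive. auto. ring.
          apply (rder_comp (fun y => Rcpow y (- s)) (fun x => x ^ 2 + 1)).
          apply rder_Rcpow. nra. auto_derive. auto. ring. }
        replace ((1 - 2 * s) * Fj 0 1 s x + 2 * s * Fj 0 1 (s + 1) x)%C with
          (1%R * Rcpow (x ^ 2 + 1) (- s) + x * ((2 * x)%R * (- s * Rcpow (x ^ 2 + 1) (- s - 1))))%C. exact D.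
        rewrite !Fj_0. replace (- (s + 1))%C with (- s - 1)%C by ring.
        assert (EG : Rcpow (x ^ 2 + 1) (- s) = (Rcpow (x ^ 2 + 1) (- s - 1) * (x ^ 2 + 1)%R)%C).
        { transitivity (Rcpow (x ^ 2 + 1) (- s - 1) * Rcpow (x ^ 2 + 1) 1)%C.
          rewrite <- Rcpow_plus. f_equal. ring. rewrite Rcpow_1 by nra. reflexivity. }
        rewrite EG, !RtoC_mult, RtoC_plus, RtoC_pow. ring.
      - intros x _. assert (C1 : forall w, rcont (Fj 0 1 w) x) by (intros w; apply Fj_rcont; nra).
        eapply rder_rcont. apply rder_plus; apply rder_scal; apply rder_Fj; nra. }
    rewrite <- (is_CInt_unique _ _ _ _ I). apply is_CInt_unique.
    apply is_CInt_plus; apply is_CInt_scal; apply Fj1_CInt.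
  - apply (Clim_0 _ (fun M => 2 * exp (- (2 * Re s - 1) * ln (INR M + 1)))).
    + intros M. rewrite <- (S_INR M). set (m := INR (S M)). assert (Hm : 1 <= m) by (unfold m; rewrite S_INR; pose proof (pos_INR M); lra).
      replace ((- m) ^ 2 + 1) with (m ^ 2 + 1) by ring.
      replace (m * Rcpow (m ^ 2 + 1) (- s) - (- m)%R * Rcpow (m ^ 2 + 1) (- s))%C with ((2 * m)%R * Rcpow (m ^ 2 + 1) (- s))%C
        by (rewrite RtoC_mult, RtoC_opp; ring).
      rewrite Cmod_mult, Cmod_R, Cmod_Rcpow, Rabs_pos_eq by lra.
      rewrite Rmult_assoc. apply Rmult_le_compat_l. lra.
      rewrite <- (exp_ln m) at 1 by lra. rewrite <- exp_plus. apply exp_le.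
      assert (ln (m * m) <= ln (m ^ 2 + 1)) by (apply ln_le; nra). rewrite ln_mult in H by lra.
      unfold Re in *. simpl fst. nra.
    + replace (Finite 0) with (Rbar_mult 2 0) by (simpl; f_equal; ring).
      apply is_lim_seq_scal_l. apply is_lim_seq_exp_ln. lra.
Qed.

(* [ck k] continues [c0] to [Re s > 1/2 - k]. *)
Fixpoint ck (k : nat) (s : C) : C :=
  match k with O => c0 s | S k' => (2 * s * / (2 * s - 1) * ck k' (s + 1))%C end.

Lemma ck_c0 k s : / 2 < Re s -> ck k s = c0 s.
Proof.
  revert s. induction k; intros s Hs; simpl. reflexivity.
  rewrite IHk by (unfold Re in *; simpl; lra).
  assert (N2 : (2 * s - 1)%C <> 0%C) by (apply Cneq_0_Re; unfold Re in *; simpl; lra).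
  pose proof (c0_rec s Hs) as E.
  replace (c0 s) with ((2 * s - 1) * c0 s * / (2 * s - 1))%C by (field; exact N2).
  replace ((2 * s - 1) * c0 s)%C with (2 * s * c0 (s + 1) - ((1 - 2 * s) * c0 s + 2 * s * c0 (s + 1)))%C by ring.
  rewrite E. ring.
Qed.

Lemma mero_shift f z : mero f (z + 1)%C -> mero (fun w => f (w + 1)%C) z.
Proof.
  intros (k & g & [d1 [Hd1 H1]] & [d2 [Hd2 H2]]). exists k, (fun w => g (w + 1)%C). split.
  - exists d1. split. exact Hd1. intros w Hw. apply (holo_at_comp g (fun w => w + 1)%C).
    apply H1. replace (w + 1 - (z + 1))%C with (w - z)%C by ring. exact Hw.
    apply holo_at_plus. apply holo_at_id. apply holo_at_const.
  - exists d2. split. exact Hd2. intros w Hw Nw. rewrite H2.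
    replace (w + 1 - (z + 1))%C with (w - z)%C by ring. reflexivity.
    replace (w + 1 - (z + 1))%C with (w - z)%C by ring. exact Hw.
    intros E. apply Nw. replace w with (w + 1 - 1)%C by ring. rewrite E. ring.
Qed.

Lemma ck_mero k s : / 2 - INR k < Re s -> mero (ck k) s.
Proof.
  revert s. induction k; intros s Hs.
  - apply mero_holo. apply (holo_pt_Re _ (/ 2)). exact c0_holo. simpl in Hs; lra.
  - simpl ck. apply (mero_mult (fun s => 2 * s * / (2 * s - 1))%C (fun s => ck k (s + 1)%C)).
    + apply (mero_mult (fun s => 2 * s)%C (fun s => / (2 * s - 1))%C).
      apply mero_holo. exists 1. split. lra. intros w _. apply holo_at_mult. apply holo_at_const. apply holo_at_id.
      apply mero_ext with (fun s => / (2 * s + - (1)))%C. exists 1. split. lra. intros; reflexivity.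
      apply mero_inv_affine. intros E. injection E. lra.
    + apply mero_shift. apply IHk. rewrite S_INR in Hs. unfold Re in *; simpl; lra.
Qed.

(** The two factors of the recursion have their poles at [1/2] and [- 1/2], the edges of the
    strip. *)
Lemma c2_holo s : - / 2 < Re s < / 2 -> holo_at (ck 2) s.
Proof.
  intros Hs. simpl.
  assert (P : forall w, Re w <> / 2 -> holo_at (fun s => 2 * s * / (2 * s - 1))%C w).
  { intros w Hw. apply holo_at_mult. apply holo_at_mult. apply holo_at_const. apply holo_at_id.
    eexists. apply (Cder_inv (fun s => 2 * s - 1)%C).
    apply Cneq_0_Re. unfold Re in *; simpl. lra.
    apply Cder_minus; [|apply Cder_const]. apply Cder_scal, Cder_id. }
  assert (T : forall w, holo_at (fun w => w + 1)%C w) by (intros; apply holo_at_plus; [apply holo_at_id|apply holo_at_const]).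
  apply holo_at_mult. apply P. lra.
  apply holo_at_mult. apply (holo_at_comp (fun s => 2 * s * / (2 * s - 1))%C (fun s => s + 1)%C). apply P. unfold Re in *; simpl; lra. apply T.
  apply (holo_at_comp c0 (fun s => s + 1 + 1)%C). apply c0_holo. unfold Re in *; simpl; lra.
  apply holo_at_plus. apply T. apply holo_at_const.
Qed.

(** The factor [2 s] of the recursion. Because of this zero, [zhat (s - 1/2)] enters the derivative
    at 0 through its value only. *)
Lemma c2_at_0 : ck 2 0 = 0%C.
Proof. simpl. ring. Qed.

(** * The continuation of the spectral zeta function to half-planes *)

Lemma Re_sub_half (s : C) : Re (s - / 2)%C = Re s - / 2.
Proof. unfold Re; simpl. field. Qed.

Lemma Cser_zero : Cser (fun _ => RtoC 0) = 0%C.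
Proof.
  apply is_Cser_unique, is_Cser_Csum. eapply Clim_ext; [|apply (Clim_const 0%C)].
  intros n. symmetry. apply Csum_zero.
Qed.

Lemma ball_center (z : C) (r : R) : 0 < r -> Cmod (z - z)%C < r.
Proof. intros Hr. rewrite Csub_diag, Cmod_0. exact Hr. Qed.

Section Zeta.

Variables (N : nat) (b : nat -> R) (A : R).
Hypothesis HA : 0 <= A.
Hypothesis HEM : EM_bound b N A.

Lemma emF_at_0 q x0 : emF N b q 0 x0 = 0%C.
Proof.
  unfold emF, EMrem.
  rewrite (Csum_ext N _ (fun _ => RtoC 0)) by (intros; rewrite !Fj_at_0; ring).
  rewrite Csum_zero.
  assert (F1 : forall x, Fj 0 q 0 x = 1%C) by (intros x; rewrite Fj_0; replace (- 0)%C with (RtoC 0) by ring; apply Rcpow_0).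
  rewrite !F1. rewrite (is_CInt_unique _ _ _ 1%C). field.
  apply is_CInt_ext with (fun _ => RtoC 1). intros x _. symmetry; apply F1.
  pose proof (is_CInt_const 1 x0 (x0 + 1)) as I1.
  replace (x0 + 1 - x0) with 1 in I1 by ring. rewrite Cmult_1_l in I1. exact I1.
Qed.

(* The difference between the sum of [(n^2 + a^2)^(-s)] over all integers and the
   corresponding integral. *)
Definition Rf (a : R) (s : C) : C := Cser (fun n => rterm N b a n s).

Lemma Rf_bound s0 a0 : - INR N / 2 < Re s0 -> 0 < a0 -> exists r D p, 0 < r /\ 0 <= D /\ 1 < p /\
  forall s a, Cmod (s - s0)%C < r -> a0 <= a ->
    is_Cser (fun n => rterm N b a n s) (Rf a s) /\ Cmod (Rf a s) <= D * exp (- p * ln a).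
Proof.
  intros Hs Ha. destruct (rterm_bound N b A HA HEM s0 a0 Hs Ha) as (r & D & p & Hr & HD & Hp & H).
  pose proof (ex_series_power p Hp) as Hser.
  assert (HS0 : 0 <= 2 * Series (fun n => exp (- p * ln (INR n + 1)))).
  { eapply Rle_trans; [|apply (is_Cser_bound (fun _ => RtoC 0))]. apply Cmod_ge_0.
    intros n. rewrite Cmod_0. apply Rlt_le, exp_pos. exact Hser. }
  exists r, (2 * Series (fun n => exp (- p * ln (INR n + 1))) * D), p.
  split. exact Hr. split. apply Rmult_le_pos; assumption. split. exact Hp.
  intros s a Hsr Haa.
  destruct (is_Cser_bound (fun n => rterm N b a n s) (fun n => D * exp (- p * ln a) * exp (- p * ln (INR n + 1)))) as [B1 B2].
  intros n. apply H; assumption. apply (ex_series_scal (V := RN)), Hser.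
  split. exact B1. unfold Rf. eapply Rle_trans. exact B2. rewrite Series_scal_l. right. ring.
Qed.

Lemma Rf_Cder s0 a : - INR N / 2 < Re s0 -> 0 < a ->
  is_Cser (fun n => C_derive (rterm N b a n) s0) (Cser (fun n => C_derive (rterm N b a n) s0)) /\
  Cder (Rf a) s0 (Cser (fun n => C_derive (rterm N b a n) s0)).
Proof.
  intros Hs Ha. destruct (rterm_bound N b A HA HEM s0 a Hs Ha) as (r & D & p & Hr & HD & Hp & H).
  apply (weierstrass (fun n s => rterm N b a n s) (fun n => D * exp (- p * ln a) * exp (- p * ln (INR n + 1))) s0 r Hr).
  intros n w _. apply rterm_holo, Ha. intros n w Hw. apply H. exact Hw. lra.
  apply (ex_series_scal (V := RN)). apply ex_series_power, Hp.
Qed.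

Lemma Rf_at_0 a : Rf a 0 = 0%C.
Proof.
  unfold Rf. rewrite (Cser_ext _ (fun _ => RtoC 0)). apply Cser_zero.
  intros n. unfold rterm. rewrite !emF_at_0. ring.
Qed.

Lemma Fj_0_even q s x : Fj 0 q s (- x) = Fj 0 q s x.
Proof. rewrite !Fj_0. f_equal. ring. Qed.

Lemma Csum_shift (g : nat -> C) M : Csum M g = (Csum M (fun n => g (S n)) + g 0%nat - g M)%C.
Proof. induction M; simpl. ring. rewrite IHM. ring. Qed.

Lemma Csum_plus (f g : nat -> C) M : Csum M (fun n => f n + g n)%C = (Csum M f + Csum M g)%C.
Proof. induction M; simpl. ring. rewrite IHM. ring. Qed.

(** The two half-lines meet at 0, where half-values and boundary terms of both sides cancel, so that
    such terms remain at [M] and [- M] only. As [Fj 0] is even, the left sum equals the right one;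
    the shift of the index isolates the term of [n = 0]. *)
Lemma Csum_rterm a s M : 0 < a ->
  Csum M (fun n => rterm N b a n s) =
  (2 * Csum M (fun n => Fj 0 (a ^ 2) s (INR n + 1)%R) + Fj 0 (a ^ 2) s 0 - Fj 0 (a ^ 2) s (INR M)
   - CInt (Fj 0 (a ^ 2) s) (- INR M) (INR M)
   - Csum N (fun j => b j * (Fj (S j) (a ^ 2) s (INR M) - Fj (S j) (a ^ 2) s (- INR M)%R)))%C.
Proof.
  intros Ha. set (q := a ^ 2). assert (Hq : forall x, 0 < x ^ 2 + q) by (intros x; unfold q; nra).
  unfold rterm. fold q. rewrite Csum_plus.
  rewrite (Csum_ext M (fun n => emF N b q s (INR n)) (fun n => emF N b q s (0 + INR n))).
  2:{ intros n _. rewrite Rplus_0_l. reflexivity. }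
  rewrite emF_sum_right, emF_sum_left by (intros; apply Hq).
  rewrite (Csum_ext M (fun n => Fj 0 q s (0 + INR n)%R) (fun n => Fj 0 q s (INR n))) by (intros; rewrite Rplus_0_l; reflexivity).
  rewrite (Csum_ext M (fun n => Fj 0 q s (- INR n - 1)%R) (fun n => Fj 0 q s (INR n + 1))).
  2:{ intros n _. rewrite <- Fj_0_even. f_equal. ring. }
  rewrite (Csum_shift (fun n => Fj 0 q s (INR n))).
  rewrite (Csum_ext M (fun n => Fj 0 q s (INR (S n))) (fun n => Fj 0 q s (INR n + 1))) by (intros; rewrite S_INR; reflexivity).
  rewrite Rplus_0_l, Fj_0_even.
  rewrite (is_CInt_unique (Fj 0 q s) (- INR M) (INR M) (CInt (Fj 0 q s) (- INR M) 0 + CInt (Fj 0 q s) 0 (INR M))%C).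
  2:{ eapply is_CInt_Chasles; apply is_CInt_cont; intros x _; apply Fj_rcont, Hq. }
  rewrite (Csum_split b (fun j => Fj (S j) q s (INR M)) (fun j => Fj (S j) q s 0) (fun j => Fj (S j) q s (- INR M)%R)).
  simpl INR. field.
Qed.

(** The limit of [Csum_rterm]. The sum over all integers counts [n] and [- n], whence [1/2], and its
    central term is [a^(-2 s)]; the integral is rescaled to [c0]. *)
Lemma inner_sum a s : - INR N / 2 < / 2 -> 0 < a -> / 2 < Re s ->
  is_Cser (fun n => Fj 0 (a ^ 2) s (INR n + 1))
    (/ 2 * (Rf a s - Rcpow a (- (2) * s) + Rcpow a (1 - 2 * s) * c0 s))%C.
Proof.
  intros HN Ha Hs.
  destruct (Rf_bound s a) as (r & D & p & Hr & _ & _ & H). lra. exact Ha.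
  destruct (H s a (ball_center s r Hr) (Rle_refl a)) as [S1 _].
  apply is_Cser_Csum in S1. apply is_Cser_Csum.
  assert (F0 : Fj 0 (a ^ 2) s 0 = Rcpow a (- (2) * s)).
  { rewrite Fj_0. unfold Rcpow. f_equal. replace (0 ^ 2 + a ^ 2) with (a * a) by ring.
    rewrite ln_mult, RtoC_plus by exact Ha. ring. }
  assert (Lc : Clim (fun M => CInt (Fj 0 (a ^ 2) s) (- INR M) (INR M)) (Rcpow a (1 - 2 * s) * c0 s)%C).
  { apply Clim_ext with (fun M => Rcpow a (1 - 2 * s) * CInt (Fj 0 1 s) (- (INR M / a)) (INR M / a))%C.
    - intros M. rewrite <- CInt_scaling by exact Ha. f_equal; field; lra.
    - apply Clim_scal. apply c0_lim; assumption. }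
  assert (Hqa : 0 <= a ^ 2) by nra.
  assert (LF : forall j, Clim (fun M => Fj j (a ^ 2) s (INR M)) 0%C).
  { intros j. apply Clim_incr. apply Fj_lim_0. exact Hqa. intros n. rewrite S_INR. pose proof (pos_INR n). rewrite Rabs_pos_eq; lra. lra. }
  assert (LF' : forall j, Clim (fun M => Fj j (a ^ 2) s (- INR M)) 0%C).
  { intros j. apply Clim_incr. apply (Fj_lim_0 j (a ^ 2) s (fun n => - INR (S n))). exact Hqa. intros n. rewrite S_INR. pose proof (pos_INR n). rewrite Rabs_left1; lra. lra. }
  apply Clim_ext with (fun M => / 2 * (Csum M (fun n => rterm N b a n s) - Fj 0 (a ^ 2) s 0 + Fj 0 (a ^ 2) s (INR M)
   + CInt (Fj 0 (a ^ 2) s) (- INR M) (INR M)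
   + Csum N (fun j => b j * (Fj (S j) (a ^ 2) s (INR M) - Fj (S j) (a ^ 2) s (- INR M)%R))))%C.
  { intros M. rewrite Csum_rterm by exact Ha. field. }
  apply Clim_scal. rewrite <- F0.
  replace (Rf a s - Fj 0 (a ^ 2) s 0 + Rcpow a (1 - 2 * s) * c0 s)%C with
    (Rf a s - Fj 0 (a ^ 2) s 0 + 0 + Rcpow a (1 - 2 * s) * c0 s + Csum N (fun j => b j * (0 - 0)))%C.
  - apply Clim_plus; [apply Clim_plus; [apply Clim_plus; [apply Clim_minus|]|]|].
    + exact S1.
    + apply Clim_const.
    + apply LF.
    + exact Lc.
    + apply (Clim_Csum N (fun j M => b j * (Fj (S j) (a ^ 2) s (INR M) - Fj (S j) (a ^ 2) s (- INR M)%R))%C).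
      intros j _. apply Clim_scal. apply Clim_minus. apply LF. apply LF'.
  - rewrite (Csum_ext N _ (fun _ => RtoC 0)) by (intros; ring). rewrite Csum_zero. ring.
Qed.

Variable u : R.
Hypothesis Hu : 0 < u.

Definition am (m : nat) : R := (INR m + 1) * u.

Lemma am_ge m : u <= am m.
Proof. unfold am. pose proof (pos_INR m). nra. Qed.

(** The exponent [p > 1] of the decay in [a] makes the bounds at [a = (m + 1) u] summable, so
    [weierstrass] applies once more. *)
Lemma Rf_series s0 : - INR N / 2 < Re s0 ->
  (exists r, 0 < r /\ forall s, Cmod (s - s0)%C < r -> is_Cser (fun m => Rf (am m) s) (Cser (fun m => Rf (am m) s))) /\
  is_Cser (fun m => C_derive (Rf (am m)) s0) (Cser (fun m => C_derive (Rf (am m)) s0)) /\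
  Cder (fun s => Cser (fun m => Rf (am m) s)) s0 (Cser (fun m => C_derive (Rf (am m)) s0)).
Proof.
  intros Hs. destruct (Rf_bound s0 u Hs Hu) as (r0 & D & p & Hr0 & HD & Hp & H).
  set (r := Rmin r0 (Re s0 + INR N / 2)). assert (Hr : 0 < r) by (apply Rmin_glb_lt; lra).
  assert (Hr1 : r <= r0) by apply Rmin_l. assert (Hr2 : r <= Re s0 + INR N / 2) by apply Rmin_r.
  assert (E : ex_series (fun m => D * exp (- p * ln u) * exp (- p * ln (INR m + 1)))).
  { apply (ex_series_scal (V := RN)). apply ex_series_power, Hp. }
  assert (B : forall m s, Cmod (s - s0)%C < r -> Cmod (Rf (am m) s) <= D * exp (- p * ln u) * exp (- p * ln (INR m + 1))).
  { intros m s Hsr. destruct (H s (am m) ltac:(lra) (am_ge m)) as [_ B]. eapply Rle_trans. exact B.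
    right. unfold am. pose proof (pos_INR m). rewrite ln_mult by lra.
    rewrite Rmult_assoc, <- exp_plus. f_equal. f_equal. ring. }
  split.
  - exists r. split. exact Hr. intros s Hsr. eapply is_Cser_bound; [|exact E]. intros m. apply B, Hsr.
  - apply (weierstrass (fun m s => Rf (am m) s) _ s0 r Hr) with (3 := E).
    + intros m w Hw. eexists. apply Rf_Cder.
      pose proof (abs_fst_le_Cmod (w - s0)%C) as B1. simpl in B1.
      assert (B2 : Rabs (fst w + - fst s0) < r) by lra. apply Rabs_def2 in B2. unfold Re in *. lra.
      pose proof (am_ge m). lra.
    + intros m w Hw. apply B, Hw.
Qed.

Variable k : nat.

(* The continuation of the sum of [((m u)^2 + n^2)^(-s)] over [m, n >= 1]. *)
Definition Wfun (s : C) : C :=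
  (/ 2 * (Rcpow u (1 - 2 * s) * zhat N b (s - / 2) * ck k s - Rcpow u (- (2) * s) * zhat N b s
          + Cser (fun m => Rf (am m) s)))%C.

Definition Zfun (s : C) : C := (Rcpow (PI ^ 2 / u) (- s) * Wfun s)%C.

Lemma holo_Rcpow_affine x (c d s : C) : holo_at (fun s => Rcpow x (c + d * s)) s.
Proof.
  apply (holo_at_Rcpow x (fun s => c + d * s)%C). apply holo_at_plus. apply holo_at_const.
  apply holo_at_mult. apply holo_at_const. apply holo_at_id.
Qed.

Lemma mero_half_shift f z : mero f (z - / 2)%C -> mero (fun w => f (w - / 2)%C) z.
Proof.
  intros (j & g & [d1 [Hd1 H1]] & [d2 [Hd2 H2]]). exists j, (fun w => g (w - / 2)%C).
  assert (E : forall w, (w - / 2 - (z - / 2) = w - z)%C) by (intros; ring). split.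
  - exists d1. split. exact Hd1. intros w Hw. apply (holo_at_comp g (fun w => w - / 2)%C).
    apply H1. rewrite E. exact Hw.
    apply holo_at_minus. apply holo_at_id. apply holo_at_const.
  - exists d2. split. exact Hd2. intros w Hw Nw. rewrite H2, E. reflexivity.
    rewrite E. exact Hw.
    intros F. apply Nw. replace w with (w - / 2 + / 2)%C by ring. rewrite F. ring.
Qed.

Lemma Zfun_mero s : - INR N / 2 < Re s -> / 2 - INR k < Re s -> mero Zfun s.
Proof.
  intros H1 H2.
  assert (HH : forall f, (forall w, holo_at f w) -> mero f s).
  { intros f Hf. apply mero_holo. exists 1. split. lra. intros; apply Hf. }
  assert (HP : forall x c d, mero (fun s => Rcpow x (c + d * s)) s) by (intros; apply HH; intros; apply holo_Rcpow_affine).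
  apply (mero_mult (fun s => Rcpow (PI ^ 2 / u) (- s)) Wfun).
  { apply mero_ext with (fun s => Rcpow (PI ^ 2 / u) (0 + (- (1)) * s)); [|apply HP].
    exists 1. split. lra. intros w _ _. f_equal. ring. }
  apply mero_mult. apply HH. intros; apply holo_at_const.
  apply mero_plus. apply mero_minus.
  - apply mero_mult; [apply mero_mult|].
    + apply mero_ext with (fun s => Rcpow u (1 + (- (2)) * s)); [|apply HP].
      exists 1. split. lra. intros w _ _. f_equal. ring.
    + apply mero_half_shift. apply (zhat_mero N b A HA HEM). rewrite Re_sub_half. lra.
    + apply ck_mero. exact H2.
  - apply mero_mult.
    + apply mero_ext with (fun s => Rcpow u (0 + (- (2)) * s)); [|apply HP].
      exists 1. split. lra. intros w _ _. f_equal. ring.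
    + apply (zhat_mero N b A HA HEM). lra.
  - apply mero_holo. apply (holo_pt_Re _ (- INR N / 2)); [|exact H1].
    intros w Hw. eexists. apply (Rf_series w Hw).
Qed.

(** [Rcpow u] splits off from the powers of [am m]; what remains of [a^(-2 s)] and [a^(1 - 2 s)]
    sums to [zhat] at [s] and at [s - 1/2]. *)
Lemma Zfun_sum L s : 0 < L -> u = / L ^ 2 -> 1 < Re s -> is_zeta_sum L s (Zfun s).
Proof.
  intros HL EL Hs. pose proof (pos_INR N) as HN.
  assert (Hpu : 0 < PI ^ 2 / u) by (apply Rdiv_lt_0_compat; [apply pow_lt, PI_RGT_0|exact Hu]).
  set (In := fun m => (/ 2 * (Rf (am m) s - Rcpow (am m) (- (2) * s) + Rcpow (am m) (1 - 2 * s) * c0 s))%C).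
  exists (fun m => Rcpow (PI ^ 2 / u) (- s) * In m)%C. split.
  - intros m. apply is_series_is_Cser.
    assert (Ha : 0 < am m) by (pose proof (am_ge m); lra).
    apply is_Cser_ext with (fun n => Rcpow (PI ^ 2 / u) (- s) * Fj 0 (am m ^ 2) s (INR n + 1))%C.
    + intros n. rewrite Fj_0, <- Rcpow_mult_base; [|exact Hpu|].
      2:{ pose proof (pow_lt (am m) 2 Ha). pose proof (pow2_ge_0 (INR n + 1)). lra. }
      f_equal.
      unfold dirichlet_eigenvalue, am. rewrite EL, !S_INR. field. lra.
    + apply is_Cser_scal. apply inner_sum; lra.
  - apply is_series_is_Cser. unfold Zfun. apply is_Cser_scal.
    unfold In, Wfun. apply is_Cser_scal. rewrite ck_c0 by lra.
    assert (EP : forall m (w : C), Rcpow (am m) w = (Rcpow u w * Rcpow (INR m + 1) w)%C).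
    { intros m w. unfold am. pose proof (pos_INR m). rewrite Rcpow_mult_base by lra. ring. }
    assert (S1 : is_Cser (fun m => Rcpow (am m) (- (2) * s)) (Rcpow u (- (2) * s) * zhat N b s)%C).
    { apply is_Cser_ext with (fun m => Rcpow u (- (2) * s) * Fj 0 0 s (INR m + 1))%C.
      intros m. rewrite EP, Fj_0_q0. reflexivity. pose proof (pos_INR m); lra.
      apply is_Cser_scal. apply (zhat_sum N b A HA HEM). lra. }
    assert (S2 : is_Cser (fun m => Rcpow (am m) (1 - 2 * s) * c0 s)%C (Rcpow u (1 - 2 * s) * zhat N b (s - / 2) * c0 s)%C).
    { apply is_Cser_ext with (fun m => (Rcpow u (1 - 2 * s) * c0 s) * Fj 0 0 (s - / 2) (INR m + 1))%C.
      intros m. rewrite EP, Fj_0_q0. replace (- (2) * (s - / 2))%C with (1 - 2 * s)%C by field. ring. pose proof (pos_INR m); lra.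
      replace (Rcpow u (1 - 2 * s) * zhat N b (s - / 2) * c0 s)%C with ((Rcpow u (1 - 2 * s) * c0 s) * zhat N b (s - / 2))%C by ring.
      apply is_Cser_scal. apply (zhat_sum N b A HA HEM). rewrite Re_sub_half. lra. }
    assert (S3 : is_Cser (fun m => Rf (am m) s) (Cser (fun m => Rf (am m) s))).
    { destruct (Rf_series s) as [(r & Hr & H) _]. lra. apply H, ball_center, Hr. }
    pose proof (is_Cser_plus _ _ _ _ (is_Cser_minus _ _ _ _ S3 S1) S2) as S4.
    match type of S4 with is_Cser _ ?l => match goal with |- is_Cser _ ?l' => replace l' with l by ring end end.
    exact S4.
Qed.

End Zeta.

(** * The product formula for the hyperbolic sine *)

(* Wallis-type integrals; their ratio at [a] and at [0] satisfies the recursion of the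
   partial products of [sinh (PI a) / (PI a)]. *)
Definition Jint (a : R) (n : nat) : R := RInt (fun t => cosh (2 * a * t) * cos t ^ n) 0 (PI / 2).

Lemma Jint_cont a n x : continuous (fun t => cosh (2 * a * t) * cos t ^ n) x.
Proof. apply (ex_derive_continuous (V := RN)). unfold cosh. auto_derive. auto. Qed.

Lemma Jint_ex a n : ex_RInt (fun t => cosh (2 * a * t) * cos t ^ n) 0 (PI / 2).
Proof. apply ex_RInt_Chas. intros; apply Jint_cont. Qed.

Lemma Jint_rec a n : (INR (S (S n)) ^ 2 + 4 * a ^ 2) * Jint a (S (S n)) = INR (S (S n)) * INR (S n) * Jint a n.
Proof.
  set (m := INR (S (S n))).
  (* The boundary terms of two integrations by parts; they vanish at [PI / 2] by the cosine and at 0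
     by [sinh] and the sine. *)
  set (G := fun t => 2 * a * sinh (2 * a * t) * cos t ^ S (S n) + m * cosh (2 * a * t) * cos t ^ S n * sin t).
  assert (I : is_RInt (fun t => (m ^ 2 + 4 * a ^ 2) * (cosh (2 * a * t) * cos t ^ S (S n)) - m * INR (S n) * (cosh (2 * a * t) * cos t ^ n))
     0 (PI / 2) (G (PI / 2) - G 0)).
  { apply (is_RInt_derive (V := RCN) G).
    - intros x _. unfold G, cosh, sinh. auto_derive. auto.
      change (pred (S (S n))) with (S n). change (pred (S n)) with n.
      replace (match n with | 0%nat => 1 | S _ => INR n + 1 end) with (INR (S n)) by reflexivity.
      assert (S2 : sin x * sin x = 1 - cos x * cos x).
      { pose proof (sin2_cos2 x) as H. unfold Rsqr in H. lra. }
      assert (Em : m = INR (S n) + 1) by (unfold m; apply S_INR).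
      replace (cos x ^ S (S n)) with (cos x * cos x * cos x ^ n) by (simpl; ring).
      replace (cos x ^ S n) with (cos x * cos x ^ n) by reflexivity.
      replace (2 * a * x) with (2 * a * x) by ring.
      set (p := INR (S n)) in *. set (c := cos x) in *. set (s := sin x) in *. set (cn := c ^ n).
      set (e1 := exp (2 * a * x)). set (e2 := exp (- (2 * a * x))).
      match goal with |- ?lhs = ?rhs => replace lhs with (4 * a ^ 2 * ((e1 + e2) / 2) * (c * c * cn) + m * ((e1 + e2) / 2) * (c * c * cn)
         - m * p * ((e1 + e2) / 2) * cn * (s * s)) by (rewrite Em; field) end.
      rewrite S2, Em. field.
    - intros x _. apply (continuous_minus (fun t => (m ^ 2 + 4 * a ^ 2) * (cosh (2 * a * t) * cos t ^ S (S n))) (fun t => m * INR (S n) * (cosh (2 * a * t) * cos t ^ n)));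
      apply (continuous_scal_r (V := RN)); apply Jint_cont. }
  apply (is_RInt_unique (V := RCN)) in I.
  rewrite (RInt_minus (V := RCN) (fun t => (m ^ 2 + 4 * a ^ 2) * (cosh (2 * a * t) * cos t ^ S (S n))) (fun t => m * INR (S n) * (cosh (2 * a * t) * cos t ^ n))) in I.
  2:{ apply (ex_RInt_scal (V := RN)), Jint_ex. }
  2:{ apply (ex_RInt_scal (V := RN)), Jint_ex. }
  rewrite (RInt_scal (V := RCN) (fun t => cosh (2 * a * t) * cos t ^ S (S n))) in I by apply Jint_ex.
  rewrite (RInt_scal (V := RCN) (fun t => cosh (2 * a * t) * cos t ^ n)) in I by apply Jint_ex.
  assert (G1 : G (PI / 2) = 0) by (unfold G; rewrite cos_PI2; simpl; ring).
  assert (G0 : G 0 = 0).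
  { unfold G, sinh. rewrite sin_0. replace (2 * a * 0) with 0 by ring. rewrite Ropp_0. field. }
  rewrite G1, G0 in I.
  change ((m ^ 2 + 4 * a ^ 2) * Jint a (S (S n)) + - (m * INR (S n) * Jint a n) = 0 - 0) in I. lra.
Qed.

Lemma cosh_ge_1 y : 1 <= cosh y.
Proof.
  unfold cosh. rewrite exp_Ropp. pose proof (exp_pos y) as H. set (e := exp y) in *.
  assert (0 <= (e - 1) ^ 2 / e) by (apply Rle_div_r; [exact H|]; rewrite Rmult_0_l; apply pow2_ge_0).
  replace ((e + / e) / 2) with (1 + (e - 1) ^ 2 / e / 2) by (field; lra). lra.
Qed.

Lemma Jint_0_le a n : Jint 0 n <= Jint a n.
Proof.
  unfold Jint. pose proof PI_RGT_0. apply RInt_le. lra. apply Jint_ex. apply Jint_ex.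
  intros x Hx. apply Rmult_le_compat_r. apply pow_le, cos_ge_0; lra.
  replace (cosh (2 * 0 * x)) with 1. apply cosh_ge_1.
  unfold cosh. replace (2 * 0 * x) with 0 by ring. rewrite Ropp_0, exp_0. field.
Qed.

Lemma Jint_pos a n : 0 < Jint a n.
Proof.
  pose proof PI_RGT_0. unfold Jint. apply RInt_gt_0. lra.
  - intros x Hx. apply Rmult_lt_0_compat. pose proof (cosh_ge_1 (2 * a * x)); lra.
    apply pow_lt, cos_gt_0; lra.
  - intros x _. apply Jint_cont.
Qed.

(** [cosh y - 1 = 2 sinh(y / 2)^2], and [2 sinh(y / 2) <= y e^(y / 2)]. *)
Lemma cosh_upper y : 0 <= y -> cosh y - 1 <= y ^ 2 * exp y / 2.
Proof.
  intros Hy. set (z := y / 2). set (e := exp z).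
  assert (He : 1 <= e) by (unfold e; rewrite <- exp_0; apply exp_le; unfold z; lra).
  assert (E1 : exp y = e * e) by (unfold e; rewrite <- exp_plus; f_equal; unfold z; field).
  unfold cosh. rewrite exp_Ropp, E1.
  assert (B : e - / e <= y * e).
  { assert (1 - y <= / (e * e)).
    { rewrite <- E1, <- exp_Ropp. pose proof (exp_ineq1_le (- y)). lra. }
    apply Rmult_le_compat_l with (r := e) in H; [|lra].
    replace (e * / (e * e)) with (/ e) in H by (field; lra). lra. }
  assert (P : 0 <= e - / e).
  { assert (/ e <= 1). rewrite <- Rinv_1. apply Rinv_le_contravar; lra. lra. }
  replace ((e * e + / (e * e)) / 2 - 1) with ((e - / e) * (e - / e) / 2) by (field; lra).
  assert ((e - / e) * (e - / e) <= (y * e) * (y * e)) by (apply Rmult_le_compat; assumption).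
  lra.
Qed.

Lemma t_cos_le_sin t : 0 <= t <= PI / 2 -> t * cos t <= sin t.
Proof.
  intros Ht. pose proof PI_RGT_0.
  destruct (MVT_gen (fun x => sin x - x * cos x) 0 t (fun x => x * sin x)) as [c [Hc E]].
  - intros x _. auto_derive. auto. ring.
  - intros x _. apply continuity_pt_filterlim.
    apply (ex_derive_continuous (V := RN) (fun x => sin x - x * cos x)). auto_derive. auto.
  - rewrite Rmin_left, Rmax_right in Hc by lra. rewrite sin_0 in E.
    assert (0 <= c * sin c * (t - 0)).
    { apply Rmult_le_pos; [|lra]. apply Rmult_le_pos. lra. apply sin_ge_0; lra. }
    lra.
Qed.

(** From [cosh (2 a t) - 1 <= K t^2] and [t^2 cos^2 t <= sin^2 t = 1 - cos^2 t] the excess over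
    [Jint 0 (n + 2)] is at most [K] times the difference of [Jint 0 n] and [Jint 0 (n + 2)], whose
    ratio is [(n + 2) / (n + 1)]. *)
Lemma Jint_upper a n : 0 < a ->
  Jint a (S (S n)) <= Jint 0 (S (S n)) * (1 + 2 * a ^ 2 * exp (PI * a) / INR (S n)).
Proof.
  intros Ha. pose proof PI_RGT_0.
  set (K := 2 * a ^ 2 * exp (PI * a)).
  assert (HK : 0 <= K). { unfold K. pose proof (exp_pos (PI * a)). nra. }
  assert (C0 : forall x, cosh (2 * 0 * x) = 1).
  { intros x. unfold cosh. replace (2 * 0 * x) with 0 by ring. rewrite Ropp_0, exp_0. field. }
  assert (B : Jint a (S (S n)) <= (1 - K) * Jint 0 (S (S n)) + K * Jint 0 n).
  { unfold Jint.
    assert (I : is_RInt (fun t => (1 - K) * (cosh (2 * 0 * t) * cos t ^ S (S n)) + K * (cosh (2 * 0 * t) * cos t ^ n)) 0 (PI / 2)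
       ((1 - K) * RInt (fun t => cosh (2 * 0 * t) * cos t ^ S (S n)) 0 (PI / 2) + K * RInt (fun t => cosh (2 * 0 * t) * cos t ^ n) 0 (PI / 2))).
    { apply (is_RInt_plus (V := RN)); apply (is_RInt_scal (V := RN)); apply (RInt_correct (V := RCN)); apply Jint_ex. }
    rewrite <- (is_RInt_unique (V := RCN) _ _ _ _ I).
    apply RInt_le. lra. apply Jint_ex. eexists; exact I.
    intros x Hx. rewrite C0.
    assert (Hc : 0 <= cos x) by (apply cos_ge_0; lra).
    assert (Hcn : 0 <= cos x ^ n) by (apply pow_le, Hc).
    replace (cos x ^ S (S n)) with (cos x * cos x * cos x ^ n) by (simpl; ring).
    assert (U : cosh (2 * a * x) - 1 <= K * x ^ 2).
    { eapply Rle_trans. apply cosh_upper. nra.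
      unfold K. assert (exp (2 * a * x) <= exp (PI * a)) by (apply exp_le; nra).
      replace ((2 * a * x) ^ 2 * exp (2 * a * x) / 2) with (2 * a ^ 2 * x ^ 2 * exp (2 * a * x)) by field.
      replace (2 * a ^ 2 * exp (PI * a) * x ^ 2) with (2 * a ^ 2 * x ^ 2 * exp (PI * a)) by ring.
      apply Rmult_le_compat_l; nra. }
    assert (T : x * cos x <= sin x) by (apply t_cos_le_sin; lra).
    assert (T2 : (x * cos x) * (x * cos x) <= sin x * sin x) by (apply Rmult_le_compat; nra).
    pose proof (sin2_cos2 x) as SC. unfold Rsqr in SC.
    assert (M1 : (cosh (2 * a * x) - 1) * (cos x * cos x) <= K * (1 - cos x * cos x)).
    { apply Rle_trans with (K * x ^ 2 * (cos x * cos x)). apply Rmult_le_compat_r; nra. 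
      replace (K * x ^ 2 * (cos x * cos x)) with (K * ((x * cos x) * (x * cos x))) by ring.
      apply Rmult_le_compat_l; lra. }
    apply Rmult_le_compat_r with (r := cos x ^ n) in M1; [|exact Hcn]. lra. }
  pose proof (Jint_rec 0 n) as E. replace (4 * 0 ^ 2) with 0 in E by ring. rewrite Rplus_0_r in E.
  rewrite (S_INR (S n)) in E. set (p := INR (S n)) in *.
  assert (Hp : 1 <= p) by (unfold p; rewrite S_INR; pose proof (pos_INR n); lra).
  assert (E2 : Jint 0 n = (p + 1) / p * Jint 0 (S (S n))).
  { apply Rmult_eq_reg_l with ((p + 1) * p); [|nra]. rewrite <- E. field. lra. }
  rewrite E2 in B. eapply Rle_trans. exact B. right. fold K. field. lra.
Qed.

(** For the ratio [q k] of [Jint a (2 k)] to [Jint 0 (2 k)] the recursion reads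
    [q k = (1 + a^2 / (k + 1)^2) q (k + 1)], so the logarithms telescope. [q 0] is the claimed
    value, and [q k] tends to 1, squeezed between 1 and the bound of [Jint_upper]. *)
Theorem sinh_product (a : R) : 0 < a ->
  is_lim_seq (fun M => Rsum M (fun n => ln (1 + a ^ 2 / INR (S n) ^ 2))) (ln (sinh (PI * a) / (PI * a))).
Proof.
  intros Ha. pose proof PI_RGT_0 as HPI.
  set (q := fun k => Jint a (2 * k) / Jint 0 (2 * k)).
  assert (Hq1 : forall k, 1 <= q k).
  { intros k. unfold q. apply Rle_div_r. apply Jint_pos. rewrite Rmult_1_l. apply Jint_0_le. }
  assert (Hqrec : forall k, q k = (1 + a ^ 2 / INR (S k) ^ 2) * q (S k)).
  { intros k. unfold q. replace (2 * S k)%nat with (S (S (2 * k))) by lia.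
    pose proof (Jint_rec a (2 * k)) as E1. pose proof (Jint_rec 0 (2 * k)) as E2.
    replace (4 * 0 ^ 2) with 0 in E2 by ring. rewrite Rplus_0_r in E2.
    pose proof (Jint_pos 0 (2 * k)) as P1. pose proof (Jint_pos 0 (S (S (2 * k)))) as P2.
    replace (INR (S (S (2 * k)))) with (2 * INR (S k)) in E1, E2.
    2:{ rewrite !S_INR, mult_INR. simpl. ring. }
    pose proof (pos_INR k) as Pk.
    assert (Ps : 0 < INR (S k)) by (rewrite S_INR; lra).
    assert (Pp : 0 < INR (S (2 * k))) by (rewrite S_INR, mult_INR; simpl; lra).
    set (x := INR (S k)) in *. set (y := INR (S (2 * k))) in *.
    set (Ja := Jint a (2 * k)) in *. set (J0 := Jint 0 (2 * k)) in *.
    set (Ja2 := Jint a (S (S (2 * k)))) in *. set (J02 := Jint 0 (S (S (2 * k)))) in *.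
    assert (F1 : Ja = ((2 * x) ^ 2 + 4 * a ^ 2) * Ja2 / (2 * x * y)) by (rewrite E1; field; lra).
    assert (F2 : J0 = (2 * x) ^ 2 * J02 / (2 * x * y)) by (rewrite E2; field; lra).
    rewrite F1, F2. field. lra. }
  assert (Hq0 : q 0%nat = sinh (PI * a) / (PI * a)).
  { unfold q. simpl Nat.mul.
    assert (I1 : Jint a 0 = sinh (PI * a) / (2 * a)).
    { unfold Jint. apply (is_RInt_unique (V := RCN)).
      replace (sinh (PI * a) / (2 * a)) with (minus (sinh (2 * a * (PI / 2)) / (2 * a)) (sinh (2 * a * 0) / (2 * a))).
      - apply (is_RInt_derive (V := RCN) (fun t => sinh (2 * a * t) / (2 * a))).
        + intros x _. unfold sinh, cosh. auto_derive. auto. field. lra.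
        + intros x _. apply Jint_cont.
      - unfold minus, plus, opp; simpl. unfold sinh. replace (2 * a * 0) with 0 by ring.
        replace (2 * a * (PI / 2)) with (PI * a) by field. rewrite Ropp_0, exp_0. field. lra. }
    assert (I2 : Jint 0 0 = PI / 2).
    { unfold Jint. rewrite (RInt_ext _ (fun _ => 1)).
      rewrite RInt_const. unfold scal; simpl; unfold mult; simpl. field.
      intros x _. unfold cosh. replace (2 * 0 * x) with 0 by ring. rewrite Ropp_0, exp_0. simpl. field. }
    rewrite I1, I2. field. lra. }
  assert (Lq : is_lim_seq q 1).
  { apply is_lim_seq_incr_1.
    apply (is_lim_seq_le_le (fun _ => 1) _ (fun k => 1 + 2 * a ^ 2 * exp (PI * a) * / (INR k + 1))).
    - intros k. split. apply Hq1. unfold q. apply Rle_div_l. apply Jint_pos.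
      replace (2 * S k)%nat with (S (S (2 * k))) by lia.
      eapply Rle_trans. apply Jint_upper, Ha. rewrite Rmult_comm.
      apply Rmult_le_compat_r. apply Rlt_le, Jint_pos.
      apply Rplus_le_compat_l. unfold Rdiv. apply Rmult_le_compat_l. pose proof (exp_pos (PI * a)); nra.
      rewrite S_INR, mult_INR. simpl INR. pose proof (pos_INR k). apply Rinv_le_contravar; lra.
    - apply is_lim_seq_const.
    - replace (Finite 1) with (Finite (1 + 2 * a ^ 2 * exp (PI * a) * 0)) by (f_equal; ring).
      apply is_lim_seq_plus'. apply is_lim_seq_const.
      apply (is_lim_seq_scal_l (fun k => / (INR k + 1)) (2 * a ^ 2 * exp (PI * a)) 0).
      apply is_lim_seq_ext with (fun n => exp (- (1) * ln (INR n + 1))).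
      intros n. pose proof (pos_INR n). replace (- (1) * ln (INR n + 1)) with (- ln (INR n + 1)) by ring.
      rewrite exp_Ropp, exp_ln by lra. reflexivity.
      apply (is_lim_seq_exp_ln 1). lra. }
  assert (ES : forall M, Rsum M (fun n => ln (1 + a ^ 2 / INR (S n) ^ 2)) = ln (q 0%nat) - ln (q M)).
  { induction M. simpl. ring.
    change (Rsum (S M) (fun n => ln (1 + a ^ 2 / INR (S n) ^ 2))) with (Rsum M (fun n => ln (1 + a ^ 2 / INR (S n) ^ 2)) + ln (1 + a ^ 2 / INR (S M) ^ 2)).
    rewrite IHM, (Hqrec M), ln_mult. ring.
    assert (0 < a ^ 2 / INR (S M) ^ 2). { apply Rdiv_lt_0_compat; apply pow_lt. exact Ha. rewrite S_INR; pose proof (pos_INR M); lra. }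
    lra. specialize (Hq1 (S M)); lra. }
  apply is_lim_seq_ext with (fun M => ln (q 0%nat) - ln (q M)). intros; symmetry; apply ES.
  rewrite <- Hq0. replace (Finite (ln (q 0%nat))) with (Finite (ln (q 0%nat) - ln 1)) by (rewrite ln_1; f_equal; ring).
  apply is_lim_seq_minus'. apply is_lim_seq_const.
  apply (is_lim_seq_continuous ln q 1). apply continuity_pt_filterlim.
  apply (ex_derive_continuous (V := RN)). auto_derive. lra. exact Lq.
Qed.

(** * The derivative at zero *)

Lemma dFj_lim j q (x : nat -> R) : 0 <= q -> (forall n, INR n + 1 <= Rabs (x n)) ->
  Clim (fun n => C_derive (fun s => Fj (S j) q s (x n)) 0) 0%C.
Proof.
  intros Hq Hx. destruct (Fj_bound (S j) 0) as (r0 & D & Hr0 & HD & H).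
  (* Radius at most [1 / 4] keeps the exponent [Re s + (j + 1) / 2] at least [1 / 4]; the Cauchy
     estimate in [s] then passes the decay on to the derivative. *)
  set (r := Rmin r0 (1 / 4)). assert (Hr : 0 < r) by (apply Rmin_glb_lt; lra).
  assert (Hr1 : r <= r0) by apply Rmin_l. assert (Hr2 : r <= 1 / 4) by apply Rmin_r.
  apply (Clim_0 _ (fun n => (8 * D / r) * exp (- (/ 2) * ln (INR n + 1)))).
  - intros n. pose proof (pos_INR n) as Hn. specialize (Hx n).
    assert (L : (INR n + 1) ^ 2 <= x n ^ 2 + q).
    { rewrite <- (pow2_abs (x n)). assert ((INR n + 1) ^ 2 <= Rabs (x n) ^ 2) by (apply pow_incr; lra). lra. }
    replace (8 * D / r * exp (- (/ 2) * ln (INR n + 1))) with (8 * (D * exp (- (/ 2) * ln (INR n + 1))) / r) by (field; lra).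
    apply (cauchy_estimate (fun s => Fj (S j) q s (x n)) 0 _ r _ Hr).
    + intros w _. apply holo_Fj.
    + intros w Hw. eapply Rle_trans. apply H; try lra. nra.
      apply Rmult_le_compat_l. exact HD. apply exp_le.
      pose proof (abs_fst_le_Cmod (w - 0)%C) as B. simpl in B.
      assert (B2 : Rabs (fst w + - 0) < 1 / 4) by lra. apply Rabs_def2 in B2.
      assert (L2 : 2 * ln (INR n + 1) <= ln (x n ^ 2 + q)).
      { replace (2 * ln (INR n + 1)) with (ln ((INR n + 1) ^ 2)).
        apply ln_le; nra. replace ((INR n + 1) ^ 2) with ((INR n + 1) * (INR n + 1)) by ring. rewrite ln_mult by lra. ring. }
      assert (L3 : 0 <= ln (INR n + 1)) by (rewrite <- ln_1; apply ln_le; lra).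
      rewrite S_INR. unfold Re. pose proof (pos_INR j).
      assert (1 / 4 * ln (x n ^ 2 + q) <= (fst w + (INR j + 1) / 2) * ln (x n ^ 2 + q)) by (apply Rmult_le_compat_r; lra).
      lra.
    + apply holo_C_derive, holo_Fj.
  - replace (Finite 0) with (Rbar_mult (8 * D / r) 0) by (simpl; f_equal; ring).
    apply is_lim_seq_scal_l. apply is_lim_seq_exp_ln. lra.
Qed.

Lemma dF0_at_0 q x : dF0 q 0 x = RtoC (- ln (x ^ 2 + q)).
Proof.
  unfold dF0. rewrite Fj_0. replace (- 0)%C with (RtoC 0) by ring. rewrite Rcpow_0, RtoC_opp. ring.
Qed.

(** A primitive of [ln (x^2 + a^2)]. *)
Definition Hprim (a x : R) : R := x * ln (x ^ 2 + a ^ 2) - 2 * x + 2 * a * atan (x / a).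

Lemma CInt_dF0 a u v : 0 < a -> u <= v -> CInt (dF0 (a ^ 2) 0) u v = RtoC (- (Hprim a v - Hprim a u)).
Proof.
  intros Ha Huv. apply is_CInt_unique.
  replace (RtoC (- (Hprim a v - Hprim a u))) with (RtoC (- Hprim a v) - RtoC (- Hprim a u))%C.
  2:{ rewrite <- RtoC_minus. f_equal. ring. }
  apply (is_CInt_derive (fun x => RtoC (- Hprim a x))). exact Huv.
  - intros x _. rewrite dF0_at_0. apply rder_RtoC.
    assert (Hx : 0 < x ^ 2 + a ^ 2) by nra.
    unfold Hprim. auto_derive. nra.
    replace (x * (x * 1) + a * (a * 1)) with (x ^ 2 + a ^ 2) by ring. field. repeat split; nra.
  - intros x _. apply rcont_dF0. nra.
Qed.

Lemma is_lim_seq_inv_INR (c : R) : is_lim_seq (fun M => c / INR (S M)) 0.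
Proof.
  apply is_lim_seq_ext with (fun n => c * exp (- (1) * ln (INR n + 1))).
  { intros n. pose proof (pos_INR n). replace (- (1) * ln (INR n + 1)) with (- ln (INR n + 1)) by ring.
    rewrite exp_Ropp, exp_ln, S_INR by lra. reflexivity. }
  replace (Finite 0) with (Rbar_mult c 0) by (simpl; f_equal; ring).
  apply is_lim_seq_scal_l. apply (is_lim_seq_exp_ln 1). lra.
Qed.

Lemma lim_atan_scaled (a : R) : 0 < a -> is_lim_seq (fun M => atan (INR (S M) / a)) (PI / 2).
Proof.
  intros Ha. apply is_lim_seq_ext with (fun M => PI / 2 - atan (a / INR (S M))).
  { intros M. assert (HM : 0 < INR (S M)) by (rewrite S_INR; pose proof (pos_INR M); lra).
    replace (INR (S M) / a) with (/ (a / INR (S M))) by (field; lra). rewrite atan_inv. reflexivity.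
    apply Rdiv_lt_0_compat; assumption. }
  replace (Finite (PI / 2)) with (Finite (PI / 2 - atan 0)) by (rewrite atan_0; f_equal; ring).
  apply is_lim_seq_minus'. apply is_lim_seq_const.
  apply (is_lim_seq_continuous atan). apply continuity_pt_filterlim.
  apply (ex_derive_continuous (V := RN)). eexists. apply is_derive_atan.
  apply is_lim_seq_inv_INR.
Qed.

Lemma ln_1p_le x : 0 <= x -> 0 <= ln (1 + x) <= x.
Proof.
  intros Hx. split. rewrite <- ln_1. apply ln_le; lra.
  rewrite <- (ln_exp x) at 2. apply ln_le. lra. apply exp_ineq1_le.
Qed.

(* [- rho a M] is the derivative at [s = 0] of the [M]-th partial sum of [Rf a s], up to the
   boundary terms of the Euler-Maclaurin formula, which vanish in the limit. *)
Definition rho (a : R) (M : nat) : R :=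
  2 * Rsum M (fun n => ln ((INR n + 1) ^ 2 + a ^ 2)) + ln (a ^ 2) - ln (INR M ^ 2 + a ^ 2)
  - (Hprim a (INR M) - Hprim a (- INR M)).

Definition rho0 (M : nat) : R :=
  2 * Rsum M (fun n => 2 * ln (INR (S n))) - 2 * ln (INR M) - 4 * INR M * ln (INR M) + 4 * INR M.

(* [rho0 M] collects the terms that do not depend on [a] and hence cancel in differences. *)
Lemma rho_lim a : 0 < a ->
  is_lim_seq (fun M => rho a (S M) - rho0 (S M)) (2 * ln (sinh (PI * a) / (PI * a)) + 2 * ln a - 2 * PI * a).
Proof.
  intros Ha.
  apply is_lim_seq_ext with (fun M => 2 * Rsum (S M) (fun n => ln (1 + a ^ 2 / INR (S n) ^ 2)) + 2 * ln a
     - ln (1 + a ^ 2 / INR (S M) ^ 2) - 2 * INR (S M) * ln (1 + a ^ 2 / INR (S M) ^ 2) - 4 * a * atan (INR (S M) / a)).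
  { intros M0. set (M := S M0).
    assert (HM : 0 < INR M) by (unfold M; rewrite S_INR; pose proof (pos_INR M0); lra).
    (* The parts [2 * ln x] make up [rho0]; the others form the product for [sinh], two null
       sequences and an arctangent, whose limit gives [- 2 PI a]. *)
    assert (L : forall x, 0 < x -> ln (x ^ 2 + a ^ 2) = 2 * ln x + ln (1 + a ^ 2 / x ^ 2)).
    { intros x Hx. replace (x ^ 2 + a ^ 2) with (x * x * (1 + a ^ 2 / x ^ 2)) by (field; lra).
      assert (0 < 1 + a ^ 2 / x ^ 2).
      { assert (0 < a ^ 2 / x ^ 2) by (apply Rdiv_lt_0_compat; apply pow_lt; assumption). lra. }
      rewrite !ln_mult by nra. ring. }
    assert (LS : forall K, Rsum K (fun n => ln ((INR n + 1) ^ 2 + a ^ 2)) =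
       Rsum K (fun n => 2 * ln (INR (S n))) + Rsum K (fun n => ln (1 + a ^ 2 / INR (S n) ^ 2))).
    { induction K as [|K IH]. simpl; ring. cbn [Rsum]. rewrite IH, <- (S_INR K), L.
      ring. rewrite S_INR; pose proof (pos_INR K); lra. }
    unfold rho, rho0, Hprim. rewrite LS.
    replace ((- INR M) ^ 2) with (INR M ^ 2) by ring.
    replace (- INR M / a) with (- (INR M / a)) by (field; lra). rewrite atan_opp.
    replace (ln (a ^ 2)) with (2 * ln a).
    2:{ replace (a ^ 2) with (a * a) by ring. rewrite ln_mult by exact Ha. ring. }
    rewrite (L (INR M)) by exact HM. ring. }
  replace (Finite (2 * ln (sinh (PI * a) / (PI * a)) + 2 * ln a - 2 * PI * a)) with
    (Finite (2 * ln (sinh (PI * a) / (PI * a)) + 2 * ln a - 0 - 2 * 0 - 4 * a * (PI / 2))) by (f_equal; field).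
  assert (SC : forall (c : R) v (l : R), is_lim_seq v l -> is_lim_seq (fun n => c * v n) (c * l)).
  { intros c v l H. apply (is_lim_seq_scal_l v c l H). }
  apply is_lim_seq_minus'; [apply is_lim_seq_minus'; [apply is_lim_seq_minus'; [apply is_lim_seq_plus'|]|]|].
  - apply SC. apply (is_lim_seq_incr_1 (fun M => Rsum M (fun n => ln (1 + a ^ 2 / INR (S n) ^ 2)))). apply sinh_product, Ha.
  - apply is_lim_seq_const.
  - apply (is_lim_seq_le_le (fun _ => 0) _ (fun M => a ^ 2 / INR (S M))).
    + intros M. assert (HM : 1 <= INR (S M)) by (rewrite S_INR; pose proof (pos_INR M); lra).
      assert (0 <= a ^ 2 / INR (S M) ^ 2) by (apply Rle_div_r; [apply pow_lt; lra|nra]).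
      destruct (ln_1p_le _ H) as [B1 B2]. split. exact B1. eapply Rle_trans. exact B2.
      unfold Rdiv. apply Rmult_le_compat_l. nra. apply Rinv_le_contravar. lra. nra.
    + apply is_lim_seq_const.
    + apply is_lim_seq_inv_INR.
  - apply is_lim_seq_ext with (fun M => 2 * (INR (S M) * ln (1 + a ^ 2 / INR (S M) ^ 2))). intros; ring.
    apply SC.
    apply (is_lim_seq_le_le (fun _ => 0) _ (fun M => a ^ 2 / INR (S M))).
    + intros M. assert (HM : 1 <= INR (S M)) by (rewrite S_INR; pose proof (pos_INR M); lra).
      assert (0 <= a ^ 2 / INR (S M) ^ 2) by (apply Rle_div_r; [apply pow_lt; lra|nra]).
      destruct (ln_1p_le _ H) as [B1 B2]. split. apply Rmult_le_pos; lra.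
      apply Rmult_le_compat_l with (r := INR (S M)) in B2; [|lra].
      replace (INR (S M) * (a ^ 2 / INR (S M) ^ 2)) with (a ^ 2 / INR (S M)) in B2 by (field; lra). exact B2.
    + apply is_lim_seq_const.
    + apply is_lim_seq_inv_INR.
  - apply (SC (4 * a)). apply lim_atan_scaled, Ha.
Qed.

(** The linear term removes the growth of [sinh]. The constant [- 2 ln (2 PI)] is independent of [a]
    and drops out of differences. *)
Lemma ln_sinh a : 0 < a -> 2 * ln (sinh (PI * a) / (PI * a)) + 2 * ln a - 2 * PI * a =
  2 * ln (1 - exp (- 2 * PI * a)) - 2 * ln (2 * PI).
Proof.
  intros Ha. pose proof PI_RGT_0 as HPI.
  assert (HP : 0 < PI * a) by nra.
  assert (He : exp (- 2 * PI * a) < 1) by (rewrite <- exp_0; apply exp_increasing; nra).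
  assert (E : sinh (PI * a) / (PI * a) = exp (PI * a) * (1 - exp (- 2 * PI * a)) * / (2 * PI) * / a).
  { unfold sinh. replace (exp (- (PI * a))) with (exp (PI * a) * exp (- 2 * PI * a)).
    field. lra. rewrite <- exp_plus. f_equal. ring. }
  rewrite E.
  assert (0 < exp (PI * a)) by apply exp_pos.
  assert (0 < / (2 * PI)) by (apply Rinv_0_lt_compat; lra).
  assert (0 < / a) by (apply Rinv_0_lt_compat; lra).
  rewrite !ln_mult, !ln_Rinv, ln_exp; try lra.
  rewrite (ln_mult 2 PI) by lra. ring.
  apply Rmult_lt_0_compat; lra.
  apply Rmult_lt_0_compat; [apply Rmult_lt_0_compat; lra|lra].
Qed.

Section Zeta.

Variables (N : nat) (b : nat -> R) (A : R).
Hypothesis HN : (1 <= N)%nat.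
Hypothesis HA : 0 <= A.
Hypothesis HEM : EM_bound b N A.

Definition Rf_slope (a : R) : C := Cser (fun n => C_derive (rterm N b a n) 0).

Lemma INR_N_ge_1 : 1 <= INR N.
Proof. apply (le_INR 1), HN. Qed.

(** A partial sum of [Rf a] is differentiated at 0 in two ways, term by term and in the closed form
    of [Csum_rterm]; the boundary terms [B] of the latter tend to 0. *)
Lemma Rf_slope_lim_C a : 0 < a -> Clim (fun M => RtoC (- rho a (S M))) (Rf_slope a).
Proof.
  intros Ha. pose proof INR_N_ge_1.
  destruct (Rf_Cder N b A HA HEM 0 a) as [S1 _]. simpl; lra. exact Ha.
  apply is_Cser_Csum in S1.
  assert (Q : forall x, 0 < x ^ 2 + a ^ 2) by (intros x; nra).
  set (B := fun M => Csum N (fun j => b j * (C_derive (fun s => Fj (S j) (a ^ 2) s (INR M)) 0 - C_derive (fun s => Fj (S j) (a ^ 2) s (- INR M)%R) 0))%C).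
  assert (LB : Clim (fun M => B (S M)) 0%C).
  { replace (RtoC 0) with (Csum N (fun j => b j * (0 - 0))%C).
    2:{ rewrite (Csum_ext N _ (fun _ => RtoC 0)) by (intros; ring). apply Csum_zero. }
    apply (Clim_Csum N (fun j M => b j * (C_derive (fun s => Fj (S j) (a ^ 2) s (INR (S M))) 0 - C_derive (fun s => Fj (S j) (a ^ 2) s (- INR (S M))%R) 0))%C).
    intros j _. apply Clim_scal. apply Clim_minus.
    - apply dFj_lim. nra. intros n. rewrite S_INR. pose proof (pos_INR n). rewrite Rabs_pos_eq; lra.
    - apply (dFj_lim j (a ^ 2) (fun n => - INR (S n))). nra. intros n. rewrite S_INR. pose proof (pos_INR n). rewrite Rabs_left1; lra. }
  assert (ES : forall M, Csum M (fun n => C_derive (rterm N b a n) 0) = (RtoC (- rho a M) - B M)%C).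
  { intros M.
    apply (Cder_unique (fun s => Csum M (fun n => rterm N b a n s)) 0).
    - apply Cder_Csum. intros n _. apply holo_C_derive, rterm_holo, Ha.
    - apply Cder_ext with (fun s => 2 * Csum M (fun n => Fj 0 (a ^ 2) s (INR n + 1)%R) + Fj 0 (a ^ 2) s 0 - Fj 0 (a ^ 2) s (INR M)
   - CInt (Fj 0 (a ^ 2) s) (- INR M) (INR M)
   - Csum N (fun j => b j * (Fj (S j) (a ^ 2) s (INR M) - Fj (S j) (a ^ 2) s (- INR M)%R)))%C.
      { intros s. symmetry. apply Csum_rterm, Ha. }
      replace (RtoC (- rho a M)) with (2 * Csum M (fun n => dF0 (a ^ 2) 0 (INR n + 1)%R) + dF0 (a ^ 2) 0 0%R - dF0 (a ^ 2) 0 (INR M)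
         - CInt (dF0 (a ^ 2) 0) (- INR M) (INR M))%C.
      + apply Cder_minus; [apply Cder_minus; [apply Cder_minus; [apply Cder_plus|]|]|].
        * apply Cder_scal. apply (Cder_Csum M (fun n s => Fj 0 (a ^ 2) s (INR n + 1))). intros n _. apply Cder_F0.
        * apply Cder_F0.
        * apply Cder_F0.
        * apply Cder_CInt_F0. pose proof (pos_INR M); lra. intros x _. apply Q.
        * apply (Cder_Csum N (fun j s => b j * (Fj (S j) (a ^ 2) s (INR M) - Fj (S j) (a ^ 2) s (- INR M)%R))%C).
          intros j _. apply Cder_scal. apply Cder_minus; apply holo_C_derive, holo_Fj.
      + rewrite CInt_dF0 by (try exact Ha; pose proof (pos_INR M); lra). rewrite !dF0_at_0.
        rewrite (Csum_ext M _ (fun n => RtoC (- ln ((INR n + 1) ^ 2 + a ^ 2)))) by (intros; apply dF0_at_0).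
        assert (CS : forall K, Csum K (fun n => RtoC (- ln ((INR n + 1) ^ 2 + a ^ 2))) = RtoC (- Rsum K (fun n => ln ((INR n + 1) ^ 2 + a ^ 2)))).
        { induction K as [|K IH]. simpl. rewrite Ropp_0; reflexivity. cbn [Csum Rsum]. rewrite IH, <- RtoC_plus. f_equal. ring. }
        rewrite CS. unfold rho. rewrite <- RtoC_mult, <- RtoC_plus, <- !RtoC_minus. f_equal.
        replace (0 ^ 2 + a ^ 2) with (a ^ 2) by ring. ring. }
  apply Clim_ext with (fun M => Csum (S M) (fun n => C_derive (rterm N b a n) 0) + B (S M))%C.
  { intros M. rewrite ES. ring. }
  replace (Rf_slope a) with (Rf_slope a + 0)%C by ring.
  apply Clim_plus; [|exact LB].
  destruct S1 as [T1 T2]. split.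
  - apply (is_lim_seq_incr_1 (fun M => fst (Csum M (fun n => C_derive (rterm N b a n) 0)))). exact T1.
  - apply (is_lim_seq_incr_1 (fun M => snd (Csum M (fun n => C_derive (rterm N b a n) 0)))). exact T2.
Qed.

(** The decay of [Rf a] in [a] is uniform near [s = 0], so the Cauchy estimate passes it on to the
    derivative. *)
Lemma Rf_slope_inf : Clim (fun m => Rf_slope (INR m + 1)) 0%C.
Proof.
  pose proof INR_N_ge_1.
  destruct (Rf_bound N b A HA HEM 0 1) as (r0 & D & p & Hr0 & HD & Hp & H1). simpl; lra. lra.
  set (r := Rmin r0 (1 / 4)). assert (Hr : 0 < r) by (apply Rmin_glb_lt; lra).
  assert (Hr1 : r <= r0) by apply Rmin_l. assert (Hr2 : r <= 1 / 4) by apply Rmin_r.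
  apply (Clim_0 _ (fun m => 8 * D / r * exp (- p * ln (INR m + 1)))).
  - intros m. pose proof (pos_INR m).
    replace (8 * D / r * exp (- p * ln (INR m + 1))) with (8 * (D * exp (- p * ln (INR m + 1))) / r) by (field; lra).
    apply (cauchy_estimate (Rf N b (INR m + 1)) 0 _ r _ Hr).
    + intros w Hw. eexists. apply (Rf_Cder N b A HA HEM).
      pose proof (abs_fst_le_Cmod (w - 0)%C) as B. simpl in B.
      assert (B2 : Rabs (fst w + - 0) < 1 / 4) by lra. apply Rabs_def2 in B2. unfold Re. lra. lra.
    + intros w Hw. apply (H1 w (INR m + 1)); lra.
    + apply (Rf_Cder N b A HA HEM). simpl; lra. lra.
  - replace (Finite 0) with (Rbar_mult (8 * D / r) 0) by (simpl; f_equal; ring).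
    apply is_lim_seq_scal_l. apply is_lim_seq_exp_ln. lra.
Qed.

(** Only differences in [a] are computed, since the limit of [rho0] is Stirling's constant. The
    missing additive constant is found along [a' = m + 1], where both sides tend to 0. *)
Lemma Rf_slope_eq a : 0 < a -> Rf_slope a = RtoC (- 2 * ln (1 - exp (- 2 * PI * a))).
Proof.
  intros Ha. pose proof PI_RGT_0 as HPI.
  assert (Diff : forall a', 0 < a' -> fst (Rf_slope a') - fst (Rf_slope a) =
     2 * ln (1 - exp (- 2 * PI * a)) - 2 * ln (1 - exp (- 2 * PI * a'))).
  { intros a' Ha'.
    destruct (Rf_slope_lim_C a Ha) as [L1 _]. destruct (Rf_slope_lim_C a' Ha') as [L2 _]. simpl in L1, L2.
    pose proof (is_lim_seq_minus' _ _ _ _ L2 L1) as L3.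
    pose proof (is_lim_seq_minus' _ _ _ _ (rho_lim a Ha) (rho_lim a' Ha')) as L4.
    rewrite !ln_sinh in L4 by assumption.
    assert (L5 : is_lim_seq (fun M => rho a (S M) - rho0 (S M) - (rho a' (S M) - rho0 (S M))) (fst (Rf_slope a') - fst (Rf_slope a))).
    { eapply is_lim_seq_ext; [|exact L3]. intros M. cbv beta. ring. }
    apply is_lim_seq_unique in L4, L5. rewrite L4 in L5. apply Rbar_finite_eq in L5. lra. }
  apply Ceq.
  - change (fst (Rf_slope a) = - 2 * ln (1 - exp (- 2 * PI * a))).
    destruct Rf_slope_inf as [L1 _]. change (fst (RtoC 0)) with 0 in L1.
    assert (L2 : is_lim_seq (fun m => 2 * ln (1 - exp (- 2 * PI * a)) - 2 * ln (1 - exp (- 2 * PI * (INR m + 1))) + fst (Rf_slope a)) 0).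
    { eapply is_lim_seq_ext; [|exact L1]. intros m. cbv beta. pose proof (pos_INR m). rewrite <- Diff by lra. ring. }
    assert (L3 : is_lim_seq (fun m => 2 * ln (1 - exp (- 2 * PI * a)) - 2 * ln (1 - exp (- 2 * PI * (INR m + 1))) + fst (Rf_slope a))
        (2 * ln (1 - exp (- 2 * PI * a)) - 2 * ln (1 - 0) + fst (Rf_slope a))).
    { apply is_lim_seq_plus'; [|apply is_lim_seq_const]. apply is_lim_seq_minus'. apply is_lim_seq_const.
      apply (is_lim_seq_scal_l (fun m => ln (1 - exp (- 2 * PI * (INR m + 1)))) 2 (ln (1 - 0))).
      apply (is_lim_seq_continuous ln). apply continuity_pt_filterlim.
      apply (ex_derive_continuous (V := RN)). auto_derive. lra.
      apply is_lim_seq_minus'. apply is_lim_seq_const.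
      apply (is_lim_seq_le_le (fun _ => 0) _ (fun m => exp (- (1) * ln (INR m + 1)))).
      - intros m. pose proof (pos_INR m). split. apply Rlt_le, exp_pos. apply exp_le.
        assert (ln (INR m + 1) <= INR m) by (rewrite Rplus_comm; apply ln_1p_le; assumption).
        pose proof (PI2_1). nra.
      - apply is_lim_seq_const.
      - apply (is_lim_seq_exp_ln 1). lra. }
    apply is_lim_seq_unique in L2, L3. rewrite L2 in L3. apply Rbar_finite_eq in L3.
    rewrite Rminus_0_r, ln_1 in L3. lra.
  - destruct (Rf_slope_lim_C a Ha) as [_ L2]. simpl in L2.
    pose proof (is_lim_seq_const 0) as L3.
    apply is_lim_seq_unique in L2, L3. rewrite L2 in L3. apply Rbar_finite_eq in L3. exact L3.
Qed.

End Zeta.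

Section Derivative.

Variables (b : nat -> R) (A : R).
Hypothesis HA : 0 <= A.
Hypothesis HEM : EM_bound b 2 A.

Variable u : R.
Hypothesis Hu : 0 < u.

Lemma INR2 : INR 2 = 2.
Proof. simpl; ring. Qed.

Lemma zhat_half_shift_holo s : Re s < / 2 -> - 1 < Re s -> holo_at (fun s => zhat 2 b (s - / 2)%C) s.
Proof.
  intros H1 H2. apply (holo_at_comp (zhat 2 b) (fun s => s - / 2)%C).
  apply (zhat_holo 2 b A HA HEM). rewrite INR2, Re_sub_half. lra. rewrite Re_sub_half. lra.
  apply holo_at_minus. apply holo_at_id. apply holo_at_const.
Qed.

Lemma Zfun_holo s : - / 2 < Re s < / 2 -> holo_at (Zfun 2 b u 2) s.
Proof.
  intros Hs. unfold Zfun, Wfun.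
  apply holo_at_mult.
  { apply (holo_at_Rcpow (PI ^ 2 / u) (fun s => - s)%C). apply holo_at_opp, holo_at_id. }
  apply holo_at_mult. apply holo_at_const.
  apply holo_at_plus; [apply holo_at_minus|].
  - apply holo_at_mult; [apply holo_at_mult|].
    + apply (holo_at_Rcpow u (fun s => 1 - 2 * s)%C). apply holo_at_minus. apply holo_at_const.
      apply holo_at_mult. apply holo_at_const. apply holo_at_id.
    + apply zhat_half_shift_holo; lra.
    + apply c2_holo. exact Hs.
  - apply holo_at_mult.
    + apply (holo_at_Rcpow u (fun s => - (2) * s)%C). apply holo_at_mult. apply holo_at_const. apply holo_at_id.
    + apply (zhat_holo 2 b A HA HEM). rewrite INR2. lra. lra.
  - eexists. apply (Rf_series 2 b A HA HEM u Hu). rewrite INR2. lra.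
Qed.

(** Neither constant depends on [u]: [kappa1] becomes the coefficient of [u] in the logarithm of the
    determinant, [kappa2] a part of its additive constant. *)
Definition kappa1 : C := (zhat 2 b (0 - / 2) * C_derive (ck 2) 0)%C.
Definition kappa2 : C := C_derive (zhat 2 b) 0.

(** The product rule with the values at 0: [ck 2] and all [Rf] vanish and [zhat] is [- 1/2], so
    [Wfun] is [1/4] there, and the logarithm of [u] comes from both [Rcpow (PI ^ 2 / u)] and
    [Rcpow u]. *)
Lemma Zfun_der :
  is_Cser (fun m => RtoC (- 2 * ln (1 - exp (- 2 * PI * am u m)))) (Cser (fun m => RtoC (- 2 * ln (1 - exp (- 2 * PI * am u m))))) /\
  Cder (Zfun 2 b u 2) 0
   (- ln (PI ^ 2 / u) * / 4 + / 2 * (u * kappa1 - (ln u + kappa2) +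
      Cser (fun m => RtoC (- 2 * ln (1 - exp (- 2 * PI * am u m))))))%C.
Proof.
  destruct (Rf_series 2 b A HA HEM u Hu 0) as [_ [S1 S2]]. { rewrite INR2. simpl. lra. }
  assert (ER : forall m, C_derive (Rf 2 b (am u m)) 0 = RtoC (- 2 * ln (1 - exp (- 2 * PI * am u m)))).
  { intros m. assert (Ha : 0 < am u m) by (pose proof (am_ge u Hu m); lra).
    rewrite <- (Rf_slope_eq 2 b A ltac:(lia) HA HEM) by exact Ha. apply Cder_C_derive.
    apply (Rf_Cder 2 b A HA HEM). rewrite INR2; simpl; lra. exact Ha. }
  rewrite (Cser_ext _ _ ER) in S1, S2.
  assert (S1' : is_Cser (fun m => RtoC (- 2 * ln (1 - exp (- 2 * PI * am u m)))) (Cser (fun m => RtoC (- 2 * ln (1 - exp (- 2 * PI * am u m)))))).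
  { eapply is_Cser_ext; [|exact S1]. exact ER. }
  split. exact S1'.
  set (SS := Cser (fun m => RtoC (- 2 * ln (1 - exp (- 2 * PI * am u m))))) in *.
  assert (D1 : Cder (fun s => Rcpow (PI ^ 2 / u) (- s)) 0 (- (1) * (ln (PI ^ 2 / u) * Rcpow (PI ^ 2 / u) (- 0)))%C).
  { apply (Cder_comp (Rcpow (PI ^ 2 / u)) (fun s => - s)%C). apply Cder_Rcpow. apply Cder_opp, Cder_id. }
  assert (D2 : Cder (fun s => Rcpow u (1 - 2 * s)) 0 ((0 - 2 * 1) * (ln u * Rcpow u (1 - 2 * 0)))%C).
  { apply (Cder_comp (Rcpow u) (fun s => 1 - 2 * s)%C). apply Cder_Rcpow. apply Cder_minus. apply Cder_const. apply Cder_scal, Cder_id. }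
  assert (D3 : Cder (fun s => Rcpow u (- (2) * s)) 0 (- (2) * 1 * (ln u * Rcpow u (- (2) * 0)))%C).
  { apply (Cder_comp (Rcpow u) (fun s => - (2) * s)%C). apply Cder_Rcpow. apply Cder_scal, Cder_id. }
  assert (D4 : Cder (fun s => zhat 2 b (s - / 2)%C) 0 (C_derive (fun s => zhat 2 b (s - / 2)%C) 0)).
  { apply holo_C_derive, zhat_half_shift_holo; simpl; lra. }
  assert (D5 : Cder (ck 2) 0 (C_derive (ck 2) 0)).
  { apply holo_C_derive, c2_holo; simpl; lra. }
  assert (D6 : Cder (zhat 2 b) 0 kappa2).
  { apply holo_C_derive, (zhat_holo 2 b A HA HEM); rewrite ?INR2; simpl; lra. }
  pose proof (Cder_minus _ _ _ _ _ (Cder_mult _ _ _ _ _ (Cder_mult _ _ _ _ _ D2 D4) D5) (Cder_mult _ _ _ _ _ D3 D6)) as E1.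
  pose proof (Cder_mult _ _ _ _ _ D1 (Cder_scal _ _ (/ 2)%C _ (Cder_plus _ _ _ _ _ E1 S2))) as E2.
  unfold Zfun, Wfun.
  match type of E2 with Cder ?f _ ?l => match goal with |- Cder _ _ ?l' => replace l' with l end end. exact E2.
  cbv beta. rewrite c2_at_0, (zhat_at_0 2 b).
  rewrite (Cser_ext (fun m => Rf 2 b (am u m) 0) (fun _ => RtoC 0)) by (intros; apply Rf_at_0). rewrite Cser_zero.
  replace (- 0)%C with (RtoC 0) by ring. replace (1 - 2 * 0)%C with (RtoC 1) by ring. replace (- (2) * 0)%C with (RtoC 0) by ring.
  rewrite !Rcpow_0, Rcpow_1 by exact Hu. unfold kappa1. field.
Qed.

End Derivative.

(** * Complex conjugation: the derivative at 0 is real *)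

Lemma Cconj_Cmod_sub (a c : C) : Cmod (Cconj a - Cconj c)%C = Cmod (a - c)%C.
Proof.
  rewrite <- (Cmod_conj (a - c)%C). f_equal. apply Ceq; simpl; ring.
Qed.

Lemma Cconj_conj (z : C) : Cconj (Cconj z) = z.
Proof. apply Ceq; simpl; ring. Qed.

Lemma Cder_conj f z l : Cder f (Cconj z) l -> Cder (fun w => Cconj (f (Cconj w))) z (Cconj l).
Proof.
  intros H eps He. destruct (H eps He) as [d [Hd H1]]. exists d. split. exact Hd.
  intros h Hh. specialize (H1 (Cconj h)). rewrite Cmod_conj in H1. specialize (H1 Hh).
  rewrite <- Cmod_conj.
  replace (Cconj (Cconj (f (Cconj (z + h))) - Cconj (f (Cconj z)) - h * Cconj l))%C with
    (f (Cconj z + Cconj h) - f (Cconj z) - Cconj h * l)%C. exact H1.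
  replace (Cconj (z + h)) with (Cconj z + Cconj h)%C by (apply Ceq; simpl; ring).
  apply Ceq; simpl; ring.
Qed.

Lemma near_conj z P : near (Cconj z) P -> near z (fun w => P (Cconj w)).
Proof.
  intros [d [Hd H]]. exists d. split. exact Hd. intros w Hw. apply H. rewrite Cconj_Cmod_sub. exact Hw.
Qed.

Lemma near_holo_conj f z : near (Cconj z) (holo_at f) -> near z (holo_at (fun w => Cconj (f (Cconj w)))).
Proof.
  intros H. apply near_conj in H. eapply near_impl; [|exact H].
  intros w [l Hl]. eexists. apply Cder_conj, Hl.
Qed.

Lemma Cconj_mult (a c : C) : Cconj (a * c) = (Cconj a * Cconj c)%C.
Proof. apply Ceq; simpl; ring. Qed.

Lemma Cconj_pow a n : Cconj (a ^ n) = (Cconj a ^ n)%C.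
Proof. induction n; simpl. apply Ceq; simpl; ring. rewrite Cconj_mult, IHn. reflexivity. Qed.

Lemma mero_conj f z : mero f (Cconj z) -> mero (fun w => Cconj (f (Cconj w))) z.
Proof.
  intros (k & g & H1 & [d [Hd H2]]). exists k, (fun w => Cconj (g (Cconj w))). split.
  apply near_holo_conj, H1.
  exists d. split. exact Hd. intros w Hw Nw.
  assert (Nc : Cconj w <> Cconj z).
  { intros E. apply Nw. rewrite <- (Cconj_conj w), <- (Cconj_conj z), E. reflexivity. }
  rewrite H2; [|rewrite Cconj_Cmod_sub; exact Hw|exact Nc].
  pose proof (Cpow_neq_0 _ k (Csub_neq_0 _ _ Nc)) as N1.
  pose proof (Cpow_neq_0 _ k (Csub_neq_0 _ _ Nw)) as N2.
  set (v := (g (Cconj w) / (Cconj w - Cconj z) ^ k)%C).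
  assert (E : g (Cconj w) = (v * (Cconj w - Cconj z) ^ k)%C) by (unfold v; field; exact N1).
  rewrite E, Cconj_mult, Cconj_pow.
  replace (Cconj (Cconj w - Cconj z)) with (w - z)%C by (apply Ceq; simpl; ring).
  field. exact N2.
Qed.

Lemma Rcpow_conj x s : Rcpow x (Cconj s) = Cconj (Rcpow x s).
Proof.
  unfold Rcpow. replace (Cconj s * ln x)%C with (Cconj (s * ln x)) by (apply Ceq; simpl; ring).
  unfold Cexp. apply Ceq; unfold Re, Im; simpl; rewrite ?cos_neg, ?sin_neg; ring.
Qed.

Lemma is_Cser_conj a l : is_Cser a l -> is_Cser (fun n => Cconj (a n)) (Cconj l).
Proof.
  intros [H1 H2]. split; simpl. exact H1. apply (is_series_opp (V := RN) (fun n => snd (a n))), H2.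
Qed.

Lemma zeta_sum_conj L s z : is_zeta_sum L s z -> is_zeta_sum L (Cconj s) (Cconj z).
Proof.
  intros (u & H1 & H2). exists (fun m => Cconj (u m)). split.
  - intros m. apply is_series_is_Cser. specialize (H1 m). apply is_series_is_Cser, is_Cser_conj in H1.
    eapply is_Cser_ext; [|exact H1]. intros n. cbv beta. rewrite <- Rcpow_conj. f_equal.
  - apply is_series_is_Cser. apply is_series_is_Cser in H2. apply is_Cser_conj, H2.
Qed.

(** The eigenvalues being real, [w => Cconj (Z (Cconj w))] is an extension too and agrees with [Z]
    near 0. The realness that [is_zeta_det] demands cannot be read off [kappa1] and [kappa2]. *)
Lemma zeta_derivative_real L Z : is_zeta_extension L Z -> holomorphic_at Z 0 -> snd (C_derive Z 0) = 0.
Proof.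
  intros HZ Hh. pose proof HZ as [M S].
  set (Z' := fun w => Cconj (Z (Cconj w))).
  assert (C0 : Cconj 0 = 0%C) by (apply Ceq; simpl; ring).
  assert (Hh' : holomorphic_at Z' 0).
  { apply holomorphic_at_near. apply near_holo_conj. rewrite C0. apply holomorphic_at_near, Hh. }
  assert (HZ' : is_zeta_extension L Z').
  { split.
    - intros s. apply meromorphic_at_mero, mero_conj, meromorphic_at_mero, M.
    - intros s Hs. rewrite <- (Cconj_conj s) at 1. apply zeta_sum_conj. apply S. exact Hs. }
  assert (Hz : holo_at Z 0) by (apply holomorphic_at_near, near_self in Hh; exact Hh).
  pose proof (C_derive_ext_near Z Z' 0 Hz (zeta_extension_unique L Z Z' HZ HZ' Hh Hh')) as E.
  assert (E2 : C_derive Z' 0 = Cconj (C_derive Z 0)).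
  { apply Cder_C_derive, Cder_conj. rewrite C0. apply holo_C_derive, Hz. }
  rewrite E2 in E. revert E. generalize (C_derive Z 0). intros c E.
  assert (E3 := f_equal snd E). simpl in E3. lra.
Qed.

(** * Exchange of the two summations *)

Lemma Clim_bound a l B : Clim a l -> (exists N, forall n, (N <= n)%nat -> Cmod (a n) <= B) -> Cmod l <= 2 * B.
Proof.
  intros [H1 H2] [N HB].
  assert (G : forall v (x : R), is_lim_seq v x -> (forall n, (N <= n)%nat -> Rabs (v n) <= B) -> Rabs x <= B).
  { intros v x Hv Hb. apply is_lim_seq_abs in Hv.
    apply (is_lim_seq_le_loc (fun n => Rabs (v n)) (fun _ => B) (Rabs x) B).
    exists N. exact Hb. exact Hv. apply is_lim_seq_const. }
  assert (B1 := G _ _ H1 (fun n Hn => Rle_trans _ _ _ (abs_fst_le_Cmod _) (HB n Hn))).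
  assert (B2 := G _ _ H2 (fun n Hn => Rle_trans _ _ _ (abs_snd_le_Cmod _) (HB n Hn))).
  eapply Rle_trans. apply Cmod_le_abs. lra.
Qed.

(** Cutting row [m] after [k] terms costs at most a multiple of [e m] times the tail of [e] from [k]
    on. This is summable over [m], and the total cost tends to 0 with the tail. *)
Theorem fubini_Cser (a : nat -> nat -> C) (e : nat -> R) (K : R) (z : C) (v : nat -> C) :
  0 <= K -> (forall n, 0 <= e n) -> ex_series e -> (forall m n, Cmod (a m n) <= K * e m * e n) ->
  (forall m, is_Cser (a m) (v m)) -> is_Cser v z ->
  is_Cser (fun n => Cser (fun m => a m n)) z.
Proof.
  intros HK He Hs Ha Hv Hz.
  assert (Col : forall n, is_Cser (fun m => a m n) (Cser (fun m => a m n))).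
  { intros n. apply (is_Cser_bound _ (fun m => K * e n * e m)).
    intros m. replace (K * e n * e m) with (K * e m * e n) by ring. apply Ha.
    apply (ex_series_scal (V := RN)), Hs. }
  assert (Fin : forall k, is_Cser (fun m => Csum k (a m)) (Csum k (fun n => Cser (fun m => a m n)))).
  { induction k. simpl. apply is_Cser_Csum. eapply Clim_ext; [|apply (Clim_const 0%C)]. intros; symmetry; apply Csum_zero.
    cbn [Csum]. apply is_Cser_plus. exact IHk. apply Col. }
  assert (LT : is_lim_seq (fun k => Rsum k e) (Series e)) by (apply is_series_Rsum, Series_correct, Hs).
  assert (Mono : forall k d, Rsum k e <= Rsum (k + d) e).
  { intros k d. induction d. rewrite Nat.add_0_r; lra. rewrite Nat.add_succ_r. simpl. specialize (He (k + d)%nat). lra. }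
  assert (Tail : forall k, Rsum k e <= Series e).
  { intros k. apply (is_lim_seq_le_loc (fun _ => Rsum k e) (fun n => Rsum n e) (Rsum k e) (Series e)).
    exists k. intros n Hn. replace n with (k + (n - k))%nat by lia. apply Mono. apply is_lim_seq_const. exact LT. }
  assert (Part : forall m k d, Cmod (Csum (k + d) (a m) - Csum k (a m))%C <= K * e m * (Rsum (k + d) e - Rsum k e)).
  { intros m k d. induction d.
    - rewrite Nat.add_0_r. replace (Csum k (a m) - Csum k (a m))%C with (RtoC 0) by ring. rewrite Cmod_0. lra.
    - rewrite Nat.add_succ_r. cbn [Csum Rsum].
      replace (Csum (k + d) (a m) + a m (k + d)%nat - Csum k (a m))%C with ((Csum (k + d) (a m) - Csum k (a m)) + a m (k + d)%nat)%C by ring.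
      eapply Rle_trans. apply Cmod_triangle. specialize (Ha m (k + d)%nat). lra. }
  assert (Row : forall m k, Cmod (v m - Csum k (a m))%C <= (4 * K * (Series e - Rsum k e)) * e m).
  { intros m k. assert (0 <= K * e m) by (apply Rmult_le_pos; auto).
    pose proof (Clim_minus _ _ _ _ (proj1 (is_Cser_Csum _ _) (Hv m)) (Clim_const (Csum k (a m)))) as L.
    apply Rle_trans with (2 * (K * e m * (Series e - Rsum k e))).
    - apply (Clim_bound _ _ _ L). exists k. intros n Hn. replace n with (k + (n - k))%nat by lia.
      eapply Rle_trans. apply Part. apply Rmult_le_compat_l. exact H. specialize (Tail (k + (n - k))%nat). lra.
    - specialize (Tail k). assert (0 <= K * e m * (Series e - Rsum k e)) by (apply Rmult_le_pos; lra). lra. }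
  apply is_Cser_Csum.
  apply Clim_ext with (fun k => z - Cser (fun m => v m - Csum k (a m))%C)%C.
  { intros k. rewrite (is_Cser_unique _ _ (is_Cser_minus _ _ _ _ Hz (Fin k))). ring. }
  replace z with (z - 0)%C at 1 by ring. apply Clim_minus. apply Clim_const.
  apply (Clim_0 _ (fun k => 8 * K * Series e * (Series e - Rsum k e))).
  - intros k. destruct (is_Cser_bound (fun m => v m - Csum k (a m))%C (fun m => (4 * K * (Series e - Rsum k e)) * e m)) as [_ B].
    intros m. apply Row. apply (ex_series_scal (V := RN)), Hs.
    rewrite Series_scal_l in B. eapply Rle_trans. exact B. right. ring.
  - replace (Finite 0) with (Rbar_mult (8 * K * Series e) (Series e - Series e)) by (simpl; f_equal; ring).
    apply is_lim_seq_scal_l. apply is_lim_seq_minus'. apply is_lim_seq_const. exact LT.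
Qed.

(* Swapping the summations exchanges [L] and [1/L]; absolute convergence follows from
   [lambda_(m,n) >= 2 PI^2 m n]. *)
Lemma zeta_sum_swap L s z : 0 < L -> 1 < Re s -> is_zeta_sum L s z -> is_zeta_sum (/ L) s z.
Proof.
  intros HL Hs (v & H1 & H2).
  set (a := fun m n => Rcpow (dirichlet_eigenvalue L (S m) (S n)) (- s)).
  set (e := fun n => exp (- Re s * ln (INR n + 1))).
  assert (Sw : forall m n, dirichlet_eigenvalue (/ L) m n = dirichlet_eigenvalue L n m).
  { intros m n. unfold dirichlet_eigenvalue. field. lra. }
  pose proof PI_RGT_0 as HPI.
  assert (Bd : forall m n, Cmod (a m n) <= exp (- Re s * ln (2 * PI ^ 2)) * e m * e n).
  { intros m n. unfold a, e. rewrite Cmod_Rcpow, <- !exp_plus. apply exp_le.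
    pose proof (pos_INR m). pose proof (pos_INR n).
    assert (P2 : 0 < 2 * PI ^ 2) by (pose proof (pow_lt PI 2 HPI); lra).
    assert (L1 : 2 * PI ^ 2 * (INR m + 1) * (INR n + 1) <= dirichlet_eigenvalue L (S m) (S n)).
    { unfold dirichlet_eigenvalue. rewrite !S_INR.
      replace (PI ^ 2 * (INR m + 1) ^ 2 / L ^ 2 + PI ^ 2 * (INR n + 1) ^ 2 * L ^ 2) with
        (PI ^ 2 * (((INR m + 1) / L - (INR n + 1) * L) ^ 2) + 2 * PI ^ 2 * (INR m + 1) * (INR n + 1)) by (field; lra).
      assert (0 <= PI ^ 2 * (((INR m + 1) / L - (INR n + 1) * L) ^ 2)) by (apply Rmult_le_pos; apply pow2_ge_0). lra. }
    assert (L2 : ln (2 * PI ^ 2) + ln (INR m + 1) + ln (INR n + 1) <= ln (dirichlet_eigenvalue L (S m) (S n))).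
    { rewrite <- !ln_mult; try lra; try nra. apply ln_le; [|exact L1]. apply Rmult_lt_0_compat; nra. }
    assert (Er : Re (- s)%C = - Re s) by reflexivity. rewrite Er.
    apply Rmult_le_compat_l with (r := Re s) in L2; [|lra]. lra. }
  pose proof (fubini_Cser a e (exp (- Re s * ln (2 * PI ^ 2))) z v) as F.
  assert (He : ex_series e) by (apply ex_series_power; exact Hs).
  exists (fun n => Cser (fun m => a m n)). split.
  - intros n. apply is_series_is_Cser.
    apply is_Cser_ext with (fun m => a m n). intros m. unfold a. rewrite Sw. reflexivity.
    apply (is_Cser_bound _ (fun m => exp (- Re s * ln (2 * PI ^ 2)) * e n * e m)).
    intros m. replace (exp (- Re s * ln (2 * PI ^ 2)) * e n * e m) with (exp (- Re s * ln (2 * PI ^ 2)) * e m * e n) by ring. apply Bd.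
    apply (ex_series_scal (V := RN)), He.
  - apply is_series_is_Cser. apply F.
    apply Rlt_le, exp_pos. intros; apply Rlt_le, exp_pos. exact He. exact Bd.
    intros m. apply is_series_is_Cser. exact (H1 m). apply is_series_is_Cser. exact H2.
Qed.

(** * Maximization *)

Definition eta_term (u : R) (m : nat) : R := ln (1 - exp (- 2 * PI * ((INR m + 1) * u))).

(* With [eta] the Dedekind function, [alpha u + Series (eta_term u)] is [ln (eta (i u))]
   when [alpha = - PI / 12]; only [alpha < 0] matters below. *)
Definition logdet (alpha kappa u : R) : R := ln u / 4 + alpha * u + Series (eta_term u) + kappa.

(** The constants come before [L], so that one function of [u] describes all rectangles. The
    invariance under [L -> 1 / L] holds because the same [Z] is an extension for both, by
    [zeta_sum_swap]. *)
Lemma det_laplacian_formula : exists alpha kappa : R, forall L u, 0 < L -> u = / L ^ 2 ->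
  ex_series (eta_term u) /\ det_laplacian L = exp (logdet alpha kappa u) /\ det_laplacian (/ L) = det_laplacian L.
Proof.
  (* One coefficient sequence is fixed for each order before [L] is given; [kappa1] and [kappa2] are
     thereby the same for all [L]. *)
  set (EM := fun N => constructive_indefinite_description _ (euler_maclaurin N)).
  set (bb := fun N => proj1_sig (EM N)).
  assert (HEM : forall N, exists A, 0 <= A /\ EM_bound (bb N) N A).
  { intros N. exact (proj2_sig (EM N)). }
  exists (- fst (kappa1 (bb 2%nat)) / 2), (ln (PI ^ 2) / 4 + fst (kappa2 (bb 2%nat)) / 2).
  intros L u HL EL.
  assert (Hu : 0 < u) by (rewrite EL; apply Rinv_0_lt_compat, pow_lt, HL).
  destruct (HEM 2%nat) as (A2 & HA2 & HEM2).
  destruct (Zfun_der (bb 2%nat) A2 HA2 HEM2 u Hu) as [S1 D].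
  (* To reach [Re s > - (K + 1)] the remainder needs order [N >= 2 K + 2], and [ck k] needs
     [k >= K + 3/2]. *)
  destruct (glue L (fun K => Zfun (2 * K + 2) (bb (2 * K + 2)%nat) u (K + 2))) as (Z & HZ & Hnear).
  { intros K s Hs. destruct (HEM (2 * K + 2)%nat) as (A & HA & HE).
    apply (Zfun_mero _ _ A HA HE u Hu).
    rewrite plus_INR, mult_INR, INR2. lra. rewrite plus_INR, INR2. lra. }
  { intros K s Hs. destruct (HEM (2 * K + 2)%nat) as (A & HA & HE).
    apply (Zfun_sum _ _ A HA HE u Hu); assumption. }
  simpl Nat.add in Hnear.
  assert (Hh : holomorphic_at Z 0).
  { apply holomorphic_at_near.
    assert (B : near 0 (fun w => - / 2 < Re w /\ Re w < / 2)).
    { apply near_and. apply near_lt_Re. simpl; lra.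
      exists (/ 2). split. lra. intros w Hw.
      pose proof (abs_fst_le_Cmod (w - 0)%C) as B. simpl in B.
      assert (B2 : Rabs (fst w + - 0) < / 2) by lra. apply Rabs_def2 in B2. unfold Re. lra. }
    destruct (near_and _ _ _ Hnear B) as [d [Hd HH]]. exists d. split. exact Hd.
    intros w Hw. destruct (HH w Hw) as [_ Hw2].
    destruct (Zfun_holo (bb 2%nat) A2 HA2 HEM2 u Hu w Hw2) as [l Hl]. exists l.
    eapply Cder_ext_loc; [|exact Hl].
    exists (d - Cmod (w - 0)%C). split. lra. intros v Hv. symmetry. apply (HH v).
    replace (v - 0)%C with ((v - w) + (w - 0))%C by ring. eapply Rle_lt_trans. apply Cmod_triangle. lra. }
  assert (DZ : C_derive Z 0 = C_derive (Zfun 2 (bb 2%nat) u 2) 0).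
  { apply C_derive_ext_near. apply holomorphic_at_near, near_self in Hh. exact Hh. exact Hnear. }
  pose proof (zeta_derivative_real L Z HZ Hh) as Him.
  assert (Eser : is_series (eta_term u) (- / 2 * fst (Cser (fun m => RtoC (- 2 * ln (1 - exp (- 2 * PI * am u m))))))).
  { destruct S1 as [S1 _].
    apply (is_series_ext (fun m => - / 2 * (- 2 * ln (1 - exp (- 2 * PI * am u m))))).
    intros m. change (- / 2 * (- 2 * ln (1 - exp (- 2 * PI * am u m))) = ln (1 - exp (- 2 * PI * am u m))). field.
    apply (is_series_scal (V := RN) (- / 2)). exact S1. }
  pose proof (is_series_unique _ _ Eser) as Eser2.
  set (SS := Cser (fun m => RtoC (- 2 * ln (1 - exp (- 2 * PI * am u m))))) in *.
  assert (Det : RtoC (exp (logdet (- fst (kappa1 (bb 2%nat)) / 2) (ln (PI ^ 2) / 4 + fst (kappa2 (bb 2%nat)) / 2) u)) = Cexp (- C_derive Z 0)%C).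
  { assert (Ere : fst (C_derive Z 0) = - logdet (- fst (kappa1 (bb 2%nat)) / 2) (ln (PI ^ 2) / 4 + fst (kappa2 (bb 2%nat)) / 2) u).
    { rewrite DZ, (Cder_C_derive _ _ _ D). unfold logdet. rewrite Eser2.
      assert (EP : ln (PI ^ 2 / u) = ln (PI ^ 2) - ln u).
      { unfold Rdiv. rewrite ln_mult, ln_Rinv. ring. exact Hu. apply pow_lt, PI_RGT_0. apply Rinv_0_lt_compat, Hu. }
      rewrite EP. generalize (ln (PI ^ 2)) (kappa1 (bb 2%nat)) (kappa2 (bb 2%nat)) SS. intros x k1 k2 S'. simpl. field. }
    revert Him Ere. generalize (C_derive Z 0). intros c Him Ere.
    match goal with |- RtoC (exp ?x) = _ => replace (- c)%C with (RtoC x) by (apply Ceq; [change (x = - fst c); lra|change (0 = - snd c); lra]); generalize x end.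
    intros x. unfold Cexp. apply Ceq; simpl; rewrite ?cos_0, ?sin_0; ring. }
  split. eexists; exact Eser.
  rewrite (det_laplacian_eq L _ Z HZ Hh Det). split. reflexivity.
  apply (det_laplacian_eq (/ L) _ Z); [|exact Hh|exact Det].
  destruct HZ as [HM HS]. split. exact HM. intros s Hs. apply zeta_sum_swap; auto.
Qed.

(** Both values lie above the tangent at the mean [w]. *)
Lemma exp_convex t x y : 0 <= t <= 1 -> exp (t * x + (1 - t) * y) <= t * exp x + (1 - t) * exp y.
Proof.
  intros Ht. set (w := t * x + (1 - t) * y). pose proof (exp_pos w) as P.
  assert (T : forall z, exp w * (1 + (z - w)) <= exp z).
  { intros z. replace z with (w + (z - w)) at 2 by ring. rewrite exp_plus.
    apply Rmult_le_compat_l. lra. apply exp_ineq1_le. }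
  pose proof (Rmult_le_compat_l t _ _ (proj1 Ht) (T x)) as T1.
  pose proof (Rmult_le_compat_l (1 - t) _ _ ltac:(lra) (T y)) as T2.
  replace (exp w) with (t * (exp w * (1 + (x - w))) + (1 - t) * (exp w * (1 + (y - w)))) by (unfold w; ring).
  lra.
Qed.

Lemma ln_concave t x y : 0 <= t <= 1 -> 0 < x -> 0 < y -> t * ln x + (1 - t) * ln y <= ln (t * x + (1 - t) * y).
Proof.
  intros Ht Hx Hy.
  pose proof (exp_convex t (ln x) (ln y) Ht) as E. rewrite !exp_ln in E by assumption.
  rewrite <- (ln_exp (t * ln x + (1 - t) * ln y)). apply ln_le. apply exp_pos. exact E.
Qed.

Lemma exp_neg_lt_1 u m : 0 < u -> exp (- 2 * PI * ((INR m + 1) * u)) < 1.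
Proof.
  intros Hu. apply Rlt_le_trans with (exp 0); [|rewrite exp_0; lra]. apply exp_increasing.
  pose proof PI_RGT_0. pose proof (pos_INR m).
  assert (0 < PI * ((INR m + 1) * u)) by (apply Rmult_lt_0_compat; [lra|apply Rmult_lt_0_compat; lra]). lra.
Qed.

(** An increasing concave function, [ln], of the concave function 1 minus an exponential. *)
Lemma eta_term_concave t u v m : 0 <= t <= 1 -> 0 < u -> 0 < v ->
  t * eta_term u m + (1 - t) * eta_term v m <= eta_term (t * u + (1 - t) * v) m.
Proof.
  intros Ht Hu Hv. unfold eta_term.
  pose proof (exp_neg_lt_1 u m Hu). pose proof (exp_neg_lt_1 v m Hv).
  eapply Rle_trans. apply ln_concave; lra. apply ln_le.
  - destruct (Req_dec t 0) as [->|Nt]. lra. assert (0 < t) by lra. nra.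
  - replace (- 2 * PI * ((INR m + 1) * (t * u + (1 - t) * v))) with
      (t * (- 2 * PI * ((INR m + 1) * u)) + (1 - t) * (- 2 * PI * ((INR m + 1) * v))) by ring.
    pose proof (exp_convex t (- 2 * PI * ((INR m + 1) * u)) (- 2 * PI * ((INR m + 1) * v)) Ht). lra.
Qed.

Lemma eta_term_le_0 u m : 0 < u -> eta_term u m <= 0.
Proof.
  intros Hu. unfold eta_term. rewrite <- ln_1. pose proof (exp_neg_lt_1 u m Hu).
  pose proof (exp_pos (- 2 * PI * ((INR m + 1) * u))). apply ln_le; lra.
Qed.

Lemma eta_term_incr u v m : 0 < u -> u <= v -> eta_term u m <= eta_term v m.
Proof.
  intros Hu Huv. unfold eta_term. pose proof (exp_neg_lt_1 u m Hu). apply ln_le. lra.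
  pose proof PI_RGT_0. pose proof (pos_INR m).
  assert (exp (- 2 * PI * ((INR m + 1) * v)) <= exp (- 2 * PI * ((INR m + 1) * u))); [|lra].
  apply exp_le.
  assert (PI * ((INR m + 1) * u) <= PI * ((INR m + 1) * v)) by (apply Rmult_le_compat_l; [lra|apply Rmult_le_compat_l; lra]).
  lra.
Qed.

Lemma Series_le_gen (a c : nat -> R) : (forall n, a n <= c n) -> ex_series a -> ex_series c -> Series a <= Series c.
Proof.
  intros H Ha Hc.
  apply (is_lim_seq_le (fun n => sum_n a n) (fun n => sum_n c n) (Series a) (Series c)).
  - intros n. apply sum_n_m_le. exact H.
  - apply Series_correct, Ha.
  - apply Series_correct, Hc.
Qed.

Section LogDet.

Variables alpha kappa : R.
Let F := logdet alpha kappa.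
Hypothesis Hser : forall u, 0 < u -> ex_series (eta_term u).
Hypothesis Hsym : forall u, 0 < u -> F (/ u) = F u.

Lemma logdet_lt_gt_1 u : 1 < u -> F u < F 1.
Proof.
  (* [1] is the convex combination of [u] and [1 / u] with weight [t], and both have the same image. *)
  intros Hu. set (t := / (u + 1)).
  assert (Ht : 0 < t < / 2).
  { split. apply Rinv_0_lt_compat; lra. apply Rinv_lt_contravar; lra. }
  assert (Hiu : 0 < / u) by (apply Rinv_0_lt_compat; lra).
  assert (E1 : t * u + (1 - t) * / u = 1) by (unfold t; field; lra).
  assert (Hs : t * Series (eta_term u) + (1 - t) * Series (eta_term (/ u)) <= Series (eta_term 1)).
  { rewrite <- !Series_scal_l, <- Series_plus.
    - apply Series_le_gen.
      + intros n. pose proof (eta_term_concave t u (/ u) n) as B. rewrite E1 in B. apply B; lra.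
      + apply (ex_series_plus (V := RN) (fun n => t * eta_term u n) (fun n => (1 - t) * eta_term (/ u) n));
        apply (ex_series_scal (V := RN)); apply Hser; lra.
      + apply Hser; lra.
    - apply (ex_series_scal (V := RN)); apply Hser; lra.
    - apply (ex_series_scal (V := RN)); apply Hser; lra. }
  assert (Hln : 0 < ln u) by (rewrite <- ln_1; apply ln_increasing; lra).
  assert (C : F u = t * F u + (1 - t) * F (/ u)) by (rewrite Hsym by lra; ring).
  rewrite C. unfold F, logdet. rewrite ln_Rinv, ln_1 by lra.
  assert (Ha : alpha * (t * u + (1 - t) * / u) = alpha * 1) by (rewrite E1; reflexivity).
  (* Strictness comes from the logarithm alone: [t ln u + (1 - t) ln (1 / u) = - (1 - 2 t) ln u < 0
     = ln 1]. *)
  assert (0 < (1 - 2 * t) * ln u) by (apply Rmult_lt_0_compat; lra).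
  lra.
Qed.

Lemma logdet_lt_1 u : 0 < u -> u <> 1 -> F u < F 1.
Proof.
  intros Hu Nu. destruct (Rlt_dec 1 u) as [H|H]. apply logdet_lt_gt_1, H.
  rewrite <- Hsym by exact Hu. apply logdet_lt_gt_1.
  rewrite <- Rinv_1. apply Rinv_lt_contravar; lra.
Qed.

Lemma alpha_neg : alpha < 0.
Proof.
  (* for [alpha >= 0] the term [ln u / 4] would make [F] unbounded on [[1, +oo)] *)
  apply Rnot_le_lt. intros Ha.
  set (K := F 1 - kappa - Series (eta_term 1)).
  (* Here [ln u / 4] exceeds [K], whereas [F u < F 1] and the monotone series force it below [K];
     the [Rmax] ensures [u > 1]. *)
  set (u := exp (4 * (Rmax 0 K + 1))).
  assert (Hu : 1 < u).
  { unfold u. apply Rle_lt_trans with (exp 0); [rewrite exp_0; lra|].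
    apply exp_increasing. pose proof (Rmax_l 0 K); lra. }
  pose proof (logdet_lt_gt_1 u Hu) as B. unfold F, logdet at 1 in B.
  assert (S1 : Series (eta_term 1) <= Series (eta_term u)).
  { apply Series_le_gen. intros n. apply eta_term_incr; lra. apply Hser; lra. apply Hser; lra. }
  assert (E : ln u = 4 * (Rmax 0 K + 1)) by (unfold u; apply ln_exp).
  rewrite E in B. pose proof (Rmax_r 0 K).
  assert (EK : K = logdet alpha kappa 1 - kappa - Series (eta_term 1)) by reflexivity.
  clearbody K.
  assert (0 <= alpha * u) by (apply Rmult_le_pos; lra). lra.
Qed.

Lemma exp_logdet_small eps : 0 < eps -> exists U, 0 < U /\ forall u, U < u -> exp (F u) < eps.
Proof.
  intros He. pose proof alpha_neg as Ha.
  (* With this slope the bound [ln u <= beta u - 1 - ln beta] lets [ln u / 4] use up half of the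
     linear term; [alpha u / 2] remains and drives the limit. *)
  set (beta := - 2 * alpha). assert (Hb : 0 < beta) by (unfold beta; lra).
  set (K := (- 1 - ln beta) / 4 + kappa).
  exists (Rmax 1 (2 * (K - ln eps) / - alpha)). split. eapply Rlt_le_trans; [|apply Rmax_l]; lra.
  intros u HU.
  assert (U1 : 1 < u) by (eapply Rle_lt_trans; [apply Rmax_l|exact HU]).
  assert (U2 : 2 * (K - ln eps) / - alpha < u) by (eapply Rle_lt_trans; [apply Rmax_r|exact HU]).
  apply Rlt_div_l in U2; [|lra].
  rewrite <- (exp_ln eps) by exact He. apply exp_increasing.
  assert (S0 : Series (eta_term u) <= 0).
  { replace 0 with (Series (fun n => 0 * eta_term u n)) by (rewrite Series_scal_l; ring).
    apply Series_le_gen. intros n. rewrite Rmult_0_l. apply eta_term_le_0; lra. apply Hser; lra.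
    apply (ex_series_scal (V := RN)). apply Hser; lra. }
  assert (L : ln u <= beta * u - 1 - ln beta).
  { pose proof (exp_ineq1_le (ln (beta * u))) as E. rewrite exp_ln in E by nra.
    rewrite ln_mult in E by lra. lra. }
  assert (EL : beta * u = - 2 * alpha * u) by reflexivity. rewrite EL in L.
  assert (EK : K = (- 1 - ln beta) / 4 + kappa) by reflexivity.
  clearbody K beta. unfold F, logdet. lra.
Qed.

End LogDet.

Theorem theorem5 :
  (forall L : R, 0 < L -> L <> 1 -> det_laplacian L < det_laplacian 1) /\
  filterlim det_laplacian (at_right 0) (locally 0) /\
  filterlim det_laplacian (Rbar_locally p_infty) (locally 0).
Proof.
  destruct det_laplacian_formula as (alpha & kappa & H).
  (* Every [u > 0] belongs to the rectangle with [L = 1 / sqrt u], and [1 / u] to the one with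
     [1 / L]; so the facts about rectangles become facts about all [u > 0]. *)
  assert (Hu : forall u, 0 < u -> let L := / sqrt u in 0 < L /\ u = / L ^ 2 /\ / u = / (/ L) ^ 2).
  { intros u Hu L. unfold L. pose proof (sqrt_lt_R0 u Hu) as P.
    assert (E : sqrt u ^ 2 = u) by (apply pow2_sqrt; lra).
    split. apply Rinv_0_lt_compat, P. split.
    rewrite pow_inv, E, Rinv_inv. reflexivity. rewrite Rinv_inv, E. reflexivity. }
  assert (Hser : forall u, 0 < u -> ex_series (eta_term u)).
  { intros u Hu0. destruct (Hu u Hu0) as (HL & E & _). apply (H _ u HL E). }
  assert (Hsym : forall u, 0 < u -> logdet alpha kappa (/ u) = logdet alpha kappa u).
  { intros u Hu0. destruct (Hu u Hu0) as (HL & E & E').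
    destruct (H _ u HL E) as (_ & D1 & D2).
    destruct (H (/ (/ sqrt u)) (/ u) ltac:(apply Rinv_0_lt_compat, HL) E') as (_ & D3 & _).
    apply exp_inv. rewrite <- D1, <- D3. exact D2. }
  assert (Small : forall eps, 0 < eps -> exists d, 0 < d /\ forall L, 0 < L -> L < d -> Rabs (det_laplacian L) < eps).
  { intros eps He. destruct (exp_logdet_small alpha kappa Hser Hsym eps He) as (U & HU & HB).
    exists (/ sqrt U). pose proof (sqrt_lt_R0 U HU) as P. split. apply Rinv_0_lt_compat, P.
    intros L HL Hd. destruct (H L (/ L ^ 2) HL eq_refl) as (_ & D1 & _).
    rewrite D1, Rabs_pos_eq by apply Rlt_le, exp_pos. apply HB.
    rewrite <- (pow2_sqrt U) by lra. rewrite <- pow_inv.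
    assert (sqrt U < / L). { rewrite <- (Rinv_inv (sqrt U)). apply Rinv_lt_contravar; [|exact Hd]. apply Rmult_lt_0_compat. exact HL. apply Rinv_0_lt_compat, P. }
    nra. }
  split; [|split].
  - intros L HL N1.
    destruct (H L (/ L ^ 2) HL eq_refl) as (_ & D1 & _).
    destruct (H 1 1 Rlt_0_1 ltac:(field)) as (_ & D2 & _).
    rewrite D1, D2. apply exp_increasing. apply (logdet_lt_1 alpha kappa Hser Hsym).
    apply Rinv_0_lt_compat, pow_lt, HL.
    intros E. apply N1. assert (L ^ 2 = 1) by (rewrite <- (Rinv_inv (L ^ 2)), E; apply Rinv_1). nra.
  - apply filterlim_locally. intros [eps He]. destruct (Small eps He) as (d & Hd & HB).
    exists (mkposreal d Hd). intros L HLd HL.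
    change (Rabs (det_laplacian L - 0) < eps). rewrite Rminus_0_r. apply HB. exact HL.
    change (Rabs (L - 0) < d) in HLd. rewrite Rminus_0_r in HLd. apply Rabs_def2 in HLd. lra.
  - apply filterlim_locally. intros [eps He]. destruct (Small eps He) as (d & Hd & HB).
    (* The limit at infinity is the one at 0 read through [L -> 1 / L], since [L > 1 / d] means
       [1 / L < d]. *)
    exists (/ d). intros L HL.
    assert (Hid : 0 < / d) by (apply Rinv_0_lt_compat, Hd).
    assert (HL0 : 0 < L) by lra.
    change (Rabs (det_laplacian L - 0) < eps). rewrite Rminus_0_r.
    destruct (H L (/ L ^ 2) HL0 eq_refl) as (_ & _ & D). rewrite <- D. apply HB.
    apply Rinv_0_lt_compat, HL0. rewrite <- (Rinv_inv d). apply Rinv_lt_contravar; [|exact HL]. apply Rmult_lt_0_compat; lra.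
Qed.
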